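(* Let $\beta>0$ and $1\le p<2$, and let $R=(r_1,r_2)$ be a non-degenerate ground state of the elliptic system $$-\tfrac12 \partial_{xx} r_1+r_1=r_1^{2p+1}+\beta r_1^{p}r_2^{p+1},\qquad -\tfrac12 \partial_{xx} r_2+r_2=r_2^{2p+1}+\beta r_2^{p}r_1^{p+1}\quad\text{in }\mathbb{R}.$$ Then $R$ is isolated, in the sense that there exists $\delta>0$ such that every ground state $S$ of the system with $\|R-S\|_{H^1\times H^1}<\delta$ coincides with $R$ up to a translation and a phase change, i.e. there are $x_0\in\mathbb{R}$ and $\theta_1,\theta_2\in\mathbb{R}$ with $S=\big(e^{\mathrm{i}\theta_1}r_1(\cdot-x_0),e^{\mathrm{i}\theta_2}r_2(\cdot-x_0)\big)$.
   Context: Norm: $\|\Phi\|_{H^1\times H^1}^2=\|\partial_x\Phi\|_2^2+\|\Phi\|_2^2$, where $\|\Phi\|_2^2=\|\phi_1\|_2^2+\|\phi_2\|_2^2$. Energy: $\mathcal{E}(V)=\frac12\|\partial_xV\|_2^2-\frac1{p+1}\int_{\mathbb{R}}\big(|v_1|^{2p+2}+|v_2|^{2p+2}+2\beta|v_1v_2|^{p+1}\big)\,dx$ for $V=(v_1,v_2)$. Action: $\mathcal{I}(V)=\mathcal{E}(V)+\|V\|_2^2$. Ground state: a solution $R=(r_1,r_2)\in H^1(\mathbb{R},\mathbb{R})^2$, $R\neq(0,0)$, with nonnegative components, of the elliptic system, having least action $\mathcal{I}$ among all such nonzero solutions. As standing facts (known for $1\le p<2$), a ground state $R$ is taken with $r_i\in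 C^2(\mathbb{R})\cap W^{2,s}(\mathbb{R})$ for every $s$, $r_i\ge 0$ even, decreasing on $(0,\infty)$ and exponentially decaying, and it satisfies $\mathcal{E}(R)=\inf\{\mathcal{E}(V): V\in H^1\times H^1,\ \|V\|_2=\|R\|_2\}$. Non-degenerate: the set of solutions $(\phi,\psi)\in H^1(\mathbb{R},\mathbb{R})^2$ of the linearized system $$-\tfrac12\partial_{xx}\phi+\phi=[(2p+1)r_1^{2p}+\beta p\,r_1^{p-1}r_2^{p+1}]\phi+\beta(p+1)r_1^pr_2^p\psi,$$ $$-\tfrac12\partial_{xx}\psi+\psi=[(2p+1)r_2^{2p}+\beta p\,r_1^{p+1}r_2^{p-1}]\psi+\beta(p+1)r_1^pr_2^p\phi$$ in $\mathbb{R}$ is a $1$-dimensional vector space, and every solution is of the form $\theta\,\partial_xR$ with $\theta\in\mathbb{R}$. (Convention: $r^{p-1}=1$ when $p=1$.) *)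

(* Defs.v *)
From HB Require Import structures.
From mathcomp Require Import all_boot all_order all_algebra.
From mathcomp Require Import all_classical all_reals all_analysis.
From mathcomp Require Import complex.

Set Implicit Arguments.
Unset Strict Implicit.
Unset Printing Implicit Defensive.
Import Order.TTheory GRing.Theory Num.Theory.
Import numFieldNormedType.Exports.
Import ComplexField.Normc.

Local Open Scope classical_set_scope.
Local Open Scope ring_scope.
Local Open Scope complex_scope.

(* Elements of Lebesgue and Sobolev spaces are represented by functions; two
   representatives of the same element are equal almost everywhere, so all
   equalities between such elements are stated almost everywhere. Test functions
   are taken of class C^1 with compact support, as is usual in one dimension. *)

Definition test_fun (R : realType) (f : R -> R) : Prop :=
  [/\ forall x, derivable f x 1,
      continuous (derive1 f) &
      exists M : R, forall x, M <= `|x| -> f x = 0].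

Definition is_weak_deriv (R : realType) (u g : R -> R) : Prop :=
  [/\ locally_integrable setT u,
      locally_integrable setT g &
      forall f, test_fun f ->
        (\int[lebesgue_measure]_x (u x * derive1 f x) =
         - \int[lebesgue_measure]_x (g x * f x))%R].

(* A weak derivative is unique almost everywhere; [wderiv u] is a choice of
   representative, and the zero function if [u] has no weak derivative. *)
Definition wderiv (R : realType) (u : R -> R) : R -> R :=
  xget (fun=> 0) [set g | is_weak_deriv u g].

(* The Sobolev spaces W^{1,s}(R) and W^{2,s}(R), for 1 <= s <= +oo. *)
Definition W1 (R : realType) (s : \bar R) (u : R -> R) : Prop :=
  [/\ u \in Lfun lebesgue_measure s,
      is_weak_deriv u (wderiv u) &
      wderiv u \in Lfun lebesgue_measure s].

Definition W2 (R : realType) (s : \bar R) (u : R -> R) : Prop :=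
  W1 s u /\ W1 s (wderiv u).

Definition H1 (R : realType) (u : R -> R) : Prop := W1 2%:E u.

Definition H1C (R : realType) (v : R -> R[i]) : Prop :=
  H1 (fun x => complex.Re (v x)) /\ H1 (fun x => complex.Im (v x)).

Definition wderivC (R : realType) (v : R -> R[i]) : R -> R[i] :=
  fun x => wderiv (fun y => complex.Re (v y)) x +i*
           wderiv (fun y => complex.Im (v y)) x.

Definition rpair (R : realType) : Type := ((R -> R) * (R -> R))%type.
Definition cpair (R : realType) : Type := ((R -> R[i]) * (R -> R[i]))%type.

Definition pairC (R : realType) (r : rpair R) : cpair R :=
  (fun x => (r.1 x)%:C, fun x => (r.2 x)%:C).

Definition subp (R : realType) (V W : cpair R) : cpair R :=
  (fun x => V.1 x - W.1 x, fun x => V.2 x - W.2 x).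

Definition derivp (R : realType) (V : cpair R) : cpair R :=
  (wderivC V.1, wderivC V.2).

Definition L2norm (R : realType) (V : cpair R) : R :=
  Num.sqrt (\int[lebesgue_measure]_x (normc (V.1 x) ^+ 2) +
            \int[lebesgue_measure]_x (normc (V.2 x) ^+ 2))%R.

Definition H1norm (R : realType) (V : cpair R) : R :=
  Num.sqrt (L2norm (derivp V) ^+ 2 + L2norm V ^+ 2).

Definition energy (R : realType) (p beta : R) (V : cpair R) : R :=
  2^-1 * L2norm (derivp V) ^+ 2 -
  (p + 1)^-1 * (\int[lebesgue_measure]_x
     (normc (V.1 x) `^ (2 * p + 2) + normc (V.2 x) `^ (2 * p + 2) +
      2 * beta * normc (V.1 x * V.2 x) `^ (p + 1)))%R.

Definition action (R : realType) (p beta : R) (V : cpair R) : R :=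
  energy p beta V + L2norm V ^+ 2.

Definition ae_eqp (R : realType) (u v : rpair R) : Prop :=
  {ae lebesgue_measure, forall x : R, u.1 x = v.1 x /\ u.2 x = v.2 x}.

(* - u'' / 2 + u = g on R, in the weak sense. *)
Definition weak_eq (R : realType) (u g : R -> R) : Prop :=
  forall f, test_fun f ->
    (2^-1 * \int[lebesgue_measure]_x (wderiv u x * derive1 f x) +
     \int[lebesgue_measure]_x (u x * f x) =
     \int[lebesgue_measure]_x (g x * f x))%R.

Definition elliptic_solution (R : realType) (p beta : R) (r : rpair R) : Prop :=
  [/\ H1 r.1 /\ H1 r.2,
      {ae lebesgue_measure, forall x : R, 0 <= r.1 x /\ 0 <= r.2 x},
      weak_eq r.1 (fun x => r.1 x `^ (2 * p + 1) +
                            beta * r.1 x `^ p * r.2 x `^ (p + 1)) &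
      weak_eq r.2 (fun x => r.2 x `^ (2 * p + 1) +
                            beta * r.2 x `^ p * r.1 x `^ (p + 1))].

Definition nonzerop (R : realType) (r : rpair R) : Prop :=
  ~ ae_eqp r (fun=> 0, fun=> 0).

Definition ground_state (R : realType) (p beta : R) (r : rpair R) : Prop :=
  [/\ elliptic_solution p beta r, nonzerop r &
      forall s, elliptic_solution p beta s -> nonzerop s ->
        action p beta (pairC r) <= action p beta (pairC s)].

Definition regular_profile (R : realType) (u : R -> R) : Prop :=
  [/\ [/\ forall x, derivable u x 1, forall x, derivable (derive1 u) x 1 &
          continuous (derive1 (derive1 u))],
      forall s : \bar R, (1 <= s)%E -> W2 s u,
      (forall x, 0 <= u x) /\ (forall x, u (- x) = u x),
      forall x y, 0 < x -> x <= y -> u y <= u x &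
      exists C c : R, 0 < c /\ forall x, `|u x| <= C * expR (- (c * `|x|))].

Definition energy_minimizer (R : realType) (p beta : R) (r : rpair R) : Prop :=
  (energy p beta (pairC r))%:E =
  ereal_inf [set (energy p beta V)%:E | V in
    [set V : cpair R | [/\ H1C V.1, H1C V.2 & L2norm V = L2norm (pairC r)]]].

(* The normalization (centring, choice of representative) imposed on the
   reference ground state; it is not part of [ground_state], which is
   invariant under translations. *)
Definition normalized (R : realType) (p beta : R) (r : rpair R) : Prop :=
  [/\ regular_profile r.1, regular_profile r.2 & energy_minimizer p beta r].

(* Since 0 `^ 0 = 1, the convention r^{p-1} = 1 for p = 1 is built in. *)
Definition linearized_solution (R : realType) (p beta : R) (r w : rpair R) :
    Prop :=
  [/\ H1 w.1, H1 w.2,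
      weak_eq w.1 (fun x =>
        ((2 * p + 1) * r.1 x `^ (2 * p) +
         beta * p * r.1 x `^ (p - 1) * r.2 x `^ (p + 1)) * w.1 x +
        beta * (p + 1) * r.1 x `^ p * r.2 x `^ p * w.2 x) &
      weak_eq w.2 (fun x =>
        ((2 * p + 1) * r.2 x `^ (2 * p) +
         beta * p * r.1 x `^ (p + 1) * r.2 x `^ (p - 1)) * w.2 x +
        beta * (p + 1) * r.1 x `^ p * r.2 x `^ p * w.1 x)].

Definition scalep (R : realType) (c : R) (w : rpair R) : rpair R :=
  (fun x => c * w.1 x, fun x => c * w.2 x).

(* The first conjunct says that the solutions, taken modulo almost everywhere
   equality, form a 1-dimensional vector space, spanned by [e]. A function that
   is almost everywhere equal to a multiple of [e] need not be Borel measurable,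
   hence the two separate inclusions. *)
Definition nondegenerate_state (R : realType) (p beta : R) (r : rpair R) : Prop :=
  (exists e : rpair R,
     [/\ nonzerop e,
         forall c : R, linearized_solution p beta r (scalep c e) &
         forall w, linearized_solution p beta r w ->
           exists c : R, ae_eqp w (scalep c e)]) /\
  (forall w, linearized_solution p beta r w ->
     exists theta : R, ae_eqp w (scalep theta (wderiv r.1, wderiv r.2))).

Definition expi (R : realType) (theta : R) : R[i] := cos theta +i* sin theta.

Definition phase_translate (R : realType) (theta1 theta2 x0 : R) (r : rpair R) :
    cpair R :=
  (fun x => expi theta1 * (r.1 (x - x0))%:C,
   fun x => expi theta2 * (r.2 (x - x0))%:C).

Definition ae_eqpC (R : realType) (V W : cpair R) : Prop :=
  {ae lebesgue_measure, forall x : R, V.1 x = W.1 x /\ V.2 x = W.2 x}.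

(* Main.v *)
(* A solution s of the system near r is compared with r through its difference
   with r, which after normalization almost solves the linearized system.

   Weak solutions have C^2 representatives solving the system classically, and
   closeness in H^1 gives uniform closeness.  Pick a point where r' does not
   vanish, say in its i-th component; by the intermediate value theorem a
   translate of s takes there the same i-th value as r.  Were r not isolated,
   such translates s_n <> r would converge uniformly to r.  Normalize
   w_n = (s_n - r) / N_n by the Cauchy data at that point: outside a fixed
   interval |w_n|^2 is convex and bounded by its second derivative, so the w_n
   decay exponentially, uniformly in n; inside it Gronwall's inequality bounds
   them.  Pointwise limits along an ultrafilter then yield a decaying solution w
   of the linearized system with normalized Cauchy data.  Nondegeneracy gives
   w = theta r', the choice of the translation gives theta = 0, and w = 0
   contradicts the normalization. *)

Require Import Defs.
From mathcomp Require Import all_boot all_order all_algebra.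
From mathcomp Require Import all_classical all_reals all_analysis.
From mathcomp Require Import complex.
From mathcomp Require Import measurable_realfun ring lra.

Set Implicit Arguments.
Unset Strict Implicit.
Unset Printing Implicit Defensive.
Import Order.TTheory GRing.Theory Num.Theory.
Import numFieldNormedType.Exports.
Import ComplexField.Normc.
Local Open Scope classical_set_scope.
Local Open Scope ring_scope.

(** * Differential inequalities on the line *)

(** The exponent [p - 1] lies between [0] and [1], so the partial derivatives of the nonlinearity
    need not be differentiable where a component vanishes. It is therefore treated as a C^1 function
    on the closed quadrant, through strict differentiability; the strict form is what linearization
    asks for, since the values of [s_n] and of [r] both move while the coefficients are frozen at a
    point.

    Convexity at infinity comes from the vanishing of both partial derivatives at the origin: where
    [r] and [s_n] are small, the nonlinearity has Lipschitz constant [1/4], so the difference [w]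
    satisfies [w . w'' >= |w|^2 / 2], hence [(|w|^2)'' >= |w|^2]. The a priori bound on [w_n]
    degenerates when [N_n] tends to [0]; it only serves to exclude growth, and the decay constant
    comes from the Cauchy data alone. Decay of the limit places it in H^1, where nondegeneracy
    applies.

    The passage between weak and classical solutions rests on a fundamental theorem of calculus for
    weak derivatives, proved by testing with smoothed indicators of intervals whose ends are
    Lebesgue points. *)

Section RealCalculus.
Context {R : realType}.
Implicit Types f g : R -> R.

(** The derivative is carried as an explicit function, so that a second-order equation is a pair of
    such statements. *)
Definition has_deriv f (f' : R -> R) := forall x : R, is_derive x 1 f (f' x).

Lemma has_deriv_continuous f f' : has_deriv f f' -> continuous f.
Proof.
move=> df x; apply: differentiable_continuous; apply/derivable1_diffP.
exact: ex_derive.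
Qed.

Lemma has_deriv_derivable f f' x : has_deriv f f' -> derivable f x 1.
Proof. by move=> df; exact: ex_derive. Qed.

Lemma has_deriv_derive1 f f' : has_deriv f f' -> derive1 f = f'.
Proof. by move=> df; apply/funext => x; rewrite derive1E; apply: derive_val. Qed.

Lemma has_deriv_mvt f f' a b : has_deriv f f' -> a <= b ->
  exists2 c, a <= c <= b & f b - f a = f' c * (b - a).
Proof.
move=> df ab; have [||c cab E] := @MVT_segment R f f' a b ab.
- by move=> x _; exact: df.
- exact/continuous_subspaceT/(has_deriv_continuous df).
by exists c => //; move: cab; rewrite in_itv.
Qed.

Lemma has_deriv_lip f f' a b K : has_deriv f f' -> a <= b ->
  (forall c, a <= c <= b -> `|f' c| <= K) -> `|f b - f a| <= K * (b - a).
Proof.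
move=> df ab H; have [c cab ->] := has_deriv_mvt df ab.
by rewrite normrM (ger0_norm (_ : 0 <= b - a)) ?subr_ge0// ler_wpM2r ?subr_ge0// H.
Qed.

Lemma has_deriv_nondecr f f' X : has_deriv f f' ->
  (forall x, X <= x -> 0 <= f' x) ->
  forall x y, X <= x -> x <= y -> f x <= f y.
Proof.
move=> df H x y Xx xy; have [c /andP[xc _] E] := has_deriv_mvt df xy.
by rewrite -subr_ge0 E mulr_ge0 ?subr_ge0// H// (le_trans Xx).
Qed.

Lemma has_derivD f g f' g' : has_deriv f f' -> has_deriv g g' ->
  has_deriv (fun x => f x + g x) (fun x => f' x + g' x).
Proof. by move=> df dg x; have ? := df x; have ? := dg x; exact: is_deriveD. Qed.

Lemma has_derivB f g f' g' : has_deriv f f' -> has_deriv g g' ->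
  has_deriv (fun x => f x - g x) (fun x => f' x - g' x).
Proof. by move=> df dg x; have ? := df x; have ? := dg x; exact: is_deriveB. Qed.

Lemma has_derivM f g f' g' : has_deriv f f' -> has_deriv g g' ->
  has_deriv (fun x => f x * g x) (fun x => f' x * g x + f x * g' x).
Proof.
move=> df dg x; have ? := df x; have ? := dg x.
have -> : f' x * g x + f x * g' x = f x *: g' x + g x *: f' x.
  by rewrite /GRing.scale/=; ring.
exact: is_deriveM.
Qed.

Lemma has_derivZ f f' c : has_deriv f f' ->
  has_deriv (fun x => c * f x) (fun x => c * f' x).
Proof. by move=> df x; have ? := df x; exact: is_deriveZ. Qed.

Lemma has_deriv_affine f f' a b : has_deriv f f' ->
  has_deriv (fun x => f (a * x + b)) (fun x => a * f' (a * x + b)).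
Proof.
move=> df x.
have dg : is_derive x 1 (fun y : R => a * y + b) (a * 1 + 0).
  by apply: is_deriveD; exact: is_deriveZ.
have := df (a * x + b); rewrite mulr1 addr0 in dg => dfx.
have := @is_derive1_comp R f (fun y => a * y + b) x _ _ dfx dg.
by rewrite mulrC.
Qed.

Lemma has_deriv_exp c : has_deriv (fun x => expR (c * x)) (fun x => c * expR (c * x)).
Proof.
move=> x; have := @has_deriv_affine expR expR c 0 (fun y => is_derive_expR y) x.
by under eq_fun do rewrite addr0; rewrite addr0.
Qed.

Lemma has_deriv_ext f g f' g' : f =1 g -> f' =1 g' -> has_deriv f f' -> has_deriv g g'.
Proof. by move=> /funext-> /funext->. Qed.

(** The product of [f] with [expR (- C * z)] has nonpositive derivative. No sign is asked of [f]. *)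
Lemma gronwall_right f f' C x y : has_deriv f f' ->
  (forall z, f' z <= C * f z) -> x <= y -> f y <= f x * expR (C * (y - x)).
Proof.
move=> df H xy.
have dg := has_derivM df (has_deriv_exp (- C)).
have := has_deriv_mvt dg xy => -[c _ E].
have : f y * expR (- C * y) <= f x * expR (- C * x).
  rewrite -subr_le0 E mulr_le0_ge0 ?subr_ge0//.
  by have := H c; have := expR_gt0 (- C * c); nra.
have -> : C * (y - x) = C * y + - C * x by ring.
rewrite expRD => L.
have := ler_wpM2r (expR_ge0 (C * y)) L.
by rewrite -[f y * _ * _]mulrA -expRD mulNr (addrC (- _)) subrr expR0 mulr1
  -mulrA [expR (- C * x) * _]mulrC.
Qed.

Lemma gronwall f f' C x y : has_deriv f f' ->
  (forall z, `|f' z| <= C * f z) -> f y <= f x * expR (C * `|y - x|).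
Proof.
move=> df H; have [xy|yx] := leP x y.
  rewrite ger0_norm ?subr_ge0//; apply: (gronwall_right df) => // z.
  by apply: le_trans (H z); rewrite ler_norm.
rewrite ltr0_norm ?subr_lt0// opprB.
(* Going left from [x] is going right for the reflected function [z |-> f (- z)]. *)
have := @gronwall_right _ _ C (- x) (- y) (has_deriv_affine (-1) 0 df).
rewrite !addr0 !mulN1r !opprK lerN2 (addrC (- y)); apply; last exact: ltW.
move=> z; rewrite addr0 !mulN1r; apply: le_trans (H (- z)).
by rewrite -normrN ler_norm.
Qed.

(** A convex function lies above its tangents, so one positive slope would make it unbounded to the
    right. *)
Lemma bounded_convex_noninc f f' f'' X M :
  has_deriv f f' -> has_deriv f' f'' -> (forall x, X <= x -> 0 <= f'' x) ->
  (forall x, f x <= M) -> forall x, X <= x -> f' x <= 0.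
Proof.
move=> df ddf H B x Xx; rewrite leNgt; apply/negP => fx.
have up y : x <= y -> f x + f' x * (y - x) <= f y.
  move=> xy; have [c /andP[xc _] E] := has_deriv_mvt df xy.
  rewrite -lerBrDl E ler_wpM2r ?subr_ge0//.
  exact: (has_deriv_nondecr ddf H).
have Mf : 0 <= M - f x by rewrite subr_ge0.
(* At this abscissa the tangent at [x] has height [M + 1]. *)
have := up (x + (M - f x + 1) / f' x).
have p0 : 0 <= (M - f x + 1) / f' x by apply: divr_ge0; [lra|exact: ltW].
rewrite lerDl => /(_ p0).
rewrite {1}(addrC x) addrK mulrC divfK ?gt_eqF//.
by have := B (x + (M - f x + 1) / f' x); lra.
Qed.

(* [expR (- x) * (f' x + f x)] is nondecreasing on [X, +oo[; were [f' + f]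
   positive somewhere it would grow exponentially, contradicting [f' <= 0] and
   the bound on [f]. *)
Lemma exponential_decay f f' f'' X M :
  has_deriv f f' -> has_deriv f' f'' -> (forall x, 0 <= f x <= M) ->
  (forall x, X <= x -> f x <= f'' x) ->
  forall x, X <= x -> f x <= f X * expR (- (x - X)).
Proof.
move=> df ddf B H.
have f0 x : 0 <= f x by case/andP: (B x).
have fM x : f x <= M by case/andP: (B x).
have cvx x : X <= x -> 0 <= f'' x by move=> /H; apply: le_trans.
have f'0 := bounded_convex_noninc df ddf cvx fM.
pose h x := f' x + f x.
have dh : has_deriv h (fun x => f'' x + f' x) := has_derivD ddf df.
have h0 x : X <= x -> h x <= 0.
  move=> Xx; rewrite leNgt; apply/negP => hx.
  have M0 : 0 <= M by exact: le_trans (f0 x) (fM x).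
  have hh y : x <= y -> h x <= h y * expR (- (y - x)).
    move=> xy.
    have dg := has_derivM dh (has_deriv_exp (-1)).
    have [|c /andP[xc cy]] := @has_deriv_mvt _ _ x y dg; first by [].
    rewrite !mulN1r => E.
    have L : h x * expR (- x) <= h y * expR (- y).
      rewrite -subr_ge0 E mulr_ge0 ?subr_ge0//.
      have := H c (le_trans Xx xc); have := expR_gt0 (- c).
      by rewrite /h; nra.
    have := ler_wpM2r (expR_ge0 x) L.
    by rewrite -!mulrA -!expRD addNr expR0 mulr1 opprB (addrC x).
  (* At distance [M / h x], growth by [expR t >= 1 + t] brings [h] to at least [h x + M], above its
     bound [M]. *)
  have ty : x <= x + M / h x by rewrite lerDl divr_ge0// ltW.
  have := hh _ ty; rewrite (addrC x) addrK => L.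
  have L2 : h (M / h x + x) <= M.
    have := f'0 (M / h x + x); rewrite addrC (le_trans Xx ty) => /(_ isT).
    by have := fM (x + M / h x); rewrite /h; lra.
  have := expR_ge1Dx (M / h x) => L3.
  have L4 : h x * expR (M / h x) <= M.
    apply: (@le_trans _ _ (h (M / h x + x))) => //.
    have := ler_wpM2r (expR_ge0 (M / h x)) L.
    by rewrite -mulrA -expRD addNr expR0 mulr1.
  have : h x * (1 + M / h x) <= h x * expR (M / h x) by rewrite ler_pM2l.
  rewrite mulrDr mulr1 mulrCA mulfV ?gt_eqF// mulr1.
  by lra.
move=> x Xx.
(* As [f' + f <= 0] on this half-line, [f x * expR x] does not increase there. *)
have dg := has_derivM df (has_deriv_exp 1).
have [c /andP[xc cy]] := @has_deriv_mvt _ _ X x dg Xx.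
rewrite !mul1r => E.
have L : f x * expR x <= f X * expR X.
  rewrite -subr_le0 E mulr_le0_ge0 ?subr_ge0//.
  by rewrite -mulrDl mulr_le0_ge0 ?expR_ge0//; exact: h0.
have := ler_wpM2r (expR_ge0 (- x)) L.
by rewrite -!mulrA -!expRD subrr expR0 mulr1 opprB.
Qed.

End RealCalculus.

(** * Limits of second-order systems along an ultrafilter *)

Section UltrafilterLimits.
Context {R : realType}.

Lemma sqr_abs (x : R) : `|x| ^+ 2 = x ^+ 2.
Proof. by rewrite real_normK// num_real. Qed.

(** Differentiability as a first-order expansion with nonstrict inequalities, a form that survives
    pointwise limits. *)
Lemma is_derive_small (F : R -> R) (x l : R) :
  (forall k : R, 0 < k -> exists2 h : R, 0 < h &
     forall y, `|y - x| <= h -> `|F y - F x - l * (y - x)| <= k * `|y - x|) ->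
  is_derive x 1 F l.
Proof.
move=> H.
have cv : h^-1 *: (F (h *: 1 + x) - F x) @[h --> (0:R)^'] --> l.
  apply/cvgrPdist_le => e e0; have [d d0 Hd] := H e e0.
  near=> h.
  have hn0 : h != 0 by near: h; exact: nbhs_dnbhs_neq.
  have hd : `|h| <= d.
    by near: h; apply: dnbhs0_le.
  have := Hd (h *: 1 + x); rewrite addrK /GRing.scale/= mulr1 => /(_ hd).
  have h0 : 0 < `|h| by rewrite normr_gt0.
  have -> : F (h + x) - F x - l * h = - h * (l - h^-1 * (F (h + x) - F x)).
    by field.
  by rewrite normrM normrN mulrC ler_pM2r.
by split; [apply/cvg_ex; exists l | apply: cvg_lim].
Unshelve. all: by end_near. Qed.

(** The image of the ultrafilter has a cluster point in a compact segment, and an ultrafilter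
    converges to its cluster points. The same [U] serves at every point of the line, so no diagonal
    extraction is needed. *)
Lemma ultra_bounded_cvg (U : set_system nat) (UU : UltraFilter U)
  (u : nat -> R) (M : R) : (forall n, `|u n| <= M) -> exists l : R, u n @[n --> U] --> l.
Proof.
move=> uM.
have FU : ProperFilter (u n @[n --> U]) by apply: fmap_proper_filter.
have [|l [_ cl]] := @segment_compact R (- M) M (u n @[n --> U]) FU.
  have : U [set n | `[- M, M]%classic (u n)].
    by apply: filterE => n /=; rewrite in_itv/= -ler_norml; exact: uM.
  by [].
exists l => B Bl; have [//|nB] := in_ultra_setVsetC (u @^-1` B) UU.
have [y [Hy yB]] := cl (~` B) B nB Bl.
by case: (Hy yB).
Qed.

(** Equicontinuity of the derivatives at [x] makes the first-order expansions of the [f n] uniform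
    in [n], so they pass to the limit with [y] fixed. *)
Lemma limit_has_deriv (U : set_system nat) (UU : UltraFilter U)
    (f f' : nat -> R -> R) (F G : R -> R) :
  (forall n, has_deriv (f n) (f' n)) ->
  (forall x, f n x @[n --> U] --> F x) ->
  (forall x, f' n x @[n --> U] --> G x) ->
  (forall x k : R, 0 < k -> exists2 h : R, 0 < h & U [set n |
     forall y : R, `|y - x| <= h -> `|f' n y - f' n x| <= k]) ->
  has_deriv F G.
Proof.
move=> df cf cf' equi x; apply: is_derive_small => k k0.
have [h h0 Hh] := equi x k k0; exists h => // y xyh.
have cv : `|f n y - f n x - f' n x * (y - x)| @[n --> U] -->
          `|F y - F x - G x * (y - x)|.
  apply: cvg_norm; apply: cvgB; first exact: cvgB.
  by apply: cvgM; [exact: cf'|exact: cvg_cst].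
apply: (cvgr_to_le cv); near=> n.
have {}Hn : forall y, `|y - x| <= h -> `|f' n y - f' n x| <= k by near: n.
(* Subtracting the linear part turns the remainder of the expansion into an increment, to which the
   mean value inequality applies. *)
have dg : has_deriv (fun y => f n y - f' n x * y) (fun y => f' n y - f' n x).
  apply: (has_deriv_ext _ _ (has_derivB (df n) (has_derivZ (f' n x)
    (fun y => is_derive_id y 1)))) => z //=.
  by rewrite mulr1.
have -> : f n y - f n x - f' n x * (y - x) =
          (f n y - f' n x * y) - (f n x - f' n x * x) by ring.
have [xy|yx] := leP x y.
  rewrite [X in _ <= _ * X]ger0_norm ?subr_ge0//.
  apply: (has_deriv_lip dg) => // c /andP[xc cy].
  by apply: Hn; move: xyh; rewrite !ger0_norm ?subr_ge0//; lra.
rewrite distrC [X in _ <= _ * X]distrC [X in _ <= _ * X]gtr0_norm ?subr_gt0//.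
apply: (has_deriv_lip dg); first exact: ltW.
move=> c /andP[xc cy]; apply: Hn.
by move: xyh; rewrite distrC gtr0_norm ?subr_gt0// distrC ger0_norm ?subr_ge0//; lra.
Unshelve. all: by end_near. Qed.

End UltrafilterLimits.

(** * Energy estimates for second-order systems *)

Section SecondOrderSystem.
Context {R : realType}.
Variables (w1 w2 v1 v2 z1 z2 : R -> R) (K : R).
Hypothesis K0 : 0 <= K.
Hypothesis dw1 : has_deriv w1 v1.
Hypothesis dw2 : has_deriv w2 v2.
Hypothesis dv1 : has_deriv v1 z1.
Hypothesis dv2 : has_deriv v2 z2.
Hypothesis K1 : forall x, `|z1 x| <= K * (`|w1 x| + `|w2 x|).
Hypothesis K2 : forall x, `|z2 x| <= K * (`|w1 x| + `|w2 x|).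

Let E x := w1 x * w1 x + w2 x * w2 x + (v1 x * v1 x + v2 x * v2 x).

Let dE : has_deriv E (fun x => 2 * (w1 x * v1 x + w2 x * v2 x)
  + 2 * (v1 x * z1 x + v2 x * z2 x)).
Proof.
apply: (has_deriv_ext _ _ (has_derivD (has_derivD (has_derivM dw1 dw1) (has_derivM dw2 dw2))
  (has_derivD (has_derivM dv1 dv1) (has_derivM dv2 dv2)))) => // x /=; ring.
Qed.

Let normM2 (a b : R) : 2 * `|a * b| <= a * a + b * b.
Proof.
rewrite normrM; have := sqr_ge0 (`|a| - `|b|).
have -> : a * a + b * b = `|a| ^+ 2 + `|b| ^+ 2 by rewrite !sqr_abs -!expr2.
by rewrite !expr2; lra.
Qed.

Let prod_bound (v z a b : R) : `|z| <= K * (`|a| + `|b|) ->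
  2 * `|v * z| <= K * (2 * (v * v) + a * a + b * b).
Proof.
move=> zK; rewrite normrM.
have h1 : `|v| * `|z| <= `|v| * (K * (`|a| + `|b|)) by rewrite ler_wpM2l.
have h2 := ler_wpM2l K0 (normM2 v a).
have h3 := ler_wpM2l K0 (normM2 v b).
rewrite !normrM in h2 h3; lra.
Qed.

(** The squared phase-space norm [E] satisfies [|E'| <= C * E], by [2 |a b| <= a^2 + b^2] on each
    product. This gives [C = 1 + 2 K]; [3 + 8 * K] is a comfortable larger constant. *)
Lemma second_order_gronwall x y :
  w1 y * w1 y + w2 y * w2 y + (v1 y * v1 y + v2 y * v2 y) <=
  (w1 x * w1 x + w2 x * w2 x + (v1 x * v1 x + v2 x * v2 x)) * expR ((3 + 8 * K) * `|y - x|).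
Proof.
have dEn z : `|2 * (w1 z * v1 z + w2 z * v2 z)
    + 2 * (v1 z * z1 z + v2 z * z2 z)| <= (3 + 8 * K) * E z.
  have := prod_bound (v1 z) (K1 z); have := prod_bound (v2 z) (K2 z).
  have := normM2 (w1 z) (v1 z); have := normM2 (w2 z) (v2 z).
  set a1 := w1 z * v1 z; set a2 := w2 z * v2 z.
  set a3 := v1 z * z1 z; set a4 := v2 z * z2 z.
  move=> h1 h2 h3 h4.
  have t : `|2 * (a1 + a2) + 2 * (a3 + a4)| <= 2 * `|a1| + 2 * `|a2| + (2 * `|a3| + 2 * `|a4|).
    have -> : 2 * `|a1| + 2 * `|a2| + (2 * `|a3| + 2 * `|a4|) =
      2 * ((`|a1| + `|a2|) + (`|a3| + `|a4|)) by ring.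
    rewrite -mulrDr normrM (ger0_norm (ler0n _ 2)) ler_wpM2l//.
    by apply: le_trans (ler_normD _ _) _; apply: lerD; exact: ler_normD.
  have p1 : 0 <= K * (w1 z * w1 z) by rewrite mulr_ge0// -expr2 sqr_ge0.
  have p2 : 0 <= K * (w2 z * w2 z) by rewrite mulr_ge0// -expr2 sqr_ge0.
  have p3 : 0 <= K * (v1 z * v1 z) by rewrite mulr_ge0// -expr2 sqr_ge0.
  have p4 : 0 <= K * (v2 z * v2 z) by rewrite mulr_ge0// -expr2 sqr_ge0.
  have q1 : 0 <= w1 z * w1 z by rewrite -expr2 sqr_ge0.
  have q2 : 0 <= w2 z * w2 z by rewrite -expr2 sqr_ge0.
  have q3 : 0 <= v1 z * v1 z by rewrite -expr2 sqr_ge0.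
  have q4 : 0 <= v2 z * v2 z by rewrite -expr2 sqr_ge0.
  by rewrite /E; lra.
exact: (gronwall x y dE dEn).
Qed.

Lemma second_order_unique x : w1 x = 0 -> w2 x = 0 -> v1 x = 0 -> v2 x = 0 ->
  forall y, w1 y = 0 /\ w2 y = 0.
Proof.
move=> a b c d y; have := second_order_gronwall x y.
rewrite a b c d !mulr0 !addr0 mul0r -!expr2.
have := sqr_ge0 (w1 y); have := sqr_ge0 (w2 y); have := sqr_ge0 (v1 y); have := sqr_ge0 (v2 y).
move=> q1 q2 q3 q4 q5.
by split; apply/eqP; rewrite -sqrf_eq0 eq_le; apply/andP; split => //; lra.
Qed.

End SecondOrderSystem.

(** * Uniform decay and compactness of normalized sequences *)

Section Compactness.
Context {R : realType}.
Variables (w1 w2 v1 v2 z1 z2 : nat -> R -> R) (b11 b12 b21 b22 : R -> R).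
Variables (K X x0 : R).
Hypothesis X0 : 0 <= X.
Hypothesis K0 : 0 <= K.
Hypothesis dw1 : forall n, has_deriv (w1 n) (v1 n).
Hypothesis dw2 : forall n, has_deriv (w2 n) (v2 n).
Hypothesis dv1 : forall n, has_deriv (v1 n) (z1 n).
Hypothesis dv2 : forall n, has_deriv (v2 n) (z2 n).
Hypothesis K1 : forall n x, `|z1 n x| <= K * (`|w1 n x| + `|w2 n x|).
Hypothesis K2 : forall n x, `|z2 n x| <= K * (`|w1 n x| + `|w2 n x|).
(** Half the second derivative of [w1^2 + w2^2] is [v1^2 + v2^2] plus the right-hand side here, so
    outside [[-X, X]] this second derivative dominates the function itself. *)
Hypothesis coercive : forall n x, X <= `|x| ->
  2^-1 * (w1 n x ^+ 2 + w2 n x ^+ 2) <= w1 n x * z1 n x + w2 n x * z2 n x.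
(** The bound may depend on [n]: it excludes exponential growth but enters no constant below. *)
Hypothesis bounded : forall n, exists M : R, forall x, w1 n x ^+ 2 + w2 n x ^+ 2 <= M.
Hypothesis normalized_at : forall n,
  `|w1 n x0| + `|w2 n x0| + (`|v1 n x0| + `|v2 n x0|) = 1.
(** Near [x], and for large [n], [z1 n] is a linear combination of [w1 n] and [w2 n] with
    coefficients frozen at [x]. The neighbourhood is uniform in [n], which yields equicontinuity as
    well as the limit at [x]. *)
Hypothesis lim1 : forall x k : R, 0 < k -> exists2 h : R, 0 < h & exists N, forall n (y : R),
  (N <= n)%N -> `|y - x| <= h ->
  `|z1 n y - (b11 x * w1 n y + b12 x * w2 n y)| <= k * (`|w1 n y| + `|w2 n y|).
Hypothesis lim2 : forall x k : R, 0 < k -> exists2 h : R, 0 < h & exists N, forall n (y : R),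
  (N <= n)%N -> `|y - x| <= h ->
  `|z2 n y - (b21 x * w1 n y + b22 x * w2 n y)| <= k * (`|w1 n y| + `|w2 n y|).

Let q n x := w1 n x * w1 n x + w2 n x * w2 n x.
Let E n x := q n x + (v1 n x * v1 n x + v2 n x * v2 n x).
Let C := 3 + 8 * K.

Let dq n : has_deriv (q n) (fun x => 2 * (w1 n x * v1 n x + w2 n x * v2 n x)).
Proof.
apply: (has_deriv_ext _ _ (has_derivD (has_derivM (dw1 n) (dw1 n))
  (has_derivM (dw2 n) (dw2 n)))) => // x /=; ring.
Qed.

Let ddq n : has_deriv (fun x => 2 * (w1 n x * v1 n x + w2 n x * v2 n x))
  (fun x => 2 * (v1 n x * v1 n x + v2 n x * v2 n x + (w1 n x * z1 n x + w2 n x * z2 n x))).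
Proof.
apply: (has_deriv_ext _ _ (has_derivZ 2 (has_derivD (has_derivM (dw1 n) (dv1 n))
  (has_derivM (dw2 n) (dv2 n))))) => // x /=; ring.
Qed.

(** Four nonnegative numbers of sum [1] have squares of sum at most [1], so [E n x0 <= 1]; Gronwall
    carries this to [x]. *)
Let energy_bound n x : E n x <= expR (C * `|x - x0|).
Proof.
have h := second_order_gronwall K0 (dw1 n) (dw2 n) (dv1 n) (dv2 n) (K1 n) (K2 n) x0 x.
apply: (le_trans h); rewrite -[leRHS]mul1r ler_wpM2r ?expR_ge0//.
rewrite /E /q -!expr2 -(sqr_abs (w1 _ _)) -(sqr_abs (w2 _ _)) -(sqr_abs (v1 _ _)) -(sqr_abs (v2 _ _)).
have := normalized_at n.
have := normr_ge0 (w1 n x0); have := normr_ge0 (w2 n x0).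
have := normr_ge0 (v1 n x0); have := normr_ge0 (v2 n x0).
set t1 := `|w1 _ _|; set t2 := `|w2 _ _|; set t3 := `|v1 _ _|; set t4 := `|v2 _ _|.
move=> p4 p3 p2 p1 s.
have le1 (t : R) : 0 <= t -> t <= 1 -> t ^+ 2 <= t.
  by move=> t0 t1'; rewrite expr2 ler_piMr.
by have := le1 t1 p1; have := le1 t2 p2; have := le1 t3 p3; have := le1 t4 p4; lra.
Qed.

Let q_ge0 n x : 0 <= q n x.
Proof. by rewrite addr_ge0// -expr2 sqr_ge0. Qed.

Let q_le_E n x : q n x <= E n x.
Proof. by rewrite lerDl addr_ge0// -expr2 sqr_ge0. Qed.

Let q_conv n x : X <= `|x| ->
  q n x <= 2 * (v1 n x * v1 n x + v2 n x * v2 n x + (w1 n x * z1 n x + w2 n x * z2 n x)).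
Proof.
move=> /(coercive n); rewrite /q -!expr2.
by have := sqr_ge0 (v1 n x); have := sqr_ge0 (v2 n x); lra.
Qed.

Let C0 : 0 <= C. Proof. by rewrite /C addr_ge0// mulr_ge0. Qed.

Let q_bound n : exists M : R, forall x, 0 <= q n x <= M.
Proof.
by have [M HM] := bounded n; exists M => x; rewrite q_ge0 /q -!expr2 HM.
Qed.

(** On [[-X, X]] the energy bound applies; beyond, [exponential_decay] starts from the value at [X]
    or [- X], already bounded uniformly in [n]. The bound [M], which depends on [n], does not appear
    in its conclusion. *)
Let q_decay n x : q n x <= expR (C * (X + `|x0|) + X - `|x|).
Proof.
have [M HM] := q_bound n.
have eb y : `|y| <= X -> q n y <= expR (C * (X + `|x0|)).
  move=> yX; apply: (le_trans (q_le_E n y)); apply: (le_trans (energy_bound n y)).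
  rewrite ler_expR ler_wpM2l//; apply: (le_trans (ler_normB _ _)).
  by rewrite lerD.
have [xX|Xx] := leP `|x| X.
  apply: (le_trans (eb x xX)); rewrite ler_expR -addrA lerDl subr_ge0//.
rewrite -addrA expRD; have [x_ge0|x_lt0] := leP 0 x.
  have Xx' : X <= x by rewrite ltW// -(ger0_norm x_ge0).
  have h := @exponential_decay _ _ _ _ X M (dq n) (ddq n) HM
    (fun y Xy => q_conv n (le_trans Xy (ler_norm y))) x Xx'.
  apply: (le_trans h); rewrite opprB (ger0_norm x_ge0) ler_wpM2r ?expR_ge0//.
  by apply: eb; rewrite ger0_norm.
have Xx' : X <= - x by rewrite ltW// -(ltr0_norm x_lt0).
(* The negative half-line is reduced to the positive one by reflection. *)
have dr : has_deriv (fun x => q n (- x))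
    (fun x => - (2 * (w1 n (-x) * v1 n (-x) + w2 n (-x) * v2 n (-x)))).
  apply: (has_deriv_ext _ _ (has_deriv_affine (-1) 0 (dq n))) => y /=;
  by rewrite !mulN1r !addr0.
have ddr : has_deriv (fun x => - (2 * (w1 n (-x) * v1 n (-x) + w2 n (-x) * v2 n (-x))))
    (fun x => 2 * (v1 n (-x) * v1 n (-x) + v2 n (-x) * v2 n (-x) +
                   (w1 n (-x) * z1 n (-x) + w2 n (-x) * z2 n (-x)))).
  apply: (has_deriv_ext _ _ (has_derivZ (-1) (has_deriv_affine (-1) 0 (ddq n)))) => y /=;
  by rewrite !mulN1r !addr0 ?opprK.
have HM' y : 0 <= q n (- y) <= M by exact: HM.
have cvx y : X <= y -> q n (- y) <= 2 * (v1 n (-y) * v1 n (-y) + v2 n (-y) * v2 n (-y) +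
                   (w1 n (-y) * z1 n (-y) + w2 n (-y) * z2 n (-y))).
  by move=> Xy; apply: q_conv; rewrite normrN (le_trans Xy)// ler_norm.
have h := @exponential_decay _ _ _ _ X M dr ddr HM' cvx (- x) Xx'.
rewrite opprK in h.
apply: (le_trans h); rewrite opprB (ltr0_norm x_lt0) ler_wpM2r ?expR_ge0//.
by apply: eb; rewrite normrN ger0_norm.
Qed.

(** The square root of the constant of [q_decay], which bounds squares; this is also where the rate
    [1/2] comes from. *)
Let a := expR ((C * (X + `|x0|) + X) / 2).

Let w_decay_aux (t u : R) n x : t * t + u * u = q n x ->
  `|t| <= a * expR (- (2^-1 * `|x|)).
Proof.
move=> tu; have := q_decay n x.
have -> : C * (X + `|x0|) + X - `|x| =
   ((C * (X + `|x0|) + X) / 2 + - (2^-1 * `|x|)) +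
   ((C * (X + `|x0|) + X) / 2 + - (2^-1 * `|x|)) by field.
rewrite expRD (expRD (_ / 2)) -/a => H.
have tt : `|t| ^+ 2 <= (a * expR (- (2^-1 * `|x|))) ^+ 2.
  rewrite sqr_abs [leRHS]expr2; apply: le_trans H; rewrite -tu expr2.
  by rewrite lerDl -expr2 sqr_ge0.
by rewrite -(@ler_pXn2r _ 2)// nnegrE mulr_ge0 ?expR_ge0.
Qed.

Let w1_decay n x : `|w1 n x| <= a * expR (- (2^-1 * `|x|)).
Proof. exact: (@w_decay_aux _ (w2 n x)). Qed.

Let w2_decay n x : `|w2 n x| <= a * expR (- (2^-1 * `|x|)).
Proof. by apply: (@w_decay_aux _ (w1 n x) n); rewrite addrC. Qed.

Let D := a * (2 + 2 * K).

(** On the unit interval from [x] away from the origin, the mean value theorem gives a point [c]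
    where [|v c|] is the increment of [w], and [z] controls [v c - v x]. Moving away from the origin
    only decreases the majorant. The increment costs [2 * a], the change of [v] costs [2 * K * a]:
    hence [D]. *)
Let v_decay_aux (w v z : R -> R) x : has_deriv w v -> has_deriv v z ->
  (forall x : R, `|w x| <= a * expR (- (2^-1 * `|x|))) ->
  (forall x : R, `|z x| <= K * (2 * (a * expR (- (2^-1 * `|x|))))) ->
  `|v x| <= D * expR (- (2^-1 * `|x|)).
Proof.
move=> dw dv hw hz.
have mono (y : R) : `|x| <= `|y| -> a * expR (- (2^-1 * `|y|)) <= a * expR (- (2^-1 * `|x|)).
  by move=> xy; rewrite ler_wpM2l ?expR_ge0// ler_expR lerN2 ler_wpM2l ?invr_ge0.
have main (c y : R) : `|w y - w x| = `|v c| -> `|v c - v x| <= K * (2 * (a * expR (- (2^-1 * `|x|)))) ->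
   `|x| <= `|y| -> `|v x| <= D * expR (- (2^-1 * `|x|)).
  move=> e1 e2 /mono xy.
  have t : `|v x| <= `|v c| + `|v c - v x|.
    by have := ler_normB (v c) (v c - v x); rewrite opprB addrC subrK.
  have s : `|v c| <= `|w y| + `|w x| by rewrite -e1 ler_normB.
  by have := hw y; have := hw x; rewrite /D; lra.
have [x_ge0|x_lt0] := leP 0 x.
  have [|c /andP[xc cx] e] := @has_deriv_mvt _ _ _ x (x + 1) dw; first by rewrite lerDl.
  apply: (main c (x + 1)).
  - by rewrite e addrC addKr mulr1.
  - have [|y /andP[xy yc] e2] := @has_deriv_mvt _ _ _ x c dv; first by [].
    rewrite e2 normrM; apply: (@le_trans _ _ (`|z y| * 1)).
      by rewrite ler_wpM2l// ger0_norm ?subr_ge0//; lra.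
    rewrite mulr1; apply: (le_trans (hz y)).
  rewrite (ler_wpM2l K0)// (ler_wpM2l (ler0n _ 2))//.
    by apply: mono; rewrite !ger0_norm// (le_trans x_ge0).
  - by rewrite !ger0_norm// ?lerDl// addr_ge0.
have [|c /andP[xc cx] e] := @has_deriv_mvt _ _ _ (x - 1) x dw; first by rewrite gerBl.
apply: (main c (x - 1)).
- by rewrite distrC e opprB addrC subrK mulr1.
- have [|y /andP[xy yc] e2] := @has_deriv_mvt _ _ _ c x dv; first by [].
  rewrite distrC e2 normrM; apply: (@le_trans _ _ (`|z y| * 1)).
    by rewrite ler_wpM2l// ger0_norm ?subr_ge0//; lra.
  rewrite mulr1; apply: (le_trans (hz y)).
  rewrite (ler_wpM2l K0)// (ler_wpM2l (ler0n _ 2))//.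
  by apply: mono; rewrite !ler0_norm; lra.
- by rewrite !ler0_norm; lra.
Qed.

Let z_decay (z : nat -> R -> R) n : (forall x, `|z n x| <= K * (`|w1 n x| + `|w2 n x|)) ->
  forall x, `|z n x| <= K * (2 * (a * expR (- (2^-1 * `|x|)))).
Proof.
move=> h x; apply: (le_trans (h x)); rewrite ler_wpM2l//.
by have := w1_decay n x; have := w2_decay n x; lra.
Qed.

Let v1_decay n x : `|v1 n x| <= D * expR (- (2^-1 * `|x|)).
Proof. exact: (v_decay_aux x (dw1 n) (dv1 n) (w1_decay n) (@z_decay z1 n (K1 n))). Qed.

Let v2_decay n x : `|v2 n x| <= D * expR (- (2^-1 * `|x|)).
Proof. exact: (v_decay_aux x (dw2 n) (dv2 n) (w2_decay n) (@z_decay z2 n (K2 n))). Qed.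

Let a0 : 0 <= a. Proof. exact: expR_ge0. Qed.

Let aD : a <= D.
Proof. by rewrite /D; have := mulr_ge0 a0 K0; have := a0; lra. Qed.

Let D0 : 0 <= D. Proof. exact: le_trans a0 aD. Qed.

Let exp_le1 (x : R) : expR (- (2^-1 * `|x|)) <= 1.
Proof. by rewrite -[leRHS]expR0 ler_expR oppr_le0 mulr_ge0// invr_ge0. Qed.

Let le_D (t x c : R) : c <= D -> `|t| <= c * expR (- (2^-1 * `|x|)) -> `|t| <= D.
Proof.
move=> cD /le_trans; apply; rewrite -[leRHS]mulr1.
apply: (@le_trans _ _ (D * expR (- (2^-1 * `|x|)))).
  by rewrite ler_wpM2r// expR_ge0.
by rewrite ler_wpM2l.
Qed.

Let bw1 n x : `|w1 n x| <= D. Proof. exact: le_D (w1_decay n x). Qed.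
Let bw2 n x : `|w2 n x| <= D. Proof. exact: le_D (w2_decay n x). Qed.
Let bv1 n x : `|v1 n x| <= D. Proof. exact: le_D (v1_decay n x). Qed.
Let bv2 n x : `|v2 n x| <= D. Proof. exact: le_D (v2_decay n x). Qed.

Let bz (z : nat -> R -> R) n x : `|z n x| <= K * (`|w1 n x| + `|w2 n x|) ->
  `|z n x| <= K * (D + D).
Proof. by move/le_trans; apply; rewrite ler_wpM2l// lerD. Qed.

Let lipschitz (f f' : nat -> R -> R) (L : R) : (forall n, has_deriv (f n) (f' n)) ->
  (forall n x, `|f' n x| <= L) -> forall n x y, `|f n y - f n x| <= L * `|y - x|.
Proof.
move=> df bf n x y; have [xy|yx] := leP x y.
  by rewrite [X in _ * X]ger0_norm ?subr_ge0//; apply: (has_deriv_lip (df n)).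
rewrite distrC [X in _ * X]distrC [X in _ * X]gtr0_norm ?subr_gt0//.
by apply: (has_deriv_lip (df n)) => //; exact: ltW.
Qed.

Let equi_lip (f : nat -> R -> R) (L : R) (U : set_system nat) : Filter U ->
  (forall n x y, `|f n y - f n x| <= L * `|y - x|) -> 0 <= L ->
  forall x k : R, 0 < k -> exists2 h : R, 0 < h & U [set n |
     forall y : R, `|y - x| <= h -> `|f n y - f n x| <= k].
Proof.
move=> FU lf L0 x k k0; exists (k / (L + 1)); first by rewrite divr_gt0// ltr_wpDl.
apply: filterE => n y yx; apply: (le_trans (lf n x y)).
apply: (@le_trans _ _ ((L + 1) * (k / (L + 1)))).
  by rewrite ler_pM ?lerDl.
by rewrite mulrC divfK// gt_eqF// ltr_wpDl.
Qed.

(** Since the [w] are bounded by [D], the relative error in the hypothesis becomes an absolute one.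
    Equicontinuity of [z] then follows from the Lipschitz bounds on [w1] and [w2]. *)
Let lim_z (z : nat -> R -> R) (b c : R -> R) (U : set_system nat) (W1 W2 : R -> R) :
  UltraFilter U -> \oo `<=` U ->
  (forall x k : R, 0 < k -> exists2 h : R, 0 < h & exists N, forall n (y : R),
    (N <= n)%N -> `|y - x| <= h ->
    `|z n y - (b x * w1 n y + c x * w2 n y)| <= k * (`|w1 n y| + `|w2 n y|)) ->
  (forall x, w1 n x @[n --> U] --> W1 x) ->
  (forall x, w2 n x @[n --> U] --> W2 x) ->
  (forall x, z n x @[n --> U] --> b x * W1 x + c x * W2 x) /\
  (forall x k : R, 0 < k -> exists2 h : R, 0 < h & U [set n |
     forall y : R, `|y - x| <= h -> `|z n y - z n x| <= k]).
Proof.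
move=> UU ooU lz c1 c2.
have lz' x k : 0 < k -> exists2 h, 0 < h & exists N, forall n (y : R),
    (N <= n)%N -> `|y - x| <= h -> `|z n y - (b x * w1 n y + c x * w2 n y)| <= k.
  move=> k0; have D1 : 0 < 2 * D + 1 by rewrite ltr_wpDl// mulr_ge0.
  have [|h h0 [N HN]] := lz x (k / (2 * D + 1)); first by rewrite divr_gt0.
  exists h => //; exists N => n y Nn yh; apply: (le_trans (HN n y Nn yh)).
  rewrite -mulrA ler_piMr ?(ltW k0)// mulrC ler_pdivrMr// mul1r.
  by have := bw1 n y; have := bw2 n y; lra.
split=> x.
  have cv : b x * w1 n x + c x * w2 n x @[n --> U] --> b x * W1 x + c x * W2 x.
    by apply: cvgD; apply: cvgM => //; exact: cvg_cst.
  apply/cvgrPdist_le => e e0.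
  have e20 : 0 < e / 2 by rewrite divr_gt0.
  have [h h0 [N HN]] := lz' x _ e20.
  move/cvgrPdist_le : cv => /(_ _ e20) cv.
  near=> n.
  have Nn : (N <= n)%N by near: n; apply: ooU; exact: nbhs_infty_ge.
  have := HN n x Nn; rewrite subrr normr0 => /(_ (ltW h0)) A.
  have B : `|b x * W1 x + c x * W2 x - (b x * w1 n x + c x * w2 n x)| <= e / 2.
    by near: n.
  rewrite (splitr e) distrC.
  set s := b x * W1 x + _ in B *; set t := b x * w1 n x + _ in A B.
  have -> : z n x - s = (z n x - t) - (s - t) by ring.
  by apply: le_trans (ler_normB _ _) _; apply: lerD.
move=> k k0; have k40 : 0 < k / 4 by rewrite divr_gt0.
have [h h0 [N HN]] := lz' x _ k40.
have L0 : 0 <= (`|b x| + `|c x|) * D by rewrite mulr_ge0// addr_ge0.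
have L1 : 0 < (`|b x| + `|c x|) * D + 1 by rewrite ltr_wpDl.
have h'0 : 0 < k / 2 / ((`|b x| + `|c x|) * D + 1) by rewrite !divr_gt0.
exists (Num.min h (k / 2 / ((`|b x| + `|c x|) * D + 1))); first by rewrite lt_min h0.
near=> n => y; rewrite le_min => /andP[yh yh'].
have Nn : (N <= n)%N by near: n; apply: ooU; exact: nbhs_infty_ge.
have A := HN n y Nn yh.
have := HN n x Nn; rewrite subrr normr0 => /(_ (ltW h0)) B.
have P : `|b x * (w1 n y - w1 n x) + c x * (w2 n y - w2 n x)| <= k / 2.
  apply: (le_trans (ler_normD _ _)); rewrite !normrM.
  have l1 := ler_wpM2l (normr_ge0 (b x)) (lipschitz dw1 bv1 n x y).
  have l2 := ler_wpM2l (normr_ge0 (c x)) (lipschitz dw2 bv2 n x y).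
  apply: (@le_trans _ _ (((`|b x| + `|c x|) * D + 1) * `|y - x|)).
    by have := normr_ge0 (y - x); lra.
  by rewrite mulrC -ler_pdivlMr.
rewrite (_ : z n y - z n x = (z n y - (b x * w1 n y + c x * w2 n y)) -
  (z n x - (b x * w1 n x + c x * w2 n x)) +
  (b x * (w1 n y - w1 n x) + c x * (w2 n y - w2 n x))); last by ring.
apply: (le_trans (ler_normD _ _)).
have := ler_normB (z n y - (b x * w1 n y + c x * w2 n y))
  (z n x - (b x * w1 n x + c x * w2 n x)).
by lra.
Unshelve. all: by end_near. Qed.

Let limit_le (U : set_system nat) (UU : UltraFilter U) (f : nat -> R -> R) (F c x : R) :
  f n x @[n --> U] --> F ->
  (forall n, `|f n x| <= c) -> `|F| <= c.
Proof.
by move=> cf fc; apply: (cvgr_to_le (cvg_norm cf)); apply: filterE.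
Qed.

(** The normalization at [x0] involves finitely many values, so pointwise limits keep it and the
    limit is not zero. The last clause keeps the vanishing of a component at [x0], which later fixes
    the multiple of [r']. *)
Lemma linearized_limit : exists W1 W2 V1 V2 : R -> R,
  [/\ has_deriv W1 V1 /\ has_deriv W2 V2,
      has_deriv V1 (fun x => b11 x * W1 x + b12 x * W2 x) /\
      has_deriv V2 (fun x => b21 x * W1 x + b22 x * W2 x),
      exists2 c : R, 0 <= c & forall x,
       [/\ `|W1 x| <= c * expR (- (2^-1 * `|x|)), `|W2 x| <= c * expR (- (2^-1 * `|x|)),
           `|V1 x| <= c * expR (- (2^-1 * `|x|)) & `|V2 x| <= c * expR (- (2^-1 * `|x|))],
      `|W1 x0| + `|W2 x0| + (`|V1 x0| + `|V2 x0|) = 1 &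
      ((forall n : nat, w1 n x0 = 0) -> W1 x0 = 0) /\
      ((forall n : nat, w2 n x0 = 0) -> W2 x0 = 0)].
Proof.
(* [U] refines [\oo], so whatever holds for all large [n] holds along [U]. *)
have [U [UU ooU]] := ultraFilterLemma (_ : ProperFilter (\oo : set_system nat)).
have /choice[W1 c1] x := ultra_bounded_cvg UU (bw1^~ x).
have /choice[W2 c2] x := ultra_bounded_cvg UU (bw2^~ x).
have /choice[V1 c3] x := ultra_bounded_cvg UU (bv1^~ x).
have /choice[V2 c4] x := ultra_bounded_cvg UU (bv2^~ x).
have [cz1 ez1] := lim_z UU ooU lim1 c1 c2.
have [cz2 ez2] := lim_z UU ooU lim2 c1 c2.
have KD : 0 <= K * (D + D) by rewrite mulr_ge0// addr_ge0.
have FU : Filter U by exact: ultra_proper.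
exists W1, W2, V1, V2; split.
- split.
    apply: (limit_has_deriv UU dw1 c1 c3); apply: equi_lip.
      exact: (lipschitz dv1 (fun n x => bz (K1 n x))).
    by [].
  apply: (limit_has_deriv UU dw2 c2 c4); apply: equi_lip.
    exact: (lipschitz dv2 (fun n x => bz (K2 n x))).
  by [].
- by split; [apply: (limit_has_deriv UU dv1 c3 cz1)|apply: (limit_has_deriv UU dv2 c4 cz2)].
- exists D => // x.
  have aDx : a * expR (- (2^-1 * `|x|)) <= D * expR (- (2^-1 * `|x|)).
    by rewrite ler_wpM2r ?expR_ge0.
  split.
  + by apply: (limit_le UU (c1 x)) => n; exact: le_trans (w1_decay n x) aDx.
  + by apply: (limit_le UU (c2 x)) => n; exact: le_trans (w2_decay n x) aDx.
  + by apply: (limit_le UU (c3 x)) => n; exact: v1_decay.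
  + by apply: (limit_le UU (c4 x)) => n; exact: v2_decay.
- have cv : `|w1 n x0| + `|w2 n x0| + (`|v1 n x0| + `|v2 n x0|) @[n --> U] -->
    `|W1 x0| + `|W2 x0| + (`|V1 x0| + `|V2 x0|).
    by apply: cvgD; apply: cvgD; apply: cvg_norm.
  move: cv; rewrite (_ : (fun n => _) = cst 1); last first.
    by apply/funext => n; exact: normalized_at.
  by move/(cvg_lim (@Rhausdorff R)) => <-; rewrite lim_cst//; exact: Rhausdorff.
- split=> h.
    move: (c1 x0); rewrite (_ : (fun n => _) = cst 0); last exact/funext.
    by move/(cvg_lim (@Rhausdorff R)) => <-; rewrite lim_cst//; exact: Rhausdorff.
  move: (c2 x0); rewrite (_ : (fun n => _) = cst 0); last exact/funext.
  by move/(cvg_lim (@Rhausdorff R)) => <-; rewrite lim_cst//; exact: Rhausdorff.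
Qed.

End Compactness.

(** * Strict differentiability of the nonlinearity *)

Section Powers.
Context {R : realType}.
Implicit Types x y u v a b M : R.

(** Continuity on the closed half-line. For [a = 0], needed when [p = 1], the power is the constant
    [1], also at [0]. *)
Lemma powR_cvg x a : 0 <= a -> 0 <= x -> forall k : R, 0 < k ->
  exists2 h : R, 0 < h &
    forall z, 0 <= z -> `|z - x| <= h -> `|z `^ a - x `^ a| <= k.
Proof.
rewrite le_eqVlt => /predU1P[<- _ k k0|a0].
  by exists 1 => // z _ _; rewrite !powRr0 subrr normr0 ltW.
rewrite le_eqVlt => /predU1P[<-|x0] k k0.
  have := @powR_cvg0 R a a0 => /cvgrPdist_le /(_ k k0) [h /= h0 H].
  exists (h / 2); first by rewrite divr_gt0.
  move=> z; rewrite le_eqVlt => /predU1P[<- _|z0].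
    by rewrite subrr normr0 ltW.
  rewrite subr0 (gtr0_norm z0) => zh.
  have := H z; rewrite /= sub0r normrN gtr0_norm// powR0 ?gt_eqF// sub0r normrN.
  by rewrite subr0; apply => //; lra.
have c : {for x, continuous (fun z : R => z `^ a)}.
  apply: differentiable_continuous; apply/derivable1_diffP.
  by apply: derivable_powR; rewrite in_itv/= x0.
move/cvgrPdist_le : c => /(_ k k0) [h /= h0 H].
exists (h / 2); first by rewrite divr_gt0.
by move=> z _ zh; rewrite distrC; apply: H; rewrite /= distrC; lra.
Qed.

(** When [x = 0] the power is differentiated only at interior, hence positive, points; at the
    endpoint continuity suffices. *)
Lemma powR_mvt x y q : 1 <= q -> 0 <= x -> x <= y ->
  exists2 z, x <= z <= y & y `^ q - x `^ q = q * z `^ (q - 1) * (y - x).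
Proof.
move=> q1 x0 xy.
have [||z zxy E] := @MVT_segment R (fun z => z `^ q) (fun z => q * z `^ (q - 1)) x y xy.
- move=> z; rewrite in_itv/= => /andP[xz zy].
  by apply: is_derive1_powR; exact: le_lt_trans xz.
- apply/subspace_continuousP => z /=; rewrite in_itv/= => /andP[xz zy].
  apply/cvgrPdist_le => e e0.
  have q0 : 0 <= q by lra.
  have [h h0 H] := powR_cvg q0 (le_trans x0 xz) e0.
  rewrite /within/=; exists h => //= t th; rewrite in_itv/= => /andP[xt ty].
  by rewrite distrC H ?(le_trans x0)// distrC ltW.
by exists z => //; move: zxy; rewrite in_itv.
Qed.

Lemma powR_mvt_sym u v q : 1 <= q -> 0 <= u -> 0 <= v ->
  exists2 z, Num.min u v <= z <= Num.max u v &
    v `^ q - u `^ q = q * z `^ (q - 1) * (v - u).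
Proof.
move=> q1 u0 v0; have [uv|vu] := leP u v; first exact: powR_mvt.
have [z zuv E] := powR_mvt q1 v0 (ltW vu); exists z => //.
by rewrite -opprB E -mulrN opprB.
Qed.

(* Strict differentiability at (x, y), relative to the closed quadrant, with
   partial derivatives a and b. *)
Definition sdiff (f : R -> R -> R) x y a b :=
  forall k : R, 0 < k -> exists2 h : R, 0 < h & forall u v u' v',
    [/\ 0 <= u, 0 <= v, 0 <= u' & 0 <= v'] ->
    [/\ `|u - x| <= h, `|v - y| <= h, `|u' - x| <= h & `|v' - y| <= h] ->
    `|f u' v' - f u v - (a * (u' - u) + b * (v' - v))| <= k * (`|u' - u| + `|v' - v|).

(** The increment is [q * z]^ (q - 1) * (u' - u)[for some]z[between]u[and]u'[, and]z [^ (q - 1)] is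
    close to its value at [x]. *)
Lemma powR_strict x q : 1 <= q -> 0 <= x -> forall k : R, 0 < k ->
  exists2 h : R, 0 < h & forall u u', 0 <= u -> 0 <= u' ->
    `|u - x| <= h -> `|u' - x| <= h ->
    `|u' `^ q - u `^ q - q * x `^ (q - 1) * (u' - u)| <= k * `|u' - u|.
Proof.
move=> q1 x0 k k0.
have q0 : 0 < q by lra.
have [||h h0 H] := @powR_cvg x (q - 1) _ x0 (k / q); [by lra|by rewrite divr_gt0|].
exists h => // u u' u0 u'0 uh u'h.
have [z /andP[z1 z2] ->] := powR_mvt_sym q1 u0 u'0.
have z0 : 0 <= z by apply: le_trans z1; rewrite le_min u0.
have zh : `|z - x| <= h.
  move: uh u'h z1 z2; rewrite !ler_norml => /andP[a1 a2] /andP[a3 a4].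
  by case: (leP u u') => _ z1 z2; apply/andP; split; lra.
rewrite -mulrBl normrM ler_wpM2r// -mulrBr normrM gtr0_norm//.
by rewrite mulrC -ler_pdivlMr//; exact: H.
Qed.

Lemma sdiff_powl x y q : 1 <= q -> 0 <= x ->
  sdiff (fun u _ => u `^ q) x y (q * x `^ (q - 1)) 0.
Proof.
move=> q1 x0 k k0; have [h h0 H] := powR_strict q1 x0 k0.
exists h => // u v u' v' [u0 _ u'0 _] [uh _ u'h _].
rewrite mul0r addr0; apply: (le_trans (H _ _ u0 u'0 uh u'h)).
by rewrite ler_wpM2l ?(ltW k0)// lerDl.
Qed.

Lemma sdiff_powr x y q : 1 <= q -> 0 <= y ->
  sdiff (fun _ v => v `^ q) x y 0 (q * y `^ (q - 1)).
Proof.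
move=> q1 y0 k k0; have [h h0 H] := powR_strict q1 y0 k0.
exists h => // u v u' v' [_ v0 _ v'0] [_ vh _ v'h].
rewrite mul0r add0r; apply: (le_trans (H _ _ v0 v'0 vh v'h)).
by rewrite ler_wpM2l ?(ltW k0)// lerDr.
Qed.

Lemma sdiffZ f x y a b c : sdiff f x y a b ->
  sdiff (fun u v => c * f u v) x y (c * a) (c * b).
Proof.
move=> df k k0; have c0 : 0 < `|c| + 1 by rewrite ltr_wpDl.
have [|h h0 H] := df (k / (`|c| + 1)); first by rewrite divr_gt0.
exists h => // u v u' v' A B; have := H _ _ _ _ A B.
have -> : c * f u' v' - c * f u v - (c * a * (u' - u) + c * b * (v' - v)) =
  c * (f u' v' - f u v - (a * (u' - u) + b * (v' - v))) by ring.
move=> h1; rewrite normrM.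
apply: (@le_trans _ _ ((`|c| + 1) * (k / (`|c| + 1) * (`|u' - u| + `|v' - v|)))).
  by rewrite ler_pM// lerDl.
by rewrite mulrA (mulrC (_ + 1)) divfK ?gt_eqF.
Qed.

Lemma sdiffD f g x y a b c d : sdiff f x y a b -> sdiff g x y c d ->
  sdiff (fun u v => f u v + g u v) x y (a + c) (b + d).
Proof.
move=> df dg k k0.
have [|h1 h10 H1] := df (k / 2); first by rewrite divr_gt0.
have [|h2 h20 H2] := dg (k / 2); first by rewrite divr_gt0.
exists (Num.min h1 h2); first by rewrite lt_min h10.
move=> u v u' v' A [].
rewrite !le_min => /andP[a1 a2] /andP[a3 a4] /andP[a5 a6] /andP[a7 a8].
have B1 := H1 u v u' v' A (And4 a1 a3 a5 a7).
have B2 := H2 u v u' v' A (And4 a2 a4 a6 a8).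
have -> : f u' v' + g u' v' - (f u v + g u v) - ((a + c) * (u' - u) + (b + d) * (v' - v))
  = (f u' v' - f u v - (a * (u' - u) + b * (v' - v))) +
    (g u' v' - g u v - (c * (u' - u) + d * (v' - v))) by ring.
by apply: (le_trans (ler_normD _ _)); lra.
Qed.

Lemma linear_le a b u v : `|a * u + b * v| <= (`|a| + `|b|) * (`|u| + `|v|).
Proof.
apply: (le_trans (ler_normD _ _)); rewrite !normrM.
have := mulr_ge0 (normr_ge0 a) (normr_ge0 v).
have := mulr_ge0 (normr_ge0 b) (normr_ge0 u).
by lra.
Qed.

(** Strict differentiability with one of the two points placed at [(x, y)] itself and tolerance
    [1]. *)
Lemma sdiff_continuous f x y a b : 0 <= x -> 0 <= y -> sdiff f x y a b ->
  forall k : R, 0 < k -> exists2 h : R, 0 < h & forall u v, 0 <= u -> 0 <= v ->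
    `|u - x| <= h -> `|v - y| <= h -> `|f u v - f x y| <= k.
Proof.
move=> x0 y0 df k k0; have [h h0 H] := df 1 ltr01.
pose c := 1 + (`|a| + `|b|).
have c0 : 0 < c by rewrite ltr_wpDr// addr_ge0.
exists (Num.min h (k / c / 2)); first by rewrite lt_min h0 !divr_gt0.
move=> u v u0 v0; rewrite !le_min => /andP[uh uk] /andP[vh vk].
have h0' := ltW h0.
have := H x y u v (And4 x0 y0 u0 v0); rewrite !subrr !normr0 => /(_ (And4 h0' h0' uh vh)) A.
have B := linear_le a b (u - x) (v - y).
have : `|f u v - f x y| <= c * (`|u - x| + `|v - y|).
  rewrite -[f u v - f x y](subrK (a * (u - x) + b * (v - y))).
  by apply: (le_trans (ler_normD _ _)); rewrite /c; lra.
move/le_trans; apply.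
apply: (@le_trans _ _ (c * (k / c))); last by rewrite mulrC divfK// gt_eqF.
by rewrite ler_wpM2l ?(ltW c0)//; lra.
Qed.

Lemma sdiffM f g x y a b c d : 0 <= x -> 0 <= y ->
  sdiff f x y a b -> sdiff g x y c d ->
  sdiff (fun u v => f u v * g u v) x y (a * g x y + f x y * c) (b * g x y + f x y * d).
Proof.
move=> x0 y0 df dg k k0.
(* [B] bounds both factors near the point, where they vary by at most [1]; [L] bounds both linear
   parts relative to the increment. *)
pose B := `|f x y| + `|g x y| + 1.
have B0 : 0 < B by rewrite ltr_wpDl// addr_ge0.
have Bf1 : `|f x y| + 1 <= B by rewrite /B lerD2r lerDl.
have Bg1 : `|g x y| + 1 <= B by rewrite /B lerD2r lerDr.
pose L := (`|a| + `|b|) + (`|c| + `|d|) + 1.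
have L0 : 0 < L by rewrite ltr_wpDl// !addr_ge0.
have Lab : `|a| + `|b| <= L by rewrite /L -addrA lerDl !addr_ge0.
have Lcd : `|c| + `|d| <= L by rewrite /L addrAC lerDr !addr_ge0.
have kB : 0 < k / 4 / B by rewrite !divr_gt0.
have kL : 0 < Num.min 1 (k / 4 / L) by rewrite lt_min ltr01 !divr_gt0.
have [h1 h10 H1] := df _ kB; have [h2 h20 H2] := dg _ kB.
have [h3 h30 H3] := sdiff_continuous x0 y0 df kL.
have [h4 h40 H4] := sdiff_continuous x0 y0 dg kL.
exists (Num.min (Num.min h1 h2) (Num.min h3 h4)); first by rewrite !lt_min h10 h20 h30.
move=> u v u' v' A; rewrite !le_min.
move=> [/andP[/andP[a1 a2] /andP[a3 a4]] /andP[/andP[b1 b2] /andP[b3 b4]]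
        /andP[/andP[c1 c2] /andP[c3 c4]] /andP[/andP[d1 d2] /andP[d3 d4]]].
have C1 := H1 u v u' v' A (And4 a1 b1 c1 d1).
have C2 := H2 u v u' v' A (And4 a2 b2 c2 d2).
have [u0 v0 u'0 v'0] := A.
have C3 := H3 u v u0 v0 a3 b3.
have C4 := H4 u' v' u'0 v'0 c4 d4.
move: C3 C4; rewrite !le_min => /andP[C3 C3'] /andP[C4 C4'].
set s := `|u' - u| + `|v' - v| in C1 C2 *.
have s0 : 0 <= s by rewrite addr_ge0.
set lf := a * (u' - u) + b * (v' - v) in C1.
set lg := c * (u' - u) + d * (v' - v) in C2.
have Llf : `|lf| <= (`|a| + `|b|) * s by exact: linear_le.
have Llg : `|lg| <= (`|c| + `|d|) * s by exact: linear_le.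
have Bf : `|f u v| <= B.
  rewrite -[f u v](subrK (f x y)) (le_trans (ler_normD _ _))// addrC.
  by apply: le_trans Bf1; rewrite lerD2l.
have Bg : `|g u' v'| <= B.
  rewrite -[g u' v'](subrK (g x y)) (le_trans (ler_normD _ _))// addrC.
  by apply: le_trans Bg1; rewrite lerD2l.
(* Two remainders times bounded factors, and two linear parts times small variations; each of the
   four terms gets a quarter of the tolerance. *)
have -> : f u' v' * g u' v' - f u v * g u v -
  ((a * g x y + f x y * c) * (u' - u) + (b * g x y + f x y * d) * (v' - v)) =
  (f u' v' - f u v - lf) * g u' v' + f u v * (g u' v' - g u v - lg) +
  (lf * (g u' v' - g x y) + (f u v - f x y) * lg) by rewrite /lf /lg; ring.
have Bs : k / 4 / B * s * B = k / 4 * s by rewrite mulrAC divfK// gt_eqF.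
have P1 : `|(f u' v' - f u v - lf) * g u' v'| <= k / 4 * s.
  by rewrite normrM -Bs ler_pM.
have P2 : `|f u v * (g u' v' - g u v - lg)| <= k / 4 * s.
  by rewrite normrM mulrC -Bs ler_pM.
have Ls : L * s * (k / 4 / L) = k / 4 * s by rewrite mulrC [k / 4 / L]mulrC
  mulrACA mulVf ?gt_eqF// mul1r mulrC mulrC.
have P3 : `|lf * (g u' v' - g x y)| <= k / 4 * s.
  by rewrite normrM -Ls ler_pM// (le_trans Llf)// ler_wpM2r.
have P4 : `|(f u v - f x y) * lg| <= k / 4 * s.
  by rewrite normrM mulrC -Ls ler_pM// (le_trans Llg)// ler_wpM2r.
have -> : k * s = (k / 4 * s + k / 4 * s) + (k / 4 * s + k / 4 * s) by field.
apply: (le_trans (ler_normD _ _)); apply: lerD; apply: (le_trans (ler_normD _ _)); exact: lerD.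
Qed.

(** A sup bound and a Lipschitz constant on the square [[0, M]^2], bundled because stability under
    products uses both. *)
Definition bounded_lip (f : R -> R -> R) M := exists2 K : R, 0 <= K &
  forall u v u' v', [/\ 0 <= u <= M, 0 <= v <= M, 0 <= u' <= M & 0 <= v' <= M] ->
    `|f u v| <= K /\ `|f u' v' - f u v| <= K * (`|u' - u| + `|v' - v|).

Lemma powR_lip q M : 1 <= q -> 0 <= M -> exists2 K : R, 0 <= K &
  forall u u', 0 <= u <= M -> 0 <= u' <= M ->
    `|u `^ q| <= K /\ `|u' `^ q - u `^ q| <= K * `|u' - u|.
Proof.
move=> q1 M0; have q0 : 0 <= q by lra.
have q10 : 0 <= q - 1 by lra.
exists (q * M `^ (q - 1) + M `^ q); first by rewrite addr_ge0 ?mulr_ge0 ?powR_ge0.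
move=> u u' /andP[u0 uM] /andP[u'0 u'M]; split.
  rewrite ger0_norm ?powR_ge0//; apply: (@le_trans _ _ (M `^ q)).
    by apply: ge0_ler_powR; rewrite ?nnegrE.
  by rewrite lerDr mulr_ge0 ?powR_ge0.
have [z /andP[z1 z2] ->] := powR_mvt_sym q1 u0 u'0.
have z0 : 0 <= z by apply: le_trans z1; rewrite le_min u0.
have zM : z <= M by apply: (le_trans z2); rewrite ge_max uM.
rewrite normrM ler_wpM2r// ger0_norm ?mulr_ge0 ?powR_ge0//.
apply: (@le_trans _ _ (q * M `^ (q - 1))); last by rewrite lerDl powR_ge0.
by rewrite ler_wpM2l//; apply: ge0_ler_powR; rewrite ?nnegrE.
Qed.

Lemma bounded_lipD f g M : bounded_lip f M -> bounded_lip g M -> bounded_lip (fun u v => f u v + g u v) M.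
Proof.
move=> [K K0 HK] [L L0 HL]; exists (K + L); first by rewrite addr_ge0.
move=> u v u' v' A; have [a1 a2] := HK _ _ _ _ A; have [b1 b2] := HL _ _ _ _ A.
split; first by apply: (le_trans (ler_normD _ _)); exact: lerD.
rewrite (_ : _ - _ = (f u' v' - f u v) + (g u' v' - g u v)); last by ring.
by apply: (le_trans (ler_normD _ _)); rewrite mulrDl; exact: lerD.
Qed.

Lemma bounded_lipM f g M : bounded_lip f M -> bounded_lip g M -> bounded_lip (fun u v => f u v * g u v) M.
Proof.
move=> [K K0 HK] [L L0 HL]; exists (2 * (K * L)); first by rewrite !mulr_ge0.
move=> u v u' v' A; have [a1 a2] := HK _ _ _ _ A; have [b1 b2] := HL _ _ _ _ A.
have [A1 A2 A3 A4] := A.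
have [b3 _] := HL _ _ _ _ (And4 A3 A4 A1 A2).
have KL := mulr_ge0 K0 L0.
have fg : `|f u v * g u v| <= K * L by rewrite normrM ler_pM.
split; first by lra.
rewrite (_ : _ - _ = (f u' v' - f u v) * g u' v' + f u v * (g u' v' - g u v)); last by ring.
apply: (le_trans (ler_normD _ _)).
have P1 : `|(f u' v' - f u v) * g u' v'| <= K * (`|u' - u| + `|v' - v|) * L.
  by rewrite normrM ler_pM.
have P2 : `|f u v * (g u' v' - g u v)| <= K * (L * (`|u' - u| + `|v' - v|)).
  by rewrite normrM ler_pM.
lra.
Qed.

Lemma bounded_lip_cst c M : bounded_lip (fun _ _ => c) M.
Proof.
exists `|c| => // u v u' v' _; split => //.
by rewrite subrr normr0 mulr_ge0// addr_ge0.
Qed.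

Lemma bounded_lip_powl q M : 1 <= q -> 0 <= M -> bounded_lip (fun u _ => u `^ q) M.
Proof.
move=> q1 M0; have [K K0 H] := powR_lip q1 M0; exists K => // u v u' v' [a b c d].
have [h1 h2] := H u u' a c; split => //; apply: (le_trans h2).
by rewrite ler_wpM2l// lerDl.
Qed.

Lemma bounded_lip_powr q M : 1 <= q -> 0 <= M -> bounded_lip (fun _ v => v `^ q) M.
Proof.
move=> q1 M0; have [K K0 H] := powR_lip q1 M0; exists K => // u v u' v' [a b c d].
have [h1 h2] := H v v' b d; split => //; apply: (le_trans h2).
by rewrite ler_wpM2l// lerDr.
Qed.

End Powers.

(** * The nonlinearity of the system and its partial derivatives *)

Section Nonlinearity.
Context {R : realType}.
Variables p beta : R.
Hypothesis p1 : 1 <= p.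

(** The second equation of the system uses the same function with its arguments exchanged. *)
Definition nonlin (u v : R) : R := u `^ (2 * p + 1) + beta * u `^ p * v `^ (p + 1).

Definition nonlin_d1 (u v : R) : R :=
  (2 * p + 1) * u `^ (2 * p) + beta * p * u `^ (p - 1) * v `^ (p + 1).

Definition nonlin_d2 (u v : R) : R := beta * (p + 1) * u `^ p * v `^ p.

(** As [1 <= p], all three exponents are at least [1], so each power is strictly differentiable up
    to the boundary of the quadrant. *)
Lemma sdiff_nonlin (x y : R) : 0 <= x -> 0 <= y ->
  sdiff nonlin x y (nonlin_d1 x y) (nonlin_d2 x y).
Proof.
move=> x0 y0.
have p1' := p1; have q1 : 1 <= 2 * p + 1 by lra.
have q2 : 1 <= p + 1 by lra.
have d1 := @sdiff_powl R x y _ q1 x0.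
have d2 := sdiffZ beta (sdiffM x0 y0 (@sdiff_powl R x y _ p1 x0) (@sdiff_powr R x y _ q2 y0)).
have := sdiffD d1 d2.
rewrite !addrK mulr0 addr0 mul0r add0r add0r.
have -> : (2 * p + 1) * x `^ (2 * p) + beta * (p * x `^ (p - 1) * y `^ (p + 1)) =
  nonlin_d1 x y by rewrite /nonlin_d1; ring.
have -> : beta * (x `^ p * ((p + 1) * y `^ p)) = nonlin_d2 x y by rewrite /nonlin_d2; ring.
congr sdiff; apply/funext => u; apply/funext => v; rewrite /nonlin; ring.
Qed.

Lemma bounded_lip_nonlin (M : R) : 0 <= M -> bounded_lip nonlin M.
Proof.
move=> M0; have p1' := p1; apply: bounded_lipD; first by apply: bounded_lip_powl => //; lra.
apply: bounded_lipM; last by apply: bounded_lip_powr => //; lra.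
by apply: bounded_lipM; [exact: bounded_lip_cst|exact: bounded_lip_powl].
Qed.

Lemma nonlin_d1_00 : nonlin_d1 0 0 = 0.
Proof.
have p1' := p1; have q1 : 2 * p != 0 by rewrite gt_eqF//; lra.
have q2 : p + 1 != 0 by rewrite gt_eqF//; lra.
by rewrite /nonlin_d1 (powR0 q1) (powR0 q2) !mulr0 addr0.
Qed.

Lemma nonlin_d2_00 : nonlin_d2 0 0 = 0.
Proof.
have p1' := p1; have q1 : p != 0 by rewrite gt_eqF//; lra.
by rewrite /nonlin_d2 (powR0 q1) !mulr0.
Qed.

Lemma continuous_nonlin (u v : R -> R) : (forall x, 0 <= u x) -> (forall x, 0 <= v x) ->
  continuous u -> continuous v -> continuous (fun x => nonlin (u x) (v x)).
Proof.
move=> u0 v0 cu cv x; apply/cvgrPdist_le => e e0.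
have [h h0 H] := sdiff_continuous (u0 x) (v0 x) (sdiff_nonlin (u0 x) (v0 x)) e0.
have /cvgrPdist_le/(_ h h0) cux := cu x.
have /cvgrPdist_le/(_ h h0) cvx := cv x.
by near=> z; rewrite distrC; apply: H => //; rewrite distrC; near: z.
Unshelve. all: by end_near. Qed.

Lemma measurable_nonlin (u v : R -> R) : measurable_fun setT u -> measurable_fun setT v ->
  measurable_fun setT (fun x => nonlin (u x) (v x)).
Proof.
move=> mu mv; apply: measurable_funD.
  exact: (measurableT_comp (measurable_powR _)).
apply: measurable_funM; last exact: (measurableT_comp (measurable_powR _)).
apply: measurable_funM => //; exact: (measurableT_comp (measurable_powR _)).
Qed.

End Nonlinearity.

(** * Locally integrable functions *)

Section LocallyIntegrable.
Context {R : realType}.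
Notation mu := (@lebesgue_measure R).
Implicit Types f g u v a b h : R -> R.

Lemma locint_integrable u (s t : R) : locally_integrable setT u ->
  mu.-integrable `[s, t] (EFin \o u).
Proof.
move=> [mu_ _ H]; apply/integrableP; split.
  by apply/measurable_EFinP; exact: measurable_funS mu_.
exact: (H `[s, t]%classic (@subsetT _ _) (@segment_compact R s t)).
Qed.

Lemma continuous_locint f : continuous f -> locally_integrable setT f.
Proof.
move=> cf; split; [exact: continuous_measurable_fun|exact: openT|].
move=> K _ cK.
by have /integrableP[_] := @continuous_compact_integrable R f K cK
  (continuous_subspaceT cf).
Qed.

Lemma locint_norm u : locally_integrable setT u ->
  locally_integrable setT (fun x => `|u x|).
Proof.
move=> [m o H]; split => //; first exact: measurableT_comp.
by move=> K KT cK; under eq_integral do rewrite normr_id; exact: H.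
Qed.

Lemma continuous_bounded_segment f (s t : R) : continuous f ->
  exists2 B : R, 0 <= B & forall x, s <= x <= t -> `|f x| <= B.
Proof.
move=> cf; have [st|ts] := leP s t; last first.
  by exists 0 => // x /andP[sx xt]; have := le_trans sx xt; rewrite leNgt ts.
have [c _ Hc] := @EVT_max R (fun x => `|f x|) s t st
  (continuous_subspaceT (fun x => cvg_norm (cf x))).
by exists `|f c| => // x xst; apply: Hc; rewrite in_itv.
Qed.

Lemma integrable_restr u (s t : R) : locally_integrable setT u ->
  mu.-integrable setT (EFin \o (u \_ `[s, t])).
Proof.
move=> lu; rewrite -restrict_EFin.
have [H _] := @integrable_mkcond _ _ _ mu `[s, t]%classic (EFin \o u) (measurable_itv _).
exact/H/locint_integrable.
Qed.

Lemma locint_mul_compact u f (M : R) : locally_integrable setT u -> continuous f ->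
  (forall x, M <= `|x| -> f x = 0) -> mu.-integrable setT (EFin \o (fun x => u x * f x)).
Proof.
move=> lu cf f0; have [B B0 HB] := continuous_bounded_segment (- M) M cf.
have [mu_ _ _] := lu.
have i1 := @integrableZl _ _ _ mu setT measurableT B _ (integrable_restr (- M) M lu).
apply: (le_integrable _ _ _ i1) => //.
  apply/measurable_EFinP; apply: measurable_funM => //.
  exact: continuous_measurable_fun.
move=> x _ /=; rewrite lee_fin !normrM (ger0_norm B0) mulrC patchE.
have [xM|Mx] := leP `|x| M.
  have xi : - M <= x <= M by rewrite -ler_norml.
  rewrite mem_set ?in_itv//; apply: ler_wpM2r => //; exact: HB.
by rewrite f0 ?(ltW Mx)// normr0 mul0r mulr_ge0.
Qed.

Lemma Rintegral_vanish f (M : R) : (forall x, M <= `|x| -> f x = 0) ->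
  (\int[mu]_x f x = \int[mu]_(x in `[- M, M]) f x)%R.
Proof.
move=> f0; rewrite [RHS]Rintegral_mkcond; apply: eq_Rintegral => x _.
rewrite patchE; case: ifPn => // /negP xM; apply: f0; rewrite leNgt.
apply/negP => /ltW; rewrite ler_norml => xM'; apply: xM.
by rewrite mem_set//= in_itv.
Qed.

Lemma ae_imp (P Q : R -> Prop) : (forall x, P x -> Q x) ->
  {ae mu, forall x, P x} -> {ae mu, forall x, Q x}.
Proof. by move=> PQ; apply: filterS => //; exact: (ae_filter_ringOfSetsType mu). Qed.

Lemma ae_imp2 (P Q S : R -> Prop) : (forall x, P x -> Q x -> S x) ->
  {ae mu, forall x, P x} -> {ae mu, forall x, Q x} -> {ae mu, forall x, S x}.
Proof. by move=> PQ; apply: filterS2 => //; exact: (ae_filter_ringOfSetsType mu). Qed.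

(** The exceptional set is open, and a nonempty open set contains a ball of positive measure. *)
Lemma ae_closed (P : R -> Prop) : closed [set x | P x] ->
  {ae mu, forall x, P x} -> forall x, P x.
Proof.
move=> cP [N [mN N0 PN]] x; apply: contrapT => nPx.
have oP : open (~` [set x | P x]) by exact: closed_openC.
have /nbhs_ballP[r /= r0 xr] := open_nbhs_nbhs (conj oP nPx).
have bN : ball x r `<=` N by apply: subset_trans PN; exact: xr.
have : (mu (ball x r) <= 0)%E.
  rewrite -N0; apply: le_measure => //; rewrite inE//; exact: measurable_ball.
rewrite lebesgue_measure_ball ?(ltW r0)// lee_fin leNgt.
by rewrite mulrn_wgt0.
Qed.

Lemma ae_exists (P : R -> Prop) : {ae mu, forall x, P x} -> exists x, P x.
Proof.
move=> H; apply: contrapT => /forallNP nP.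
have := @ae_closed (fun=> False) _ _ 0; apply.
  rewrite (_ : [set _ | _] = set0); first exact: closed0.
  by apply/seteqP; split.
by apply: ae_imp H => x /nP.
Qed.

Lemma continuous_ae_eq u v : continuous u -> continuous v ->
  {ae mu, forall x, u x = v x} -> u = v.
Proof.
move=> cu cv H; apply/funext; apply: ae_closed H.
have -> : [set x | u x = v x] = (fun x => u x - v x) @^-1` [set 0].
  apply/seteqP; split=> x /=; first by move=> ->; rewrite subrr.
  by move/eqP; rewrite subr_eq0 => /eqP.
apply: closed_comp; last exact: closed_eq.
by move=> x _; apply: cvgB; [exact: cu|exact: cv].
Qed.

Lemma continuous_ae_ge0 u : continuous u -> {ae mu, forall x, 0 <= u x} ->
  forall x, 0 <= u x.
Proof.
move=> cu H; apply: ae_closed H.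
apply: (@closed_comp _ _ u [set y : R | 0 <= y]); last exact: closed_ge.
by move=> x _; exact: cu.
Qed.

Lemma Rintegral_split u (s m t : R) : locally_integrable setT u -> s <= m -> m <= t ->
  (\int[mu]_(x in `[s, t]) u x = \int[mu]_(x in `[s, m]) u x + \int[mu]_(x in `[m, t]) u x)%R.
Proof.
move=> lu sm mt.
have := @Rintegral_itvB R u (BLeft s) (BRight t) m (locint_integrable s t lu).
rewrite !bnd_simp => /(_ sm mt).
rewrite Rintegral_itv_obnd_cbnd; last first.
  apply: integrableS (locint_integrable m t lu) => //.
  by apply: subset_itvr; rewrite bnd_simp.
by move=> <-; rewrite addrC subrK.
Qed.

(** Integrals over reversed segments are zero, so the primitive based at [0] is defined by cases.
    Near [x] it differs by a constant from the integral based at [x - 1], which is known to be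
    continuous. *)
Lemma locint_primitive u : locally_integrable setT u -> exists2 B : R -> R,
  continuous B & forall s t, s <= t -> B t - B s = (\int[mu]_(x in `[s, t]) u x)%R.
Proof.
move=> lu.
pose I s t := (\int[mu]_(x in `[s, t]) u x)%R.
pose B t := if 0 <= t then I 0 t else - I t 0.
have HB s t : s <= t -> B t - B s = I s t.
  move=> st; rewrite /B; have [s0|s0] := leP 0 s.
    by rewrite (le_trans s0 st) /I (Rintegral_split lu s0 st) addrC addKr.
  have [t0|t0] := leP 0 t.
    by rewrite opprK /I (Rintegral_split lu (ltW s0) t0) addrC.
  by rewrite opprK /I (Rintegral_split lu st (ltW t0)) addrC addrK.
exists B => // x.
have lt1 : x - 1 < x + 1 by rewrite ltrD2l; lra.
have le1 : x - 1 <= x + 1 := ltW lt1.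
have := @parameterized_integral_continuous R (x - 1) (x + 1) u le1 (locint_integrable _ _ lu).
move/(continuous_within_itvP _ lt1) => [c _ _].
have {}c : {for x, continuous (fun y => parameterized_integral mu (x - 1) y u)}.
  by apply: c; rewrite in_itv/=; apply/andP; split; lra.
have e : \forall y \near x, B (x - 1) + parameterized_integral mu (x - 1) y u = B y.
  near=> y; rewrite -[RHS](subrK (B (x - 1))) HB 1?addrC//.
  apply: ltW; near: y; apply: lt_nbhsr; lra.
have c2 : (B (x - 1) + parameterized_integral mu (x - 1) y u) @[y --> x] -->
   B (x - 1) + parameterized_integral mu (x - 1) x u.
  by apply: cvgD; [exact: cvg_cst|exact: c].
rewrite /continuous_at -(nbhs_singleton e).
by apply: cvg_trans c2; apply: near_eq_cvg; exact: e.
Unshelve. all: by end_near. Qed.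

(** Replacing [u] by its continuous version leaves the integrals unchanged and makes the fundamental
    theorem valid at every point. *)
Lemma primitive_has_deriv u v B : locally_integrable setT u -> continuous v ->
  {ae mu, forall x, u x = v x} ->
  (forall s t, s <= t -> B t - B s = (\int[mu]_(x in `[s, t]) u x)%R) ->
  has_deriv B v.
Proof.
move=> lu cv uv HB x.
have lv := continuous_locint cv.
have HBv s t : s <= t -> B t - B s = (\int[mu]_(x in `[s, t]) v x)%R.
  move=> st; rewrite HB//; congr fine; apply: ae_eq_integral => //.
  - by have /integrableP[] := locint_integrable s t lu.
  - by have /integrableP[] := locint_integrable s t lv.
  - by apply: ae_imp uv => y /= -> _.
have lt1 : x < x + 1 by rewrite ltrDl.
have lt2 : x - 1 < x by rewrite gtrBl.
have [d e] := continuous_FTC1_closed lt1 (locint_integrable (x - 1) (x + 1) lv) lt2 (cv x).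
have dF : is_derive x 1 (fun y => (\int[mu]_(t in `[(x - 1)%R, y]) v t)%R) (v x).
  by apply: (DeriveDef d); rewrite -derive1E; exact: e.
have dF' : is_derive x 1 (fun y => B (x - 1) + (\int[mu]_(t in `[(x - 1)%R, y]) v t)%R) (v x).
  by rewrite -[v x]add0r; apply: is_deriveD.
apply: (near_eq_is_derive _ dF').
have E y : x - 1 <= y -> B (x - 1) + (\int[mu]_(t in `[(x - 1)%R, y]) v t)%R = B y.
  by move=> xy; rewrite -(HBv _ _ xy) addrC subrK.
near=> y; apply: E.
apply: ltW; near: y; exact: lt_nbhsr.
Unshelve. all: by end_near. Qed.

(** At a Lebesgue point [h x] is the derivative of an integral of [h], which is constantly zero. *)
Lemma locint_null h : locally_integrable setT h ->
  (forall s t, s <= t -> (\int[mu]_(x in `[s, t]) h x)%R = 0) ->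
  {ae mu, forall x, h x = 0}.
Proof.
move=> lh h0; apply: ae_imp (lebesgue_differentiation lh) => x hx.
have lt1 : x < x + 1 by rewrite ltrDl.
have [|_ <-] := @FTC1_lebesgue_pt R h (BLeft (x - 1)) x (x + 1) lt1
  (locint_integrable (x - 1) (x + 1) lh) _ hx.
  by rewrite (@lte_fin R) gtrBl.
rewrite (_ : (fun y => _) = cst 0) ?derive1_cst//.
(* For [y < x - 1] the segment is empty, so the integral is zero there too. *)
apply/funext => y /=; have [xy|yx] := leP (x - 1) y; first exact: h0.
by rewrite set_itv_ge ?Rintegral_set0// bnd_simp -ltNge.
Qed.

End LocallyIntegrable.

(** * Weak derivatives *)

Section WeakDerivative.
Context {R : realType}.
Notation mu := (@lebesgue_measure R).
Implicit Types f g u v a b h : R -> R.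

Lemma test_fun_has_deriv f : test_fun f -> has_deriv f (derive1 f).
Proof. by move=> [d _ _] x; apply: (DeriveDef (d x)); rewrite -derive1E. Qed.

Lemma test_fun_continuous f : test_fun f -> continuous f.
Proof. by move/test_fun_has_deriv/has_deriv_continuous. Qed.

(** Enlarging the support bound by [1] makes [f] vanish in a neighbourhood of [x], so that its
    derivative vanishes too. *)
Lemma test_fun_support f : test_fun f -> exists2 M : R, 0 < M &
  forall x, M <= `|x| -> f x = 0 /\ derive1 f x = 0.
Proof.
move=> tf; have df := test_fun_has_deriv tf.
have [_ _ [M HM]] := tf.
have M0 : M < `|M| + 1 by apply: (le_lt_trans (ler_norm M)); rewrite ltrDl.
exists (`|M| + 1); first by rewrite ltr_wpDl.
move=> x Mx; have Mx' : M < `|x| by exact: lt_le_trans Mx.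
split; first by apply: HM; exact: ltW.
have d0 : is_derive x 1 f 0.
  apply: (near_eq_is_derive _ (is_derive_cst 0 x 1)).
  have c : {for x, continuous (fun y : R => `|y|)} by apply: cvg_norm; exact: cvg_id.
  near=> y; apply/esym/HM/ltW; near: y.
  by have := c; move/cvgr_gt; apply.
by have [_ <-] := d0; rewrite derive1E.
Unshelve. all: by end_near. Qed.

Lemma locint_mul_test u f : locally_integrable setT u -> test_fun f ->
  mu.-integrable setT (EFin \o (fun x => u x * f x)).
Proof.
move=> lu tf; have [M _ HM] := test_fun_support tf.
apply: (locint_mul_compact lu (test_fun_continuous tf)) => x /HM[] //.
Qed.

Lemma locint_mul_test' u f : locally_integrable setT u -> test_fun f ->
  mu.-integrable setT (EFin \o (fun x => u x * derive1 f x)).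
Proof.
move=> lu tf; have [M _ HM] := test_fun_support tf.
have [_ c _] := tf.
by apply: (locint_mul_compact lu c) => x /HM[].
Qed.

Lemma has_deriv_oo f f' (s t : R) : has_deriv f f' -> derivable_oo_LRcontinuous f s t.
Proof.
move=> df; have c := has_deriv_continuous df; split.
- by move=> x _; exact: has_deriv_derivable df.
- by apply: cvg_at_right_filter; exact: c.
- by apply: cvg_at_left_filter; exact: c.
Qed.

Lemma has_deriv_weak u v : has_deriv u v -> continuous v -> is_weak_deriv u v.
Proof.
move=> du cv; have cu := has_deriv_continuous du.
split; [exact: continuous_locint|exact: continuous_locint|move=> f tf].
have df := test_fun_has_deriv tf.
have [M M0 HM] := test_fun_support tf.
have [_ cf' _] := tf.
rewrite (@Rintegral_vanish _ _ M); last by move=> x /HM[_ ->]; rewrite mulr0.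
rewrite (@Rintegral_vanish _ (fun x => v x * f x) M); last by move=> x /HM[-> _]; rewrite mulr0.
have MM : - M < M by rewrite gtrN.
rewrite (@Rintegration_by_parts R u f v (derive1 f) (- M) M MM).
- have [-> _] := HM M (ler_norm M).
  have [-> _] : f (- M) = 0 /\ derive1 f (- M) = 0 by apply: HM; rewrite normrN ler_norm.
  by rewrite !mulr0 subrr add0r.
- exact: continuous_subspaceT.
- exact: has_deriv_oo du.
- by move=> x _; rewrite (has_deriv_derive1 du).
- exact: continuous_subspaceT.
- exact: has_deriv_oo df.
- by [].
Qed.

(* A C^1 step from 0 (on ]-oo, 0]) to 1 (on [1, +oo[), with tent-shaped
   derivative. *)
Definition ramp (x : R) : R := Num.max x 0.
Definition step (x : R) : R :=
  2 * (ramp x ^+ 2 - 2 * ramp (x - 2^-1) ^+ 2 + ramp (x - 1) ^+ 2).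
Definition tent (x : R) : R := 4 * (ramp x - 2 * ramp (x - 2^-1) + ramp (x - 1)).

Lemma ramp_cases (x : R) : (x <= 0 /\ ramp x = 0) \/ (0 <= x /\ ramp x = x).
Proof. by rewrite /ramp; case: leP => h; [left|right; split=> //; exact: ltW]. Qed.

Lemma ramp_continuous : continuous ramp.
Proof. by move=> x; apply: continuous_max; [exact: cvg_id|exact: cvg_cst]. Qed.

Lemma has_deriv_ramp2 : has_deriv (fun x => ramp x ^+ 2) (fun x => 2 * ramp x).
Proof.
move=> x; apply: is_derive_small => k k0; exists k => // y yx.
(* When [x] and [y] have opposite signs, [x * y <= 0] gives the bound; otherwise the remainder is
   [0] or [(y - x) ^+ 2]. *)
have T : `|ramp y ^+ 2 - ramp x ^+ 2 - 2 * ramp x * (y - x)| <= `|y - x| ^+ 2.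
  rewrite sqr_abs ler_norml; apply/andP.
  have := sqr_ge0 (y - x); have := sqr_ge0 x; have := sqr_ge0 y.
  case: (ramp_cases x) => -[hx ->]; case: (ramp_cases y) => -[hy ->]; rewrite !expr2 => q1 q2 q3.
  - by split; lra.
  - by have := mulr_le0_ge0 hx hy; split; lra.
  - by have := mulr_ge0_le0 hx hy; split; lra.
  - by split; lra.
by apply: (le_trans T); rewrite expr2 ler_wpM2r.
Qed.

Lemma has_deriv_step : has_deriv step tent.
Proof.
have sh c : has_deriv (fun x => ramp (x - c) ^+ 2) (fun x => 2 * ramp (x - c)).
  by apply: (has_deriv_ext _ _ (has_deriv_affine 1 (- c) has_deriv_ramp2)) => x /=;
    rewrite !mul1r.
apply: (has_deriv_ext _ _ (has_derivZ 2 (has_derivD (has_derivB has_deriv_ramp2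
  (has_derivZ 2 (sh 2^-1))) (sh 1)))) => // x; rewrite /tent /=; ring.
Qed.

Lemma tent_continuous : continuous tent.
Proof.
have sh (c : R) : continuous (fun x => ramp (x - c)).
  move=> x; apply: (@continuous_comp _ _ _ (fun x => x - c) ramp).
    by apply: cvgB; [exact: cvg_id|exact: cvg_cst].
  exact: ramp_continuous.
move=> x; apply: cvgM; first exact: cvg_cst.
apply: cvgD; last exact: sh.
apply: cvgB; first exact: ramp_continuous.
by apply: cvgM; [exact: cvg_cst|exact: sh].
Qed.

Lemma step0 (x : R) : x <= 0 -> step x = 0.
Proof.
move=> x0; rewrite /step /ramp !max_r//; first by rewrite expr0n/=; ring.
- lra.
- lra.
Qed.

Lemma step1 (x : R) : 1 <= x -> step x = 1.
Proof.
move=> x1; rewrite /step /ramp !max_l; [by field|lra|lra|lra].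
Qed.

Lemma tent0 (x : R) : x <= 0 -> tent x = 0.
Proof.
move=> x0; rewrite /tent /ramp !max_r//; first by ring.
- lra.
- lra.
Qed.

Lemma tent1 (x : R) : 1 <= x -> tent x = 0.
Proof.
move=> x1; rewrite /tent /ramp !max_l; [by field|lra|lra|lra].
Qed.

Lemma tent_bound (x : R) : 0 <= tent x <= 2.
Proof.
rewrite /tent; apply/andP.
case: (ramp_cases x) => -[h1 ->]; case: (ramp_cases (x - 2^-1)) => -[h2 ->];
  case: (ramp_cases (x - 1)) => -[h3 ->]; split; lra.
Qed.

Lemma step_bound (x : R) : 0 <= step x <= 1.
Proof.
have mono (s t : R) : s <= t -> step s <= step t.
  apply: (has_deriv_nondecr (X := s) has_deriv_step) => // y _.
  by case/andP: (tent_bound y).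
have [x0|x0] := leP x 0; first by rewrite step0// lexx ler01.
have s0 := mono 0 x (ltW x0); rewrite step0// in s0; rewrite s0/=.
have [x1|x1] := leP 1 x; first by rewrite step1.
by have := mono x 1 (ltW x1); rewrite (step1 (lexx 1)).
Qed.

(** A one-sided approximate identity: total mass [1], carried by [[c, c + 1 / (n + 1)]], with height
    at most [2 (n + 1)]. *)
Definition kernel (c : R) (n : nat) (x : R) : R := n.+1%:R * tent (n.+1%:R * (x - c)).

Lemma kernel_continuous c n : continuous (kernel c n).
Proof.
move=> x; apply: cvgM; first exact: cvg_cst.
apply: (@continuous_comp _ _ _ (fun x => n.+1%:R * (x - c)) tent); last exact: tent_continuous.
by apply: cvgM; [exact: cvg_cst|apply: cvgB; [exact: cvg_id|exact: cvg_cst]].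
Qed.

Lemma has_deriv_kernel c n : has_deriv (fun x => step (n.+1%:R * (x - c))) (kernel c n).
Proof.
by apply: (has_deriv_ext _ _ (has_deriv_affine n.+1%:R (- (n.+1%:R * c)) has_deriv_step)) => x /=;
  rewrite /kernel mulrBr.
Qed.

(** The kernel is bounded by a multiple of the inverse length of its support, so its error at [s] is
    controlled by a mean of [|a - a s|], which tends to zero at a Lebesgue point. *)
Lemma lebesgue_pt_kernel a (s : R) : locally_integrable setT a -> lebesgue_pt a s ->
  (\int[mu]_x (a x * kernel s n x))%R @[n --> \oo] --> a s.
Proof.
move=> la ls.
pose k := kernel s.
pose h n : R := n.+1%:R^-1.
have n0 n : 0 < n.+1%:R :> R by rewrite ltr0n.
have h0 n : 0 < h n by rewrite invr_gt0.
have kcont n : continuous (k n) by exact: kernel_continuous.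
have kd n : has_deriv (fun x => step (n.+1%:R * (x - s))) (k n) by exact: has_deriv_kernel.
have kout n x : ~ (s <= x <= s + h n) -> k n x = 0.
  move=> /negP; rewrite negb_and -!ltNge => /orP[xs|xs].
    by rewrite /k /kernel tent0 ?mulr0// pmulr_rle0// subr_le0 ltW.
  rewrite /k /kernel tent1 ?mulr0// mulrC -ler_pdivrMr// mul1r.
  by rewrite lerBrDl ltW.
have kb n x : `|k n x| <= 2 * n.+1%:R.
  rewrite /k /kernel normrM (ger0_norm (ltW (n0 n))) mulrC ler_wpM2r ?(ltW (n0 n))//.
  by have /andP[t0 t2] := tent_bound (n.+1%:R * (x - s)); rewrite ger0_norm.
have Ik n (g : R -> R) : (\int[mu]_x (g x * k n x) = \int[mu]_(x in `[s, (s + h n)%R]) (g x * k n x))%R.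
  rewrite [RHS]Rintegral_mkcond; apply: eq_Rintegral => x _; rewrite patchE.
  case: ifPn => // /negP xs; rewrite kout ?mulr0// => xs'; apply: xs.
  by rewrite mem_set//= in_itv.
have sh n : s < s + h n by rewrite ltrDl.
have k1 n : (\int[mu]_(x in `[s, (s + h n)%R]) k n x)%R = 1.
  rewrite /Rintegral (continuous_FTC2 (sh n) (continuous_subspaceT (@kcont n)) (has_deriv_oo _ _ (kd n))) /=.
    by rewrite subrr mulr0 (step0 (lexx 0)) (addrC s) addrK mulfV ?gt_eqF// (step1 (lexx 1)) subr0.
  by move=> x _; rewrite (has_deriv_derive1 (kd n)).
have lak : locally_integrable setT (fun x => a x - a s).
  by apply: locally_integrableB => //; apply: continuous_locint => x; exact: cvg_cst.
have kM n : exists M : R, forall x, M <= `|x| -> k n x = 0.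
  exists (`|s| + h n + 1) => x Mx; apply: kout => /andP[sx xs].
  have := ler_norm s; have := ler_norm (- s); rewrite normrN => e1 e2.
  have : `|x| <= `|s| + h n by rewrite ler_norml; apply/andP; split; have := h0 n; lra.
  by lra.
(* The open ball must contain the closed interval [[s, s + h n]], hence the radius [2 * h n]. Its
   measure is [4 * h n] and the kernel is at most [2 / h n]: the factor is [8]. *)
have bound n : `|(\int[mu]_x (a x * k n x))%R - a s| <= 8 * fine (davg a s (2 * h n)).
  rewrite Ik.
  have i1 : mu.-integrable `[s, (s + h n)%R] (EFin \o (fun x => a x * k n x)).
    have [M HM] := kM n.
    exact: (integrableS measurableT _ _ (locint_mul_compact la (@kcont n) HM)).
  have i2 : mu.-integrable `[s, (s + h n)%R] (EFin \o (fun x => a s * k n x)).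
    apply: locint_integrable; apply: continuous_locint => x.
    by apply: cvgM; [exact: cvg_cst|exact: kcont].
  have i3 : mu.-integrable `[s, (s + h n)%R] (EFin \o k n).
    by apply: locint_integrable; exact: continuous_locint.
  have -> : a s = (\int[mu]_(x in `[s, (s + h n)%R]) (a s * k n x))%R.
    by rewrite RintegralZl// k1 mulr1.
  rewrite -RintegralB//.
  under eq_Rintegral do rewrite -mulrBl.
  have i4 : mu.-integrable `[s, (s + h n)%R] (EFin \o (fun x => (a x - a s) * k n x)).
    have [M HM] := kM n.
    exact: (integrableS measurableT _ _ (locint_mul_compact lak (@kcont n) HM)).
  apply: (le_trans (le_normr_Rintegral _ i4)) => //.
  have li := locint_norm lak.
  have i5 : mu.-integrable `[s, (s + h n)%R] (EFin \o (fun x => 2 * n.+1%:R * `|a x - a s|)).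
    apply: (@integrableZl _ _ _ mu _ _ (2 * n.+1%:R) (EFin \o (fun x => `|a x - a s|))) => //.
    exact: locint_integrable.
  apply: (@le_trans _ _ (\int[mu]_(x in `[s, (s + h n)%R]) (2 * n.+1%:R * `|a x - a s|))%R).
    apply: le_Rintegral => //.
      exact: integrable_norm.
    by move=> x _; rewrite normrM mulrC ler_wpM2r.
  rewrite RintegralZl//; last exact: locint_integrable.
  rewrite /davg /iavg lebesgue_measure_ball; last by rewrite mulr_ge0// ltW.
  have ib : mu.-integrable (ball s (2 * h n)) (EFin \o (fun x => `|a x - a s|)).
    rewrite ball_itv; apply: integrableS (locint_integrable (s - 2 * h n) (s + 2 * h n) li) => //.
    exact: subset_itv_oo_cc.
  have -> : (\int[mu]_(y in ball s (2 * h n)) `|((center (a s) \o a) y)%:E| =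
     (\int[mu]_(x in ball s (2 * h n)) `|a x - a s|)%R%:E)%E.
    rewrite fineK//; apply: integrable_fin_num; [exact: measurable_ball|exact: ib].
  rewrite inver mulrn_eq0/= gt_eqF ?mulr_gt0//= -[X in _ <= 8 * X]/(_ * _).
  have -> : 8 * ((2 * h n *+ 2)^-1 * (\int[mu]_(x in ball s (2 * h n)) `|a x - a s|)%R) =
    2 * n.+1%:R * (\int[mu]_(x in ball s (2 * h n)) `|a x - a s|)%R.
    by rewrite -mulr_natr /h; field; rewrite gt_eqF.
  rewrite ler_wpM2l ?mulr_ge0// ?(ltW (n0 n))//.
  apply: fine_le.
  - by apply: integrable_fin_num => //; apply: locint_integrable li.
  - by apply: integrable_fin_num; [exact: measurable_ball|exact: ib].
  apply: ge0_subset_integral => //.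
  - exact: measurable_ball.
  - by have /integrableP[] := ib.
  - move=> x /=; rewrite in_itv/= => /andP[sx xs].
    by rewrite /ball/= distrC ger0_norm ?subr_ge0//; have := h0 n; lra.
have dav : fine (davg a s (2 * h n)) @[n --> \oo] --> (0 : R).
  apply: fine_cvg; apply: (cvge_at_rightP (davg a s) 0 0).1 ls _ _; split.
    by move=> n; rewrite mulr_gt0.
  by rewrite -(mulr0 (2 : R)); apply: cvgM; [exact: cvg_cst|exact: cvg_harmonic].
apply/cvgrPdist_le => e e0.
have e8 : 0 < e / 8 by rewrite divr_gt0.
move/cvgrPdist_le : dav => /(_ _ e8) H; near=> n.
rewrite distrC; apply: (le_trans (bound n)).
have : `|0 - fine (davg a s (2 * h n))| <= e / 8 by near: n.
by rewrite sub0r normrN => /(le_trans (ler_norm _)); lra.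
Unshelve. all: by end_near. Qed.

End WeakDerivative.

(** * Fundamental theorem of calculus for weak derivatives *)

Section WeakDerivativeUniqueness.
Context {R : realType}.
Notation mu := (@lebesgue_measure R).
Implicit Types f g u v a b h : R -> R.

Section WindowTestFunctions.
Variables (s t : R).
Hypothesis st : s < t.

Let k := @kernel R.
(** A C^1 approximation of the indicator of []s, t]], whose derivative is the difference of the
    approximate identities at [s] and [t]. *)
Let phi (n : nat) x : R := step (n.+1%:R * (x - s)) - step (n.+1%:R * (x - t)).

Let n0 (n : nat) : 0 < n.+1%:R :> R. Proof. by rewrite ltr0n. Qed.

Let kcont c n : continuous (k c n) := @kernel_continuous R c n.

Let kd c n : has_deriv (fun x => step (n.+1%:R * (x - c))) (k c n) := @has_deriv_kernel R c n.

Let kout c n x : c + 1 <= x -> step (n.+1%:R * (x - c)) = 1 /\ k c n x = 0.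
Proof.
move=> cx; have h : 1 <= n.+1%:R * (x - c).
  apply: (@le_trans _ _ (x - c)); first lra.
  by rewrite ler_peMl ?ler1n//; lra.
by rewrite /k /kernel step1// tent1// mulr0.
Qed.

Let klow c n x : x <= c -> step (n.+1%:R * (x - c)) = 0 /\ k c n x = 0.
Proof.
move=> xc; have h : n.+1%:R * (x - c) <= 0 by rewrite pmulr_rle0// subr_le0.
by rewrite /k /kernel step0// tent0// mulr0.
Qed.

Let dphi n : has_deriv (phi n) (fun x => k s n x - k t n x).
Proof. exact: has_derivB. Qed.

Let phi_test n : test_fun (phi n).
Proof.
split; first by move=> x; exact: has_deriv_derivable (dphi n).
  rewrite (has_deriv_derive1 (dphi n)) => x.
  by apply: cvgB; exact: kcont.
exists (`|s| + `|t| + 1) => x Mx.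
have := ler_norm s; have := ler_norm (- s); have := ler_norm t; have := ler_norm (- t).
rewrite !normrN => e1 e2 e3 e4; rewrite /phi.
have := normr_ge0 s; have := normr_ge0 t => p1 p2.
have [x0|x0] := leP 0 x; move: Mx.
  rewrite (ger0_norm x0) => Mx.
  by rewrite (kout n (_ : s + 1 <= x)).1 ?(kout n (_ : t + 1 <= x)).1 ?subrr//; lra.
rewrite (ltr0_norm x0) => Mx.
by rewrite (klow n (_ : x <= s)).1 ?(klow n (_ : x <= t)).1 ?subrr//; lra.
Qed.

Let phi_bound n x : `|phi n x| <= 1.
Proof.
have /andP[a1 a2] := step_bound (n.+1%:R * (x - s)).
have /andP[b1 b2] := step_bound (n.+1%:R * (x - t)).
by rewrite ler_norml /phi; apply/andP; split; lra.
Qed.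

Let phi_out n x : ~ (s <= x <= t + 1) -> phi n x = 0.
Proof.
move=> /negP; rewrite negb_and -!ltNge => /orP[xs|xt]; rewrite /phi.
  by rewrite (klow n (ltW xs)).1 (klow n (ltW (lt_trans xs st))).1 subrr.
rewrite (kout n (ltW xt)).1 (kout n (_ : s + 1 <= x)).1 ?subrr//.
by have := st; lra.
Qed.

Let step_cvg (c x : R) : step (n.+1%:R * (x - c)) @[n --> \oo] --> (if c < x then 1 else 0 : R).
Proof.
have [cx|xc] := ltP c x.
  have xc0 : 0 < x - c by rewrite subr_gt0.
  apply: cvg_near_cst; near=> n; apply/step1; rewrite -ler_pdivrMr// mul1r.
  apply: (@le_trans _ _ n%:R); last by rewrite ler_nat.
  by near: n; exact: nbhs_infty_ger.
apply: cvg_near_cst; near=> n.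
by rewrite (klow n xc).1.
Unshelve. all: by end_near. Qed.

(** Dominated convergence, with [|b|] on [[s, t + 1]] as a majorant valid for all [n]. The pointwise
    limit lives on []s, t]]; the endpoint [s] has measure zero. *)
Let phi_cvg b : locally_integrable setT b ->
  (\int[mu]_x (b x * phi n x))%R @[n --> \oo] --> (\int[mu]_(x in `[s, t]) b x)%R.
Proof.
move=> lb; have [mb _ _] := lb.
have lnb := locint_norm lb.
have cphi n : continuous (phi n) := has_deriv_continuous (dphi n).
have mphi n : measurable_fun setT (fun x => b x * phi n x).
  by apply: measurable_funM => //; exact: continuous_measurable_fun.
have i1 : mu.-integrable setT (EFin \o (b \_ `]s, t])).
  rewrite -restrict_EFin.
  have [H _] := @integrable_mkcond _ _ _ mu `]s, t]%classic (EFin \o b) (measurable_itv _).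
  apply: H; apply: integrableS (locint_integrable s t lb) => //.
  exact: subset_itv_oc_cc.
have [||_ _] := @dominated_convergence _ _ _ mu setT measurableT
  (fun n x => (b x * phi n x)%:E) (EFin \o (b \_ `]s, t]))
  (EFin \o ((fun x => `|b x|) \_ `[s, t + 1]))
  (fun n => (measurable_EFinP _ _).2 (mphi n))
  (measurable_int _ i1) _ (integrable_restr s (t + 1) lnb) _.
- apply: aeW => x _; apply: cvg_EFin; first by near=> n.
  rewrite /= patchE.
  have c : b x * phi n x @[n --> \oo] --> b x * ((if s < x then 1 else 0) - (if t < x then 1 else 0)).
    by apply: cvgM; [exact: cvg_cst|apply: cvgB; exact: step_cvg].
  rewrite [X in _ --> X](_ : _ = b x * ((if s < x then 1 else 0) - (if t < x then 1 else 0)))//.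
  case: ifPn => [|/negP xi].
    rewrite inE/= in_itv/= => /andP[-> xt]; rewrite ltNge xt/=.
    by rewrite subr0 mulr1.
  case: ifPn => sx; last first.
    by rewrite ltNge (le_trans _ (ltW st)) ?leNgt// subrr mulr0.
  case: ifPn => tx; first by rewrite subrr mulr0.
  by exfalso; apply: xi; rewrite inE/= in_itv/= sx leNgt.
- apply: aeW => x n _; rewrite /= lee_fin patchE.
  case: ifPn => [_|/negP xi]; first by rewrite normrM ler_piMr.
  rewrite phi_out ?mulr0 ?normr0// => xi'; apply: xi.
  by rewrite inE/= in_itv.
have -> : (\int[mu]_(x in `[s, t]) b x)%R = fine (\int[mu]_x (EFin \o (b \_ `]s, t])) x)%E.
  rewrite -[RHS]/((\int[mu]_x (b \_ `]s, t]) x)%R) -Rintegral_mkcond.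
  rewrite Rintegral_itv_obnd_cbnd//.
  apply: integrableS (locint_integrable s t lb) => //; exact: subset_itv_oc_cc.
move=> H; apply: fine_cvg.
rewrite fineK; last by apply: integrable_fin_num.
exact: H.
Unshelve. all: by end_near. Qed.

(** Tested against [phi n], the left side of the weak identity tends to [a s - a t] and the right
    side to minus the integral of [b]. *)
Lemma weak_deriv_lebesgue_pt a b : is_weak_deriv a b ->
  lebesgue_pt a s -> lebesgue_pt a t -> a t - a s = (\int[mu]_(x in `[s, t]) b x)%R.
Proof.
move=> [la lb H] ls lt.
have c1 : (\int[mu]_x (a x * k s n x))%R - (\int[mu]_x (a x * k t n x))%R @[n --> \oo] --> a s - a t.
  by apply: cvgB; exact: lebesgue_pt_kernel.
have kM (c : R) n : exists M : R, forall x, M <= `|x| -> k c n x = 0.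
  exists (`|c| + 1) => x Mx.
  have := ler_norm c; have := ler_norm (- c); rewrite normrN => e1 e2.
  move: Mx; have [x0|x0] := leP 0 x.
    rewrite (ger0_norm x0) => Mx.
    by rewrite (kout n (_ : c + 1 <= x)).2//; lra.
  rewrite (ltr0_norm x0) => Mx.
  by rewrite (klow n (_ : x <= c)).2//; have := normr_ge0 c; lra.
have ik (c : R) n : mu.-integrable setT (EFin \o (fun x => a x * k c n x)).
  by have [M HM] := kM c n; exact: (locint_mul_compact la (@kcont c n) HM).
have e n : (\int[mu]_x (a x * k s n x))%R - (\int[mu]_x (a x * k t n x))%R =
  - (\int[mu]_x (b x * phi n x))%R.
  rewrite -(H _ (phi_test n)) (has_deriv_derive1 (dphi n)) -RintegralB//.
  by apply: eq_Rintegral => x _; rewrite mulrBr.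
have c2 : - (\int[mu]_x (b x * phi n x))%R @[n --> \oo] --> - (\int[mu]_(x in `[s, t]) b x)%R.
  by apply: cvgN; exact: phi_cvg.
move: c1; rewrite (_ : (fun n => _) = (fun n => - (\int[mu]_x (b x * phi n x))%R)); last exact/funext.
move/(cvg_lim (@Rhausdorff R)); rewrite (cvg_lim (@Rhausdorff R) c2).
by move/(congr1 -%R); rewrite opprK opprB => ->.
Qed.

End WindowTestFunctions.

(** Almost every point is a Lebesgue point. The primitive of [b] is anchored at one of them and
    agrees with [a] at all the others. *)
Lemma weak_deriv_primitive a b : is_weak_deriv a b -> exists A : R -> R,
  [/\ continuous A, {ae mu, forall x, a x = A x} &
      forall s t, s <= t -> A t - A s = (\int[mu]_(x in `[s, t]) b x)%R].
Proof.
move=> ab; have [la lb _] := ab.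
have ael := lebesgue_differentiation la.
have [s0 ls0] := ae_exists ael.
have [B cB HB] := locint_primitive lb.
exists (fun t => a s0 + (B t - B s0)); split.
- move=> x; apply: cvgD; first exact: cvg_cst.
  by apply: cvgB; [exact: cB|exact: cvg_cst].
- apply: ae_imp ael => x lx.
  have [s0x|xs0|<-] := ltgtP s0 x; last by rewrite subrr addr0.
    have := weak_deriv_lebesgue_pt s0x ab ls0 lx.
    by rewrite -HB ?(ltW s0x)// => <-; rewrite addrC subrK.
  have := weak_deriv_lebesgue_pt xs0 ab lx ls0.
  rewrite -HB ?(ltW xs0)// => /(congr1 -%R); rewrite !opprB => <-.
  by rewrite addrC subrK.
- by move=> s t st; rewrite -HB//; ring.
Qed.

(** The two continuous representatives of [u] coincide, so [a - b] has zero integral over every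
    segment. *)
Lemma weak_deriv_unique u a b : is_weak_deriv u a -> is_weak_deriv u b ->
  {ae mu, forall x, a x = b x}.
Proof.
move=> ua ub; have [_ la _] := ua; have [_ lb _] := ub.
have [A [cA uA HA]] := weak_deriv_primitive ua.
have [B [cB uB HB]] := weak_deriv_primitive ub.
have AB : A = B.
  by apply: continuous_ae_eq => //; apply: ae_imp2 uA uB => x <- <-.
have lab : locally_integrable setT (fun x => a x - b x) by exact: locally_integrableB.
suff : {ae mu, forall x, a x - b x = 0}.
  by apply: ae_imp => x /eqP; rewrite subr_eq0 => /eqP.
apply: locint_null => // s t st; rewrite RintegralB//; try exact: locint_integrable.
by rewrite -HA// -HB// AB subrr.
Qed.

Lemma wderivP u v : is_weak_deriv u v ->
  is_weak_deriv u (wderiv u) /\ {ae mu, forall x, wderiv u x = v x}.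
Proof.
move=> uv; have uw : is_weak_deriv u (wderiv u).
  by apply: (xgetPex (fun=> 0) (P := [set g | is_weak_deriv u g])); exists v.
by split => //; exact: weak_deriv_unique uw uv.
Qed.

Lemma is_weak_derivB u v a b : is_weak_deriv u a -> is_weak_deriv v b ->
  is_weak_deriv (fun x => u x - v x) (fun x => a x - b x).
Proof.
move=> [lu la Hu] [lv lb Hv]; split.
- exact: locally_integrableB.
- exact: locally_integrableB.
move=> f tf; under eq_Rintegral do rewrite mulrBl.
under [in RHS]eq_Rintegral do rewrite mulrBl.
rewrite RintegralB//; try exact: locint_mul_test'.
rewrite [in RHS]RintegralB//; try exact: locint_mul_test.
by rewrite Hu// Hv// opprB addrC opprK.
Qed.

Lemma ae_eq_Rintegral f g : measurable_fun setT f -> measurable_fun setT g ->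
  {ae mu, forall x, f x = g x} -> (\int[mu]_x f x = \int[mu]_x g x)%R.
Proof.
move=> mf mg fg; congr fine; apply: ae_eq_integral => //.
- exact/measurable_EFinP.
- exact/measurable_EFinP.
- by apply: ae_imp fg => x /= -> _.
Qed.

(** Measurability of [f] is a separate hypothesis because almost everywhere equality does not
    transfer it. *)
Lemma ae_eq_locint f g : measurable_fun setT f ->
  {ae mu, forall x, f x = g x} -> locally_integrable setT g -> locally_integrable setT f.
Proof.
move=> mf fg [mg oT H]; split => // K KT cK.
have mK : measurable K by exact: compact_measurable.
rewrite (_ : (\int[mu]_(x in K) `|f x|%:E = \int[mu]_(x in K) `|g x|%:E)%E); first exact: H.
apply: ae_eq_integral => //.
- by apply/measurable_EFinP; apply: measurableT_comp => //; exact: measurable_funS mf.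
- by apply/measurable_EFinP; apply: measurableT_comp => //; exact: measurable_funS mg.
- by apply: ae_imp fg => x /= -> _.
Qed.

Lemma ae_eq_integrable f g : measurable_fun setT f ->
  {ae mu, forall x, f x = g x} -> mu.-integrable setT (EFin \o g) ->
  mu.-integrable setT (EFin \o f).
Proof.
move=> mf fg /integrableP[mg H]; apply/integrableP; split; first exact/measurable_EFinP.
rewrite (_ : (\int[mu]_x `|(EFin \o f) x| = \int[mu]_x `|(EFin \o g) x|)%E)//.
apply: ae_eq_integral => //.
- by apply: measurableT_comp => //; exact/measurable_EFinP.
- exact: measurableT_comp.
- by apply: ae_imp fg => x /= -> _.
Qed.

End WeakDerivativeUniqueness.

(** * Sobolev spaces and regularity *)

Section Sobolev.
Context {R : realType}.
Notation mu := (@lebesgue_measure R).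
Implicit Types f g u v w : R -> R.

(** By symmetry this reduces to the half-line, where the function is the exponential density of rate
    [1]. *)
Lemma integrable_exp_abs : mu.-integrable setT (EFin \o (fun x : R => expR (- `|x|))).
Proof.
have c : continuous (fun x : R => expR (- `|x|)).
  move=> x; apply: (@continuous_comp _ _ _ (fun x : R => - `|x|) expR); last exact: continuous_expR.
  by apply: cvgN; apply: cvg_norm; exact: cvg_id.
apply/integrableP; split; first by apply/measurable_EFinP; exact: continuous_measurable_fun.
under eq_integral do rewrite /= ger0_norm ?expR_ge0//.
rewrite ge0_symfun_integralT//; last by move=> x /=; rewrite normrN.
apply: lte_mul_pinfty => //.
have i1 := @integral_exponential_pdf R 1 ltr01.
have mp : measurable [set x : R | 0 <= x] by rewrite -set_itvcy.
apply: (@le_lt_trans _ _ (\int[mu]_x (exponential_pdf 1 x)%:E)%E); last by rewrite i1 ltry.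
rewrite (_ : (\int[mu]_(x in [set x : R | (0 <= x)%R]) (expR (- `|x|))%:E =
  \int[mu]_(x in [set x : R | (0 <= x)%R]) (exponential_pdf 1 x)%:E)%E).
  apply: ge0_subset_integral => //.
    by apply/measurable_EFinP; exact: measurable_exponential_pdf.
  by move=> x _; rewrite lee_fin exponential_pdf_ge0.
apply: eq_integral => x; rewrite inE/= => x0; congr EFin.
by rewrite exponential_pdfE// mul1r mulN1r ger0_norm.
Qed.

Lemma Lfun2P f : f \in Lfun mu 2%:E <->
  measurable_fun setT f /\ mu.-integrable setT (EFin \o (fun x => f x ^+ 2)).
Proof.
split=> [lf|[mf /integrableP[_ H]]].
  split; last exact: Lfun2_integrable_sqr.
  by move: lf; rewrite inE => /andP[+ _]; rewrite inE.
rewrite inE; apply/andP; split; rewrite inE//= /finite_norm unlock.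
apply: poweR_lty; apply: le_lt_trans H.
rewrite le_eqVlt; apply/orP; left; apply/eqP; apply: eq_integral => x _ /=.
by rewrite powR_mulrn// normrX.
Qed.

Lemma Lfun2_ae f g : measurable_fun setT f -> {ae mu, forall x, f x = g x} ->
  g \in Lfun mu 2%:E -> f \in Lfun mu 2%:E.
Proof.
move=> mf fg /Lfun2P[mg ig]; apply/Lfun2P; split => //.
apply: ae_eq_integrable ig; first exact: measurable_funX.
by apply: ae_imp fg => x ->.
Qed.

Lemma decay_Lfun2 w (c : R) : continuous w ->
  (forall x, `|w x| <= c * expR (- (2^-1 * `|x|))) -> w \in Lfun mu 2%:E.
Proof.
move=> cw hw; have mw := continuous_measurable_fun cw.
apply/Lfun2P; split => //.
have i := @integrableZl _ _ _ mu setT measurableT (c ^+ 2) _ integrable_exp_abs.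
apply: (le_integrable _ _ _ i) => //.
  by apply/measurable_EFinP; exact: measurable_funX.
move=> x _ /=; rewrite lee_fin (ger0_norm (sqr_ge0 _)).
rewrite (ger0_norm (mulr_ge0 (sqr_ge0 c) (expR_ge0 _))).
have -> : c ^+ 2 * expR (- `|x|) = (c * expR (- (2^-1 * `|x|))) ^+ 2.
  rewrite exprMn; congr (_ * _); rewrite expr2 -expRD; congr expR; by field.
rewrite -(sqr_abs (w x)) ler_pXn2r ?nnegrE ?normr_ge0//.
exact: le_trans (hw x).
Qed.

Lemma H1_decay w v (c : R) : has_deriv w v -> continuous v ->
  (forall x, `|w x| <= c * expR (- (2^-1 * `|x|))) ->
  (forall x, `|v x| <= c * expR (- (2^-1 * `|x|))) -> H1 w.
Proof.
move=> dw cv hw hv; have [wd ae] := wderivP (has_deriv_weak dw cv).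
split => //; first exact: decay_Lfun2 (has_deriv_continuous dw) hw.
apply: Lfun2_ae ae (decay_Lfun2 cv hv).
by have [_ [m _ _] _] := wd.
Qed.

Lemma H1_weak u : H1 u -> is_weak_deriv u (wderiv u). Proof. by case. Qed.

Lemma is_weak_deriv_measurable u v : is_weak_deriv u v ->
  measurable_fun setT u /\ measurable_fun setT v.
Proof. by move=> [[m1 _ _] [m2 _ _] _]. Qed.

Lemma Lfun2B u v : u \in Lfun mu 2%:E -> v \in Lfun mu 2%:E ->
  (fun x => u x - v x) \in Lfun mu 2%:E.
Proof.
move=> /Lfun2P[mu_ iu] /Lfun2P[mv iv]; apply/Lfun2P.
have muv : measurable_fun setT (fun x => u x - v x) by exact: measurable_funB.
split => //.
have i := @integrableZl _ _ _ mu setT measurableT 2 _ (integrableD measurableT iu iv).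
apply: (le_integrable _ _ _ i) => //; first by apply/measurable_EFinP; exact: measurable_funX.
move=> x _ /=; rewrite lee_fin (ger0_norm (sqr_ge0 _)).
have u0 := sqr_ge0 (u x); have v0 := sqr_ge0 (v x).
rewrite (ger0_norm (mulr_ge0 (ler0n _ 2) (addr_ge0 u0 v0))).
by have := sqr_ge0 (u x + v x); rewrite !expr2; lra.
Qed.

Lemma H1B u v : H1 u -> H1 v -> H1 (fun x => u x - v x).
Proof.
move=> [lu wu lu'] [lv wv lv'].
have [wd ae] := wderivP (is_weak_derivB wu wv).
have [md mwd] := is_weak_deriv_measurable wd.
split => //.
  exact: Lfun2B.
apply: Lfun2_ae ae _ => //.
exact: Lfun2B.
Qed.

Lemma H1_sqr_integrable u : H1 u ->
  mu.-integrable setT (EFin \o (fun x => u x ^+ 2)) /\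
  mu.-integrable setT (EFin \o (fun x => wderiv u x ^+ 2)).
Proof. by move=> [/Lfun2P[_ h1] _ /Lfun2P[_ h2]]. Qed.

Local Open Scope complex_scope.

Lemma H1norm_real (u1 u2 v1 v2 : R -> R) : H1 u1 -> H1 u2 -> H1 v1 -> H1 v2 ->
  H1norm (subp (pairC (u1, u2)) (pairC (v1, v2))) ^+ 2 =
  ((\int[mu]_x (wderiv (fun y => u1 y - v1 y) x ^+ 2) +
   \int[mu]_x (wderiv (fun y => u2 y - v2 y) x ^+ 2)) +
  (\int[mu]_x ((u1 x - v1 x) ^+ 2) + \int[mu]_x ((u2 x - v2 x) ^+ 2)))%R.
Proof.
move=> hu1 hu2 hv1 hv2.
have sq (a b : R) : normc (a +i* b) ^+ 2 = a ^+ 2 + b ^+ 2.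
  by rewrite /normc sqr_sqrtr// addr_ge0// sqr_ge0.
rewrite /H1norm sqr_sqrtr; last by rewrite addr_ge0// sqr_ge0.
rewrite /L2norm !sqr_sqrtr; try by rewrite addr_ge0//; apply: Rintegral_ge0 => x _; exact: sqr_ge0.
congr (_ + _).
  have main u v : H1 u -> H1 v -> (\int[mu]_x (normc (wderivC (fun x => (u x)%:C - (v x)%:C) x) ^+ 2) =
      \int[mu]_x (wderiv (fun y => u y - v y) x ^+ 2))%R.
    move=> hu hv; have [_ m1] := is_weak_deriv_measurable (H1_weak (H1B hu hv)).
    (* The imaginary parts are zero functions, but [wderiv] of zero is a chosen representative,
       known to vanish only almost everywhere. *)
    have d0 : has_deriv (fun=> 0 : R) (fun=> 0 : R) by move=> x; exact: is_derive_cst.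
    have c0 := has_deriv_continuous d0.
    have [w0 ae0] := wderivP (has_deriv_weak d0 c0).
    have [_ m0] := is_weak_deriv_measurable w0.
    have e x : normc (wderivC (fun x => (u x)%:C - (v x)%:C) x) ^+ 2 =
      wderiv (fun y => u y - v y) x ^+ 2 + wderiv (fun=> 0 : R) x ^+ 2.
      rewrite /wderivC sq; congr (_ ^+ 2 + _ ^+ 2); congr (wderiv _ x); apply/funext => y /=.
      by rewrite subr0.
    under eq_Rintegral do rewrite e.
    apply: ae_eq_Rintegral.
    - by apply: measurable_funD; exact: measurable_funX.
    - exact: measurable_funX.
    - by apply: ae_imp ae0 => x ->; rewrite expr0n/= addr0.
  by congr (_ + _); exact: main.
congr (_ + _); apply: eq_Rintegral => x _ /=.
  by rewrite sq !oppr0 addr0 (expr0n _ 2) addr0.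
by rewrite sq !oppr0 addr0 (expr0n _ 2) addr0.
Qed.

Lemma ge0_Rintegral_le f (s t : R) : (forall x, 0 <= f x) ->
  mu.-integrable setT (EFin \o f) ->
  (\int[mu]_(x in `[s, t]) f x <= \int[mu]_x f x)%R.
Proof.
move=> f0 fi; apply: fine_le.
- apply: integrable_fin_num => //; exact: integrableS fi.
- exact: integrable_fin_num.
- apply: ge0_subset_integral => //; first by have /integrableP[] := fi.
  by move=> x _; rewrite lee_fin.
Qed.

(* The bound [|d| <= e + d ^+ 2 / e] on a unit interval replaces Cauchy-Schwarz. *)
Lemma sobolev_sup (d d' D : R -> R) (e : R) : 0 < e -> is_weak_deriv d d' ->
  mu.-integrable setT (EFin \o (fun x => d x ^+ 2)) ->
  mu.-integrable setT (EFin \o (fun x => d' x ^+ 2)) ->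
  continuous D -> {ae mu, forall x, d x = D x} ->
  (forall s t, s <= t -> D t - D s = (\int[mu]_(x in `[s, t]) d' x)%R) ->
  (\int[mu]_x (d' x ^+ 2) + \int[mu]_x (d x ^+ 2) <= e ^+ 2)%R ->
  forall x, `|D x| <= 3 * e.
Proof.
move=> e0 wd i1 i2 cD dD HD le_e x.
have [ld ld' _] := wd.
have [md md'] := is_weak_deriv_measurable wd.
have am (y : R) : `|y| <= e + e^-1 * y ^+ 2.
  rewrite -(ler_pM2l e0) mulrDr mulVKf ?gt_eqF// -expr2 -(sqr_abs y).
  have := sqr_ge0 (`|y| - e); have := sqr_ge0 `|y|; have := sqr_ge0 e.
  by rewrite !expr2; lra.
have xx1 : x <= x + 1 by rewrite lerDl.
have m1 : fine (mu `[x, x + 1]) = 1.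
  by rewrite lebesgue_measure_itv/= lte_fin ltrDl ltr01 -EFinB/= addrAC subrr add0r.
have sqb f : mu.-integrable setT (EFin \o (fun x => f x ^+ 2)) -> locally_integrable setT f ->
  (\int[mu]_(y in `[x, x + 1]) `|f y| <= e + e^-1 * \int[mu]_y (f y ^+ 2))%R.
  move=> fi lf.
  have fi1 : mu.-integrable `[x, x + 1] (EFin \o (fun x => f x ^+ 2)) by exact: integrableS fi.
  have ci : mu.-integrable `[x, x + 1] (EFin \o (cst e)).
    by apply: locint_integrable; apply: continuous_locint => y; exact: cvg_cst.
  have fi2 : mu.-integrable `[x, x + 1] (EFin \o (fun x => e^-1 * f x ^+ 2)).
    exact: (@integrableZl _ _ _ mu _ _ e^-1 _ fi1).
  apply: (@le_trans _ _ (\int[mu]_(y in `[x, x + 1]) (e + e^-1 * f y ^+ 2))%R).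
    apply: le_Rintegral => //.
      exact: locint_integrable (locint_norm lf).
    have := @integrableD _ _ _ mu `[x, x + 1]%classic (measurable_itv _) _ _ ci fi2; exact.
  rewrite RintegralD// Rintegral_cst// m1 mulr1 lerD2l RintegralZl//.
  rewrite ler_wpM2l ?invr_ge0 ?(ltW e0)//; apply: ge0_Rintegral_le => // y.
  exact: sqr_ge0.
have step (y : R) : x <= y <= x + 1 -> `|D x| <= `|D y| + (e + e^-1 * (\int[mu]_y (d' y ^+ 2))%R).
  move=> /andP[xy yx].
  have h : `|D y - D x| <= e + e^-1 * (\int[mu]_y (d' y ^+ 2))%R.
    rewrite HD//; apply: (le_trans (le_normr_Rintegral _ (locint_integrable _ _ ld'))) => //.
    apply: le_trans (sqb _ i2 ld').
    have ln := locint_norm ld'.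
    rewrite (Rintegral_split ln xy yx) lerDl; exact: Rintegral_ge0.
  have := ler_normB (D y) (D y - D x); rewrite opprB addrC subrK.
  by lra.
have lD : locally_integrable setT (fun x => `|D x|).
  exact/locint_norm/continuous_locint.
set c := e + e^-1 * (\int[mu]_y (d' y ^+ 2))%R in step.
have p (y : R) : y \in `[x, x + 1] -> `|D x| <= `|D y| + c by rewrite in_itv/= => /step.
(* The bound of [|D x|] by [|D y| + c] is averaged over [y] in an interval of length [1]. *)
have : (\int[mu]_(y in `[x, x + 1]) `|D x| <= \int[mu]_(y in `[x, x + 1]) (`|D y| + c))%R.
  have j1 : mu.-integrable `[x, x + 1] (EFin \o (cst `|D x|)).
    by apply: locint_integrable; apply: continuous_locint => y; exact: cvg_cst.
  have j2 : mu.-integrable `[x, x + 1] (EFin \o (fun y => `|D y| + c)).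
    apply: locint_integrable; apply: continuous_locint => y.
    by apply: cvgD; [apply: cvg_norm; exact: cD|exact: cvg_cst].
  by apply: le_Rintegral; [exact: measurable_itv|exact: j1|exact: j2|exact: p].
rewrite Rintegral_cst// m1 mulr1 RintegralD//; last 2 first.
- exact: locint_integrable.
- by apply: (@locint_integrable _ (cst c)); apply: continuous_locint => y; exact: cvg_cst.
rewrite Rintegral_cst// m1 mulr1.
have -> : (\int[mu]_(y in `[x, x + 1]) `|D y| = \int[mu]_(y in `[x, x + 1]) `|d y|)%R.
  congr fine; apply: ae_eq_integral => //.
  - by have /integrableP[] := locint_integrable x (x + 1) lD.
  - by have /integrableP[] := locint_integrable x (x + 1) (locint_norm ld).
  - by apply: ae_imp dD => y /= -> _.
(* Each of the two unit-interval bounds contributes [e], and the two square integrals divided by [e]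
   add up to at most [e]: in all [3 * e]. *)
have := sqb _ i1 ld; rewrite /c => h1 h2.
have h3 : e^-1 * ((\int[mu]_y (d' y ^+ 2))%R + (\int[mu]_y (d y ^+ 2))%R) <= e.
  by rewrite mulrC ler_pdivrMr// -expr2.
rewrite mulrDr in h3; move: h1 h2 h3; clear.
set I1 := Rintegral _ _ _; set I2 := e^-1 * _; set I3 := e^-1 * _; set x0 := `|D x|.
by move=> h1 h2 h3; lra.
Qed.

(** The weak equation says that [wderiv u] has the weak derivative [2 u - 2 g]. Its continuous
    representative [V] is then C^1, and [U], a primitive of [wderiv u], has derivative [V]. *)
Lemma weak_eq_classical u g (U G : R -> R) : H1 u -> weak_eq u g -> measurable_fun setT g ->
  continuous U -> {ae mu, forall x, u x = U x} ->
  (forall s t, s <= t -> U t - U s = (\int[mu]_(x in `[s, t]) wderiv u x)%R) ->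
  continuous G -> {ae mu, forall x, g x = G x} ->
  exists V : R -> R, [/\ has_deriv U V, has_deriv V (fun x => 2 * U x - 2 * G x) &
    {ae mu, forall x, wderiv u x = V x}].
Proof.
move=> hu eq mg cU uU HU cG gG.
have wu := H1_weak hu; have [lu lu' _] := wu.
have [mu_ mu'] := is_weak_deriv_measurable wu.
have lg : locally_integrable setT g := ae_eq_locint mg gG (continuous_locint cG).
have l2 : locally_integrable setT (fun x => 2 * u x - 2 * g x).
  apply: (@ae_eq_locint _ _ (fun x => 2 * U x - 2 * G x)).
  - by apply: measurable_funB; apply: measurable_funM.
  - by apply: ae_imp2 uU gG => x -> ->.
  - apply: continuous_locint => x; apply: cvgB; apply: cvgM; try exact: cvg_cst.
      exact: cU.
    exact: cG.
have w2 : is_weak_deriv (wderiv u) (fun x => 2 * u x - 2 * g x).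
  split => // f tf; have := eq f tf.
  have iu := locint_mul_test lu tf; have ig := locint_mul_test lg tf.
  have -> : (\int[mu]_x ((2 * u x - 2 * g x) * f x) =
    2 * (\int[mu]_x (u x * f x) - \int[mu]_x (g x * f x)))%R.
    rewrite -RintegralB// -RintegralZl//; last exact: (integrableB measurableT iu ig).
    by apply: eq_Rintegral => x _; ring.
  by move=> <-; field.
have [V [cV uV HV]] := weak_deriv_primitive w2.
exists V; split => //.
  exact: (primitive_has_deriv lu' cV uV HU).
apply: (primitive_has_deriv l2 _ _ HV).
  move=> x; apply: cvgB; apply: cvgM; try exact: cvg_cst.
    exact: cU.
  exact: cG.
by apply: ae_imp2 uU gG => x -> ->.
Qed.

Lemma classical_weak_eq w v g : has_deriv w v -> has_deriv v (fun x => 2 * w x - 2 * g x) ->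
  continuous g -> weak_eq w g.
Proof.
move=> dw dv cg f tf.
have cw := has_deriv_continuous dw; have cv := has_deriv_continuous dv.
have cr : continuous (fun x => 2 * w x - 2 * g x).
  move=> x; apply: cvgB; apply: cvgM; try exact: cvg_cst.
    exact: cw.
  exact: cg.
have [wd ae] := wderivP (has_deriv_weak dw cv).
have [_ mwd] := is_weak_deriv_measurable wd.
have [_ _ H] := has_deriv_weak dv cr.
have [_ cf' _] := tf.
have -> : (\int[mu]_x (wderiv w x * derive1 f x) = \int[mu]_x (v x * derive1 f x))%R.
  apply: ae_eq_Rintegral.
  - by apply: measurable_funM => //; exact: continuous_measurable_fun.
  - by apply: measurable_funM => //; exact: continuous_measurable_fun.
  - by apply: ae_imp ae => x ->.
rewrite H//.
have iu := locint_mul_test (continuous_locint cw) tf.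
have ig := locint_mul_test (continuous_locint cg) tf.
have -> : (\int[mu]_x ((2 * w x - 2 * g x) * f x) =
    2 * (\int[mu]_x (w x * f x) - \int[mu]_x (g x * f x)))%R.
  rewrite -RintegralB// -RintegralZl//; last exact: (integrableB measurableT iu ig).
  by apply: eq_Rintegral => x _; ring.
by field.
Qed.

(** Continuity turns almost everywhere nonnegativity into nonnegativity everywhere, so the powers in
    the equation are continuous functions of [x]. *)
Lemma elliptic_classical (p beta : R) (s : rpair R) : 1 <= p -> elliptic_solution p beta s ->
  exists S1 S2 V1 V2 : R -> R,
  [/\ (forall x, 0 <= S1 x) /\ (forall x, 0 <= S2 x),
      {ae mu, forall x, s.1 x = S1 x} /\ {ae mu, forall x, s.2 x = S2 x},
      has_deriv S1 V1 /\ has_deriv S2 V2,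
      has_deriv V1 (fun x => 2 * S1 x - 2 * nonlin p beta (S1 x) (S2 x)) /\
      has_deriv V2 (fun x => 2 * S2 x - 2 * nonlin p beta (S2 x) (S1 x)) &
      {ae mu, forall x, wderiv s.1 x = V1 x} /\ {ae mu, forall x, wderiv s.2 x = V2 x}].
Proof.
move=> p1 [[h1 h2] s0 e1 e2].
have w1 := H1_weak h1; have w2 := H1_weak h2.
have [m1 _] := is_weak_deriv_measurable w1.
have [m2 _] := is_weak_deriv_measurable w2.
have [S1 [c1 a1 I1]] := weak_deriv_primitive w1.
have [S2 [c2 a2 I2]] := weak_deriv_primitive w2.
have S10 : forall x, 0 <= S1 x.
  by apply: continuous_ae_ge0 => //; apply: ae_imp2 s0 a1 => x [h _] <-.
have S20 : forall x, 0 <= S2 x.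
  by apply: continuous_ae_ge0 => //; apply: ae_imp2 s0 a2 => x [_ h] <-.
have [||V1 [d1 d1' b1]] := @weak_eq_classical s.1 _ S1
  (fun x => nonlin p beta (S1 x) (S2 x)) h1 e1 _ c1 a1 I1 (continuous_nonlin p1 S10 S20 c1 c2) _.
- exact: measurable_nonlin.
- by apply: ae_imp2 a1 a2 => x -> ->.
have [||V2 [d2 d2' b2]] := @weak_eq_classical s.2 _ S2
  (fun x => nonlin p beta (S2 x) (S1 x)) h2 e2 _ c2 a2 I2 (continuous_nonlin p1 S20 S10 c2 c1) _.
- exact: measurable_nonlin.
- by apply: ae_imp2 a1 a2 => x -> ->.
by exists S1, S2, V1, V2.
Qed.

End Sobolev.

(** * Isolation of classical solutions *)

Section Crossing.
Context {R : realType}.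

(** Near [x] the function [f] increases strictly. A continuous [g] closer to [f] than both gaps
    [f (x + d) - f x] and [f x - f (x - d)] still crosses the level [f x] between [x - d] and
    [x + d]. *)
Lemma level_crossing_pos (f f' : R -> R) (x : R) : has_deriv f f' -> continuous f' ->
  0 < f' x -> forall e : R, 0 < e -> exists2 k : R, 0 < k &
    forall g : R -> R, continuous g ->
    (forall y, `|g y - f y| <= k) -> exists2 y : R, `|y - x| <= e & g y = f x.
Proof.
move=> df cf' f'x e e0.
have /cvgrPdist_lt/(_ _ f'x) := cf' x; rewrite -nbhs_nearE => /nbhs_ballP[h /= h0 Hh].
pose d := Num.min (h / 2) e.
have d0 : 0 < d by rewrite lt_min e0 divr_gt0.
have dh : d < h by rewrite /d gt_min; apply/orP; left; lra.
have de : d <= e by rewrite /d ge_min lexx orbT.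
have pos c : x - d <= c <= x + d -> 0 < f' c.
  move=> /andP[c1 c2]; have /= : `|f' x - f' c| < f' x.
    apply: Hh; rewrite /ball/= ltr_norml; apply/andP; split; lra.
  by move/(le_lt_trans (ler_norm _)); rewrite ltrBlDr ltrDl.
have xd : x <= x + d by rewrite lerDl ltW.
have dx : x - d <= x by rewrite gerBl ltW.
have [c1 /andP[c11 c12] E1] := has_deriv_mvt df xd.
have [c2 /andP[c21 c22] E2] := has_deriv_mvt df dx.
have u1 : 0 < f (x + d) - f x.
  by rewrite E1 mulr_gt0 ?pos ?c12 ?(le_trans dx)// addrAC subrr add0r.
have u2 : 0 < f x - f (x - d).
  by rewrite E2 mulr_gt0 ?pos ?c21 ?(le_trans c22)// opprB addrC subrK.
exists (Num.min (f (x + d) - f x) (f x - f (x - d))); first by rewrite lt_min u1.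
move=> g cg Hg.
have g1 : g (x - d) <= f x.
  have := Hg (x - d); rewrite le_min => /andP[_ /(le_trans (ler_norm _))].
  by rewrite lerD2r.
have g2 : f x <= g (x + d).
  have := Hg (x + d); rewrite le_min distrC => /andP[/(le_trans (ler_norm _)) + _].
  by lra.
have xx : x - d <= x + d by exact: le_trans dx xd.
have [|c cxx gc] := @IVT R g (x - d) (x + d) (f x) xx (continuous_subspaceT cg).
  by rewrite ge_min g1/= le_max g2 orbT.
exists c => //; move: cxx; rewrite in_itv/= ler_norml => /andP[c3 c4].
by apply/andP; split; lra.
Qed.

Lemma level_crossing (f f' : R -> R) (x : R) : has_deriv f f' -> continuous f' ->
  f' x != 0 -> forall e : R, 0 < e -> exists2 k : R, 0 < k &
    forall g : R -> R, continuous g ->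
    (forall y, `|g y - f y| <= k) -> exists2 y : R, `|y - x| <= e & g y = f x.
Proof.
move=> df cf'; rewrite neq_lt => /orP[f'x|f'x]; last exact: level_crossing_pos.
move=> e e0.
have dn : has_deriv (fun y => - f y) (fun y => - f' y).
  by move=> y; have ? := df y; exact: is_deriveN.
have cn : continuous (fun y => - f' y) by move=> y; apply: cvgN; exact: cf'.
have nx : 0 < - f' x by rewrite oppr_gt0.
have [k k0 H] := level_crossing_pos dn cn nx e0; exists k => // g cg Hg.
have [||y yx /oppr_inj gy] := H (fun y => - g y).
- by move=> y; apply: cvgN; exact: cg.
- by move=> y; rewrite -opprD normrN.
by exists y.
Qed.

End Crossing.

(** * Rescaled differences of nearby classical solutions *)

Section ClassicalSolutions.
Context {R : realType}.
Variables p beta : R.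
Hypothesis p1 : 1 <= p.
Local Notation F := (nonlin p beta).

Definition classical_sol (S1 S2 B1 B2 : R -> R) :=
  [/\ (forall x, 0 <= S1 x) /\ (forall x, 0 <= S2 x),
      has_deriv S1 B1 /\ has_deriv S2 B2 &
      has_deriv B1 (fun x => 2 * S1 x - 2 * F (S1 x) (S2 x)) /\
      has_deriv B2 (fun x => 2 * S2 x - 2 * F (S2 x) (S1 x))].

Lemma classical_sol_translate S1 S2 B1 B2 (c : R) : classical_sol S1 S2 B1 B2 ->
  classical_sol (fun x => S1 (x + c)) (fun x => S2 (x + c))
                (fun x => B1 (x + c)) (fun x => B2 (x + c)).
Proof.
have sh (f f' : R -> R) : has_deriv f f' -> has_deriv (fun x => f (x + c)) (fun x => f' (x + c)).
  by move=> df; apply: (has_deriv_ext _ _ (has_deriv_affine 1 c df)) => x /=; rewrite !mul1r.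
by move=> [[a b] [d e] [g h]]; split; split => // *; do ?exact: sh; first exact: (sh _ _ g); exact: (sh _ _ h).
Qed.

Variables r1 r2 A1 A2 : R -> R.
Hypothesis solr : classical_sol r1 r2 A1 A2.
Variable M : R.
Hypothesis bound_r : forall x, r1 x <= M /\ r2 x <= M.
Hypothesis vanish : forall e : R, 0 < e -> exists2 X : R, 0 <= X &
  forall x, X <= `|x| -> r1 x <= e /\ r2 x <= e.
Hypothesis nondeg : forall W1 W2 V1 V2 : R -> R,
  has_deriv W1 V1 /\ has_deriv W2 V2 ->
  has_deriv V1 (fun x => 2 * W1 x - 2 * (nonlin_d1 p beta (r1 x) (r2 x) * W1 x +
                                        nonlin_d2 p beta (r1 x) (r2 x) * W2 x)) /\
  has_deriv V2 (fun x => 2 * W2 x - 2 * (nonlin_d1 p beta (r2 x) (r1 x) * W2 x +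
                                        nonlin_d2 p beta (r2 x) (r1 x) * W1 x)) ->
  (exists2 c : R, 0 <= c & forall x,
       [/\ `|W1 x| <= c * expR (- (2^-1 * `|x|)), `|W2 x| <= c * expR (- (2^-1 * `|x|)),
           `|V1 x| <= c * expR (- (2^-1 * `|x|)) & `|V2 x| <= c * expR (- (2^-1 * `|x|))]) ->
  exists theta : R, W1 = (fun x => theta * A1 x) /\ W2 = (fun x => theta * A2 x).

Let r10 x : 0 <= r1 x. Proof. by case: solr => [[]]. Qed.
Let r20 x : 0 <= r2 x. Proof. by case: solr => [[]]. Qed.
Let M0 : 0 <= M. Proof. by apply: le_trans (r10 0) _; case: (bound_r 0). Qed.

Let cr1 : continuous r1. Proof. by case: solr => _ [/has_deriv_continuous]. Qed.
Let cr2 : continuous r2. Proof. by case: solr => _ [_ /has_deriv_continuous]. Qed.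

(** Bounds on a function and on its second derivative bound its first derivative, by the mean value
    theorem on a unit interval. This controls how far a small translation moves the profile. *)
Lemma profile_lipschitz : exists2 L : R, 0 <= L &
  forall x y, `|r1 y - r1 x| <= L * `|y - x| /\ `|r2 y - r2 x| <= L * `|y - x|.
Proof.
have [_ [d1 d2] [e1 e2]] := solr.
have [K K0 HK] := bounded_lip_nonlin beta p1 M0.
have lip (f f' f'' : R -> R) (a b : R) : has_deriv f f' -> has_deriv f' f'' ->
   0 <= a -> 0 <= b -> (forall x, `|f x| <= a) -> (forall x, `|f'' x| <= b) ->
   forall x y, `|f y - f x| <= (2 * a + b) * `|y - x|.
  move=> df df' a0 b0 fa fb.
  have f'b x : `|f' x| <= 2 * a + b.
    have x1 : x <= x + 1 by rewrite lerDl.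
    have [c /andP[xc cx] e] := has_deriv_mvt df x1.
    move: e; rewrite addrAC subrr add0r mulr1 => e.
    have h1 : `|f' c - f' x| <= b * (c - x) := has_deriv_lip df' xc (fun z _ => fb z).
    have h2 : b * (c - x) <= b by rewrite ler_piMr//; lra.
    have h3 := ler_normB (f' c) (f' c - f' x); rewrite opprB addrC subrK in h3.
    have h4 := ler_normB (f (x + 1)) (f x); rewrite e in h4.
    by have := fa x; have := fa (x + 1); lra.
  move=> x y; have [xy|yx] := leP x y.
    by rewrite [X in _ * X]ger0_norm ?subr_ge0//; apply: (has_deriv_lip df).
  rewrite distrC [X in _ * X]distrC [X in _ * X]gtr0_norm ?subr_gt0//.
  by apply: (has_deriv_lip df) => //; exact: ltW.
have nb (u v : R -> R) : (forall x, 0 <= u x <= M) -> (forall x, 0 <= v x <= M) ->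
    forall x, `|2 * u x - 2 * F (u x) (v x)| <= 2 * M + 2 * K.
  move=> hu hv x; apply: (le_trans (ler_normB _ _)); rewrite !normrM (ger0_norm (ler0n _ 2)).
  have [h _] := HK _ _ _ _ (And4 (hu x) (hv x) (hu x) (hv x)).
  have /andP[u0 uM] := hu x.
  by rewrite (ger0_norm u0); lra.
have b1 x : 0 <= r1 x <= M by rewrite r10; case: (bound_r x).
have b2 x : 0 <= r2 x <= M by rewrite r20; case: (bound_r x) => _ ->.
have MK : 0 <= 2 * M + 2 * K by rewrite addr_ge0// mulr_ge0//; exact: M0.
have n1 x : `|r1 x| <= M by rewrite ger0_norm//; case/andP: (b1 x).
have n2 x : `|r2 x| <= M by rewrite ger0_norm//; case/andP: (b2 x).
exists (2 * M + (2 * M + 2 * K)).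
  by rewrite addr_ge0// mulr_ge0//; exact: M0.
move=> x y; split.
  exact: (lip _ _ _ _ _ d1 e1 M0 MK n1 (nb _ _ b1 b2)).
exact: (lip _ _ _ _ _ d2 e2 M0 MK n2 (nb _ _ b2 b1)).
Qed.

(* [S] packs the two components of a solution with their two derivatives. *)
Definition near_sol (k : R) (S : (R -> R) * (R -> R) * ((R -> R) * (R -> R))) :=
  [/\ classical_sol S.1.1 S.1.2 S.2.1 S.2.2,
      forall x, `|S.1.1 x - r1 x| <= k /\ `|S.1.2 x - r2 x| <= k &
      ~ (S.1.1 = r1 /\ S.1.2 = r2)].

(** Both partial derivatives vanish at the origin, so the Lipschitz constant near it can be made
    arbitrarily small. The value [1/4] leaves a margin in the coercivity estimate. *)
Lemma nonlin_small : exists2 h : R, 0 < h & forall u v u' v' : R,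
  [/\ 0 <= u <= h, 0 <= v <= h, 0 <= u' <= h & 0 <= v' <= h] ->
  `|F u' v' - F u v| <= 4^-1 * (`|u' - u| + `|v' - v|).
Proof.
have [|h h0 H] := sdiff_nonlin beta p1 (lexx (0 : R)) (lexx (0 : R)) (k := 4^-1).
  by rewrite invr_gt0.
exists h => // u v u' v' [/andP[a1 a2] /andP[b1 b2] /andP[c1 c2] /andP[d1 d2]].
have := H u v u' v' (And4 a1 b1 c1 d1); rewrite !subr0 (ger0_norm a1) (ger0_norm b1) (ger0_norm c1) (ger0_norm d1).
move=> /(_ (And4 a2 b2 c2 d2)).
by rewrite nonlin_d1_00// nonlin_d2_00// !mul0r addr0 [X in `|X|]subr0.
Qed.

Section Sequence.
Variables (x0 h k : R) (X : R) (K : R).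
Variable S : nat -> (R -> R) * (R -> R) * ((R -> R) * (R -> R)).
Hypothesis h0 : 0 < h.
Hypothesis k0 : 0 < k.
Hypothesis k1 : k <= 1.
Hypothesis kh : k <= h / 2.
Hypothesis X0 : 0 <= X.
Hypothesis K0 : 0 <= K.
Hypothesis smallF : forall u v u' v' : R,
  [/\ 0 <= u <= h, 0 <= v <= h, 0 <= u' <= h & 0 <= v' <= h] ->
  `|F u' v' - F u v| <= 4^-1 * (`|u' - u| + `|v' - v|).
Hypothesis lipF : forall u v u' v',
  [/\ 0 <= u <= M + 1, 0 <= v <= M + 1, 0 <= u' <= M + 1 & 0 <= v' <= M + 1] ->
  `|F u' v' - F u v| <= K * (`|u' - u| + `|v' - v|).
Hypothesis smallr : forall x, X <= `|x| -> r1 x <= h / 2 /\ r2 x <= h / 2.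
Hypothesis nearS : forall n, near_sol (k / n.+1%:R) (S n).

Let S1 n := (S n).1.1.
Let S2 n := (S n).1.2.
Let B1 n := (S n).2.1.
Let B2 n := (S n).2.2.
Let d1 n x := S1 n x - r1 x.
Let d2 n x := S2 n x - r2 x.
Let e1 n x := B1 n x - A1 x.
Let e2 n x := B2 n x - A2 x.
Let f1 n x := 2 * d1 n x - 2 * (F (S1 n x) (S2 n x) - F (r1 x) (r2 x)).
Let f2 n x := 2 * d2 n x - 2 * (F (S2 n x) (S1 n x) - F (r2 x) (r1 x)).

Let S10 n x : 0 <= S1 n x. Proof. by case: (nearS n) => -[[a _] _ _] _ _; exact: a. Qed.
Let S20 n x : 0 <= S2 n x. Proof. by case: (nearS n) => -[[_ a] _ _] _ _; exact: a. Qed.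

Let dd1 n : has_deriv (d1 n) (e1 n).
Proof.
by case: (nearS n) => -[_ [a _] _] _ _; case: solr => _ [b _] _; exact: has_derivB.
Qed.
Let dd2 n : has_deriv (d2 n) (e2 n).
Proof.
by case: (nearS n) => -[_ [_ a] _] _ _; case: solr => _ [_ b] _; exact: has_derivB.
Qed.
Let de1 n : has_deriv (e1 n) (f1 n).
Proof.
case: (nearS n) => -[_ _ [a _]] _ _; case: solr => _ _ [b _].
by apply: (has_deriv_ext _ _ (has_derivB a b)) => // x; rewrite /f1 /d1 /S1 /S2 /=; ring.
Qed.
Let de2 n : has_deriv (e2 n) (f2 n).
Proof.
case: (nearS n) => -[_ _ [_ a]] _ _; case: solr => _ _ [_ b].
by apply: (has_deriv_ext _ _ (has_derivB a b)) => // x; rewrite /f2 /d2 /S1 /S2 /=; ring.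
Qed.

Let kn n : k / n.+1%:R <= k.
Proof. by rewrite ler_pdivrMr ?ltr0n// ler_peMr ?ler1n// ltW. Qed.

Let dn1 n x : `|d1 n x| <= k / n.+1%:R. Proof. by case: (nearS n) => _ /(_ x)[]. Qed.
Let dn2 n x : `|d2 n x| <= k / n.+1%:R. Proof. by case: (nearS n) => _ /(_ x)[]. Qed.
Let dk1 n x : `|d1 n x| <= k. Proof. exact: le_trans (dn1 n x) (kn n). Qed.
Let dk2 n x : `|d2 n x| <= k. Proof. exact: le_trans (dn2 n x) (kn n). Qed.

Let Sle1 n x c : r1 x <= c -> S1 n x <= c + k.
Proof.
move=> rc; have := le_trans (ler_norm _) (dk1 n x); rewrite /d1 => h1.
by rewrite -(subrK (r1 x) (S1 n x)) addrC lerD.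
Qed.
Let Sle2 n x c : r2 x <= c -> S2 n x <= c + k.
Proof.
move=> rc; have := le_trans (ler_norm _) (dk2 n x); rewrite /d2 => h1.
by rewrite -(subrK (r2 x) (S2 n x)) addrC lerD.
Qed.

Let FK n x : `|F (S1 n x) (S2 n x) - F (r1 x) (r2 x)| <= K * (`|d1 n x| + `|d2 n x|) /\
             `|F (S2 n x) (S1 n x) - F (r2 x) (r1 x)| <= K * (`|d1 n x| + `|d2 n x|).
Proof.
have [a b] := bound_r x; have k1' := k1.
have s1 := Sle1 n a; have s2 := Sle2 n b.
have i1 : 0 <= r1 x <= M + 1 by rewrite r10/=; lra.
have i2 : 0 <= r2 x <= M + 1 by rewrite r20/=; lra.
have i3 : 0 <= S1 n x <= M + 1 by rewrite S10/=; lra.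
have i4 : 0 <= S2 n x <= M + 1 by rewrite S20/=; lra.
split; first exact: lipF.
by rewrite [`|d1 n x| + _]addrC; exact: lipF.
Qed.

Let Fsmall n x : X <= `|x| ->
  `|F (S1 n x) (S2 n x) - F (r1 x) (r2 x)| <= 4^-1 * (`|d1 n x| + `|d2 n x|) /\
  `|F (S2 n x) (S1 n x) - F (r2 x) (r1 x)| <= 4^-1 * (`|d1 n x| + `|d2 n x|).
Proof.
move=> Xx; have [a b] := smallr Xx; have kh' := kh.
have s1 := Sle1 n a; have s2 := Sle2 n b; have h0' := h0.
have i1 : 0 <= r1 x <= h by rewrite r10/=; lra.
have i2 : 0 <= r2 x <= h by rewrite r20/=; lra.
have i3 : 0 <= S1 n x <= h by rewrite S10/=; lra.
have i4 : 0 <= S2 n x <= h by rewrite S20/=; lra.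
split; first exact: smallF.
by rewrite [`|d1 n x| + _]addrC; exact: smallF.
Qed.

Let N n := `|d1 n x0| + `|d2 n x0| + (`|e1 n x0| + `|e2 n x0|).

Let f1K n x : `|f1 n x| <= (2 + 2 * K) * (`|d1 n x| + `|d2 n x|).
Proof.
have [a _] := FK n x; apply: (le_trans (ler_normB _ _)); rewrite !normrM (ger0_norm (ler0n _ 2)).
by have := normr_ge0 (d2 n x); lra.
Qed.
Let f2K n x : `|f2 n x| <= (2 + 2 * K) * (`|d1 n x| + `|d2 n x|).
Proof.
have [_ a] := FK n x; apply: (le_trans (ler_normB _ _)); rewrite !normrM (ger0_norm (ler0n _ 2)).
by have := normr_ge0 (d1 n x); lra.
Qed.

(** Equal Cauchy data at [x0] would force [S n] to coincide with the profile, which [near_sol]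
    excludes. *)
Let N0 n : 0 < N n.
Proof.
rewrite lt_neqAle !addr_ge0// andbT eq_sym; apply/eqP => N0.
have [z1 z2 z3 z4] : [/\ d1 n x0 = 0, d2 n x0 = 0, e1 n x0 = 0 & e2 n x0 = 0].
  have := normr_ge0 (d1 n x0); have := normr_ge0 (d2 n x0).
  have := normr_ge0 (e1 n x0); have := normr_ge0 (e2 n x0).
  move: N0; rewrite /N => N0 a b c d.
  by split; apply: normr0_eq0; lra.
case: (nearS n) => _ _; apply.
have K2 : 0 <= 2 + 2 * K by have := K0; lra.
have z := second_order_unique K2 (dd1 n) (dd2 n) (de1 n) (de2 n) (f1K n) (f2K n) z1 z2 z3 z4.
split; apply/funext => x; have [y1 y2] := z x.
  by move/eqP: y1; rewrite subr_eq0 => /eqP.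
by move/eqP: y2; rewrite subr_eq0 => /eqP.
Qed.

Let nd (g : nat -> R -> R) n x := (N n)^-1 * g n x.

Let ndE (g : nat -> R -> R) n x : `|nd g n x| = (N n)^-1 * `|g n x|.
Proof. by rewrite normrM gtr0_norm// invr_gt0. Qed.

Let i0 n : 0 <= (N n)^-1. Proof. by rewrite invr_ge0 ltW. Qed.

Let nd_deriv (g g' : nat -> R -> R) n : has_deriv (g n) (g' n) -> has_deriv (nd g n) (nd g' n).
Proof. exact: has_derivZ. Qed.

Let nd_le (g : nat -> R -> R) (c : R) n x : `|g n x| <= c * (`|d1 n x| + `|d2 n x|) ->
  `|nd g n x| <= c * (`|nd d1 n x| + `|nd d2 n x|).
Proof.
by move=> H; rewrite !ndE -mulrDr mulrCA ler_wpM2l.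
Qed.

Let kcvg (e : R) : 0 < e -> exists m, forall n, (m <= n)%N -> k / n.+1%:R <= e.
Proof.
move=> e0; have c : k * n.+1%:R^-1 @[n --> \oo] --> (0 : R).
  by rewrite -(mulr0 k); apply: cvgM; [exact: cvg_cst|exact: cvg_harmonic].
move/cvgrPdist_le : c => /(_ e e0) [m _ Hm]; exists m => n /Hm.
by rewrite sub0r normrN => /(le_trans (ler_norm _)).
Qed.

(** The points [(u n y, v n y)] and [(ru y, rv y)] both vary while the derivative is taken at
    [(ru x, rv x)]; strict differentiability is exactly this statement. *)
Let lin_lim (u v du dv : nat -> R -> R) (ru rv : R -> R) (f : nat -> R -> R) x :
  (forall y, 0 <= ru y) -> (forall y, 0 <= rv y) -> continuous ru -> continuous rv ->
  (forall n y, 0 <= u n y) -> (forall n y, 0 <= v n y) ->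
  (forall n y, `|u n y - ru y| <= k / n.+1%:R) -> (forall n y, `|v n y - rv y| <= k / n.+1%:R) ->
  forall c : R, 0 < c -> exists2 h : R, 0 < h & exists m, forall n (y : R),
  (m <= n)%N -> `|y - x| <= h ->
  `|F (u n y) (v n y) - F (ru y) (rv y) - (nonlin_d1 p beta (ru x) (rv x) * (u n y - ru y)
     + nonlin_d2 p beta (ru x) (rv x) * (v n y - rv y))| <= c * (`|u n y - ru y| + `|v n y - rv y|).
Proof.
move=> ru0 rv0 cu cv u0 v0 hu hv c c0.
have [h' h'0 H] := sdiff_nonlin beta p1 (ru0 x) (rv0 x) c0.
have h'2 : 0 < h' / 2 by rewrite divr_gt0.
have /cvgrPdist_le/(_ _ h'2) := cu x; rewrite -nbhs_nearE => /nbhs_ballP[a /= a0 Ha].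
have /cvgrPdist_le/(_ _ h'2) := cv x; rewrite -nbhs_nearE => /nbhs_ballP[b /= b0 Hb].
have [m Hm] := kcvg h'2.
exists (Num.min (a / 2) (b / 2)); first by rewrite lt_min !divr_gt0.
exists m => n y mn; rewrite le_min => /andP[ya yb].
have q1 : `|ru y - ru x| <= h' / 2 by rewrite distrC; apply: Ha; rewrite /ball/= distrC; lra.
have q2 : `|rv y - rv x| <= h' / 2 by rewrite distrC; apply: Hb; rewrite /ball/= distrC; lra.
have q3 : `|u n y - ru y| <= h' / 2 := le_trans (hu n y) (Hm n mn).
have q4 : `|v n y - rv y| <= h' / 2 := le_trans (hv n y) (Hm n mn).
apply: H; split => //; try lra.
- have := ler_normD (u n y - ru y) (ru y - ru x); rewrite addrA subrK; lra.
- have := ler_normD (v n y - rv y) (rv y - rv x); rewrite addrA subrK; lra.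
Qed.

Lemma no_near_solutions : (forall n, S1 n x0 = r1 x0) /\ A1 x0 != 0 \/
  (forall n, S2 n x0 = r2 x0) /\ A2 x0 != 0 -> False.
Proof.
move=> level.
(* The limit equation is [W'' = 2 W - 2 dF W], hence the coefficients [2 - 2 * nonlin_d1] and
   [- 2 * nonlin_d2]. Multiplication by [2] is why [lin_lim] is called with [c / 2]. *)
have lim1 x c : 0 < c -> exists2 h : R, 0 < h & exists m, forall n (y : R),
  (m <= n)%N -> `|y - x| <= h ->
  `|nd f1 n y - ((2 - 2 * nonlin_d1 p beta (r1 x) (r2 x)) * nd d1 n y +
                 (- 2 * nonlin_d2 p beta (r1 x) (r2 x)) * nd d2 n y)| <=
  c * (`|nd d1 n y| + `|nd d2 n y|).
  move=> c0; have c20 : 0 < c / 2 by rewrite divr_gt0.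
  have [h' h'0 [m Hm]] := @lin_lim S1 S2 d1 d2 r1 r2 f1 x r10 r20 cr1 cr2 S10 S20 dn1 dn2 _ c20.
  exists h' => //; exists m => n y mn yx; have Q := Hm n y mn yx.
  pose g (n : nat) (y : R) := f1 n y - ((2 - 2 * nonlin_d1 p beta (r1 x) (r2 x)) * d1 n y +
                 (- 2 * nonlin_d2 p beta (r1 x) (r2 x)) * d2 n y).
  rewrite (_ : _ - _ = nd g n y); last by rewrite /nd /g; ring.
  apply: nd_le; rewrite /g.
  rewrite (_ : _ - _ = - 2 * (F (S1 n y) (S2 n y) - F (r1 y) (r2 y) - (nonlin_d1 p beta (r1 x) (r2 x) * d1 n y
     + nonlin_d2 p beta (r1 x) (r2 x) * d2 n y))); last by rewrite /f1; ring.
  by rewrite normrM normrN (ger0_norm (ler0n _ 2)); move: Q; rewrite -/(d1 n y) -/(d2 n y); lra.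
have lim2 x c : 0 < c -> exists2 h : R, 0 < h & exists m, forall n (y : R),
  (m <= n)%N -> `|y - x| <= h ->
  `|nd f2 n y - ((- 2 * nonlin_d2 p beta (r2 x) (r1 x)) * nd d1 n y +
                 (2 - 2 * nonlin_d1 p beta (r2 x) (r1 x)) * nd d2 n y)| <=
  c * (`|nd d1 n y| + `|nd d2 n y|).
  move=> c0; have c20 : 0 < c / 2 by rewrite divr_gt0.
  have [h' h'0 [m Hm]] := @lin_lim S2 S1 d2 d1 r2 r1 f2 x r20 r10 cr2 cr1 S20 S10 dn2 dn1 _ c20.
  exists h' => //; exists m => n y mn yx; have Q := Hm n y mn yx.
  pose g (n : nat) (y : R) := f2 n y - ((- 2 * nonlin_d2 p beta (r2 x) (r1 x)) * d1 n y +
                 (2 - 2 * nonlin_d1 p beta (r2 x) (r1 x)) * d2 n y).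
  rewrite (_ : _ - _ = nd g n y); last by rewrite /nd /g; ring.
  apply: nd_le; rewrite /g.
  rewrite (_ : _ - _ = - 2 * (F (S2 n y) (S1 n y) - F (r2 y) (r1 y) - (nonlin_d1 p beta (r2 x) (r1 x) * d2 n y
     + nonlin_d2 p beta (r2 x) (r1 x) * d1 n y))); last by rewrite /f2; ring.
  by rewrite normrM normrN (ger0_norm (ler0n _ 2)); move: Q; rewrite -/(d1 n y) -/(d2 n y); lra.
(* The nonlinear terms cost at most [(1/2) (|a1| + |a2|)^2 <= a1^2 + a2^2], out of the
   [2 (a1^2 + a2^2)] given by the linear part. *)
have coer n x : X <= `|x| -> 2^-1 * (nd d1 n x ^+ 2 + nd d2 n x ^+ 2) <=
    nd d1 n x * nd f1 n x + nd d2 n x * nd f2 n x.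
  move=> Xx; have [a b] := Fsmall n Xx.
  rewrite (_ : nd d1 n x * _ + _ = (N n)^-1 ^+ 2 * (d1 n x * f1 n x + d2 n x * f2 n x)); last first.
    by rewrite /nd; ring.
  rewrite (_ : 2^-1 * _ = (N n)^-1 ^+ 2 * (2^-1 * (d1 n x ^+ 2 + d2 n x ^+ 2))); last first.
    by rewrite /nd; ring.
  rewrite ler_wpM2l ?sqr_ge0//.
  move: a b; rewrite /f1 /f2; set G1 := F _ _ - F _ _; set G2 := F _ _ - F _ _.
  set a1 := d1 n x; set a2 := d2 n x => H1 H2.
  have t1 : a1 * G1 <= `|a1| * (4^-1 * (`|a1| + `|a2|)).
    by apply: (le_trans (ler_norm _)); rewrite normrM ler_wpM2l.
  have t2 : a2 * G2 <= `|a2| * (4^-1 * (`|a1| + `|a2|)).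
    by apply: (le_trans (ler_norm _)); rewrite normrM ler_wpM2l.
  have t3 := sqr_ge0 (`|a1| - `|a2|).
  have t4 := sqr_abs a1; have t5 := sqr_abs a2.
  have t6 := sqr_ge0 a1; have t7 := sqr_ge0 a2.
  rewrite expr2 in t3; rewrite !expr2 in t4 t5 t6 t7 *; lra.
(* This bound contains the inverse of [N n] and need not be uniform in [n]. *)
have bdd n : exists B : R, forall x, nd d1 n x ^+ 2 + nd d2 n x ^+ 2 <= B.
  exists ((N n)^-1 ^+ 2 * (k ^+ 2 + k ^+ 2)) => x.
  rewrite (_ : _ + _ = (N n)^-1 ^+ 2 * (`|d1 n x| ^+ 2 + `|d2 n x| ^+ 2)); last first.
    by rewrite !sqr_abs /nd; ring.
  have k0' := ltW k0.
  rewrite ler_wpM2l ?sqr_ge0// lerD// ler_pXn2r ?nnegrE//.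
have K2 : 0 <= 2 + 2 * K by rewrite addr_ge0// mulr_ge0.
have norm1 n : `|nd d1 n x0| + `|nd d2 n x0| + (`|nd e1 n x0| + `|nd e2 n x0|) = 1.
  by rewrite !ndE -!mulrDr mulVf// gt_eqF.
have [W1 [W2 [V1 [V2 [dW dV dec nW [z1 z2]]]]]] := linearized_limit X0 K2
  (fun n => nd_deriv (dd1 n)) (fun n => nd_deriv (dd2 n))
  (fun n => nd_deriv (de1 n)) (fun n => nd_deriv (de2 n))
  (fun n x => nd_le (f1K n x)) (fun n x => nd_le (f2K n x)) coer bdd norm1 lim1 lim2.
have [theta [E1 E2]] : exists theta : R, W1 = (fun x => theta * A1 x) /\ W2 = (fun x => theta * A2 x).
  apply: (nondeg dW _ dec); case: dV => dV1 dV2; split.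
    by apply: (has_deriv_ext _ _ dV1) => // x; ring.
  by apply: (has_deriv_ext _ _ dV2) => // x; ring.
have th0 : theta = 0.
  case: level => -[lv Ax]; apply/eqP; rewrite -(mulIr_eq0 _ (mulIf Ax)); apply/eqP.
    by move: z1; rewrite E1; apply => n; rewrite /nd /d1 lv subrr mulr0.
  by move: z2; rewrite E2; apply => n; rewrite /nd /d2 lv subrr mulr0.
have W10 : W1 = fun=> 0 by rewrite E1 th0; apply/funext => x; rewrite mul0r.
have W20 : W2 = fun=> 0 by rewrite E2 th0; apply/funext => x; rewrite mul0r.
have dc : has_deriv (fun=> 0 : R) (fun=> 0 : R) by move=> x; exact: is_derive_cst.
case: dW => dW1 dW2.
have V10 : V1 = fun=> 0 by rewrite -(has_deriv_derive1 dW1) W10 (has_deriv_derive1 dc).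
have V20 : V2 = fun=> 0 by rewrite -(has_deriv_derive1 dW2) W20 (has_deriv_derive1 dc).
move: nW; rewrite W10 W20 V10 V20 normr0 !addr0 => /esym/eqP.
by rewrite oner_eq0.
Qed.

End Sequence.

Lemma classical_isolated (x0 : R) : A1 x0 != 0 \/ A2 x0 != 0 ->
  exists2 e : R, 0 < e & forall S1 S2 B1 B2 : R -> R, classical_sol S1 S2 B1 B2 ->
    (forall x, `|S1 x - r1 x| <= e /\ `|S2 x - r2 x| <= e) ->
    exists c : R, forall x, S1 x = r1 (x - c) /\ S2 x = r2 (x - c).
Proof.
move=> Ax; apply: contrapT => notiso.
have nQ (e : R) : 0 < e -> exists S : (R -> R) * (R -> R) * ((R -> R) * (R -> R)),
    [/\ classical_sol S.1.1 S.1.2 S.2.1 S.2.2,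
        forall x, `|S.1.1 x - r1 x| <= e /\ `|S.1.2 x - r2 x| <= e &
        ~ exists c : R, forall x, S.1.1 x = r1 (x - c) /\ S.1.2 x = r2 (x - c)].
  move=> e0; apply: contrapT => nS; apply: notiso; exists e => // S1 S2 B1 B2 cs cl.
  by apply: contrapT => nc; apply: nS; exists ((S1, S2), (B1, B2)).
have [L L0 HL] := profile_lipschitz.
have L1 : 0 < L + 1 by rewrite ltr_wpDl.
(* Half of [k] pays for the distance to the profile and half for the translation; [L + 1] replaces
   [L] to allow division. *)
have shift (k e c : R) S : 0 < k -> classical_sol S.1.1 S.1.2 S.2.1 S.2.2 ->
    (forall x, `|S.1.1 x - r1 x| <= e /\ `|S.1.2 x - r2 x| <= e) ->
    (~ exists c : R, forall x, S.1.1 x = r1 (x - c) /\ S.1.2 x = r2 (x - c)) ->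
    e <= k / 2 -> `|c| <= k / 2 / (L + 1) ->
    near_sol k (((fun x => S.1.1 (x + c)), (fun x => S.1.2 (x + c))),
                ((fun x => S.2.1 (x + c)), (fun x => S.2.2 (x + c)))).
  move=> k0 cs cl ns ek ck; split; first exact: classical_sol_translate.
    have Lc : L * `|c| <= k / 2.
      apply: (@le_trans _ _ ((L + 1) * `|c|)); first by rewrite ler_wpM2r// lerDl.
      by rewrite mulrC -ler_pdivlMr.
    move=> x; have [l1 l2] := HL x (x + c); have [m1 m2] := cl (x + c).
    rewrite addrAC subrr add0r in l1 l2; split=> /=.
      rewrite -(subrKA (r1 (x + c))); apply: (le_trans (ler_normD _ _)); lra.
    rewrite -(subrKA (r2 (x + c))); apply: (le_trans (ler_normD _ _)); lra.
  move=> [/= E1 E2]; apply: ns; exists c => x.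
  by rewrite -E1 -E2 !subrK.
(* The matched component depends only on [x0], so it is the same for the whole sequence. *)
pose level (S : (R -> R) * (R -> R) * ((R -> R) * (R -> R))) :=
  (A1 x0 != 0 -> S.1.1 x0 = r1 x0) /\ (A1 x0 = 0 -> S.1.2 x0 = r2 x0).
have [_ [dr1 dr2] [dA1 dA2]] := solr.
have near_level (k : R) : 0 < k -> exists S, near_sol k S /\ level S.
  move=> k0; have eta0 : 0 < k / 2 / (L + 1) by rewrite !divr_gt0.
  have [A1x|A1x] := eqVneq (A1 x0) 0.
    have A2x : A2 x0 != 0 by case: Ax => //; rewrite A1x eqxx.
    have [e e0 He] := level_crossing dr2 (has_deriv_continuous dA2) A2x eta0.
    have [|S [cs cl ns]] := nQ (Num.min e (k / 2)); first by rewrite lt_min e0 divr_gt0.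
    have cS : continuous S.1.2 by case: cs => _ [_ /has_deriv_continuous].
    have [|y yx Sy] := He _ cS.
      by move=> y; have [_] := cl y; rewrite le_min => /andP[].
    eexists; split; first by apply: (shift _ _ (y - x0) _ k0 cs cl ns) => //; rewrite ge_min lexx orbT.
    by split=> /=; [rewrite A1x eqxx|rewrite addrC subrK].
  have [e e0 He] := level_crossing dr1 (has_deriv_continuous dA1) A1x eta0.
  have [|S [cs cl ns]] := nQ (Num.min e (k / 2)); first by rewrite lt_min e0 divr_gt0.
  have cS : continuous S.1.1 by case: cs => _ [/has_deriv_continuous].
  have [|y yx Sy] := He _ cS.
    by move=> y; have [+ _] := cl y; rewrite le_min => /andP[].
  eexists; split; first by apply: (shift _ _ (y - x0) _ k0 cs cl ns) => //; rewrite ge_min lexx orbT.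
  by split=> /=; [rewrite addrC subrK|move=> /eqP; rewrite (negbTE A1x)].
have [h h0 smallF] := nonlin_small.
have M10 : 0 <= M + 1 by rewrite addr_ge0//; exact: M0.
have [K K0 HK] := bounded_lip_nonlin beta p1 M10.
have h2 : 0 < h / 2 by rewrite divr_gt0.
have [X X0 HX] := vanish h2.
(* With [k <= 1] the solutions take values in [[0, M + 1]], where the Lipschitz bound holds; with
   [k <= h / 2] they take values in [[0, h]] wherever [r] is below [h / 2]. *)
pose k := Num.min 1 (h / 2).
have k0 : 0 < k by rewrite lt_min ltr01.
have k1 : k <= 1 by rewrite /k ge_min lexx.
have kh : k <= h / 2 by rewrite /k ge_min lexx orbT.
have kn n : 0 < k / n.+1%:R by rewrite divr_gt0.
have [S HS] := choice (fun n => near_level _ (kn n)).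
apply: (@no_near_solutions x0 h k X K S h0 k0 k1 kh X0 K0 smallF _ HX).
- by move=> u v u' v' A; have [] := HK _ _ _ _ A.
- by move=> n; case: (HS n).
have [A1x|A1x] := eqVneq (A1 x0) 0.
  right; split; last by case: Ax => //; rewrite A1x eqxx.
  by move=> n; have [_ [_]] := HS n; apply.
by left; split => // n; have [_ [+ _]] := HS n; apply.
Qed.

End ClassicalSolutions.

(** * Continuity and decay of the coefficients, and the conclusion for ground states *)

Section Main.
Context {R : realType}.
Notation mu := (@lebesgue_measure R).

Lemma continuous_powR_comp (u : R -> R) (a : R) : 0 <= a -> (forall x, 0 <= u x) ->
  continuous u -> continuous (fun x => u x `^ a).
Proof.
move=> a0 u0 cu x; apply/cvgrPdist_le => e e0.
have [h h0 H] := powR_cvg a0 (u0 x) e0.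
have /cvgrPdist_le/(_ h h0) cux := cu x.
by near=> z; rewrite distrC; apply: H => //; rewrite distrC; near: z.
Unshelve. all: by end_near. Qed.

Lemma continuous_linearization (p beta : R) (u v w z : R -> R) : 1 <= p ->
  (forall x, 0 <= u x) -> (forall x, 0 <= v x) ->
  continuous u -> continuous v -> continuous w -> continuous z ->
  continuous (fun x => nonlin_d1 p beta (u x) (v x) * w x + nonlin_d2 p beta (u x) (v x) * z x).
Proof.
move=> p1 u0 v0 cu cv cw cz.
have pu (a : R) : 0 <= a -> continuous (fun x => u x `^ a).
  by move=> a0; exact: continuous_powR_comp.
have pv (a : R) : 0 <= a -> continuous (fun x => v x `^ a).
  by move=> a0; exact: continuous_powR_comp.
have p0 : 0 <= p by lra.
have p20 : 0 <= 2 * p by lra.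
have pm1 : 0 <= p - 1 by lra.
have pp1 : 0 <= p + 1 by lra.
have cst (a : R) : continuous (fun _ : R => a) by move=> x; exact: cvg_cst.
move=> x; apply: cvgD; apply: cvgM; [|exact: cw| |exact: cz].
  apply: cvgD; first by apply: cvgM; [exact: cst|exact: pu].
  by apply: cvgM; [apply: cvgM; [exact: cst|exact: pu]|exact: pv].
by apply: cvgM; [apply: cvgM; [exact: cst|exact: pu]|exact: pv].
Qed.

Lemma decay_vanish (f : R -> R) (C c : R) : 0 < c ->
  (forall x, `|f x| <= C * expR (- (c * `|x|))) ->
  (forall x, `|f x| <= C) /\
  forall e : R, 0 < e -> exists2 X : R, 0 <= X & forall x, X <= `|x| -> `|f x| <= e.
Proof.
move=> c0 H.
have C0 : 0 <= C.
  have := H 0; rewrite normr0 mulr0 oppr0 expR0 mulr1; exact: le_trans.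
split=> [x|e e0].
  apply: (le_trans (H x)); rewrite ler_piMr//.
  by rewrite -[leRHS]expR0 ler_expR oppr_le0 mulr_ge0// ltW.
have ce : 0 < c * e by rewrite mulr_gt0.
(* Beyond this radius [C <= e * (c * |x|)], and [expR t >= 1 + t] concludes. *)
exists (C / (c * e)); first by rewrite divr_ge0// ltW.
move=> x Xx; apply: (le_trans (H x)).
rewrite expRN -ler_pdivlMr ?invr_gt0 ?expR_gt0// invrK.
apply: (@le_trans _ _ (e * (1 + c * `|x|))); last first.
  by rewrite ler_wpM2l ?(ltW e0)//; exact: expR_ge1Dx.
have := Xx; rewrite ler_pdivrMr// => h; lra.
Qed.

Lemma regular_profile_cont (u : R -> R) : regular_profile u -> continuous u.
Proof.
move=> [[d _ _] _ _ _ _] x; apply: differentiable_continuous; exact/derivable1_diffP.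
Qed.

End Main.

Theorem corollary1p3 (R : realType) (p beta : R) (hbeta : 0 < beta)
    (hp : 1 <= p < 2) (r : rpair R)
    (hr : ground_state p beta r) (hrn : normalized p beta r)
    (hnd : nondegenerate_state p beta r) :
  exists2 delta : R, 0 < delta &
    forall s : rpair R, ground_state p beta s ->
      H1norm (subp (pairC r) (pairC s)) < delta ->
      exists x0 theta1 theta2 : R,
        ae_eqpC (pairC s) (phase_translate theta1 theta2 x0 r).
Proof.
case: r hr hrn hnd => r1 r2 [er nz _] [/= reg1 reg2 _] [_ hnd].
have /andP[p1 _] := hp.
have [S1 [S2 [A1 [A2 [S0 [a1 a2] dS dA [b1 b2]]]]]] := elliptic_classical p1 er.
have cr1 := regular_profile_cont reg1; have cr2 := regular_profile_cont reg2.
(* The normalized profile is itself continuous, so it equals its classical representative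
   everywhere, not just almost everywhere. *)
have E1 : r1 = S1 by apply: continuous_ae_eq => //; case: dS => /has_deriv_continuous.
have E2 : r2 = S2 by apply: continuous_ae_eq => //; case: dS => _ /has_deriv_continuous.
subst S1 S2.
have sol : classical_sol p beta r1 r2 A1 A2 by split.
have [_ _ _ _ [C1 [c1 [c10 H1']]]] := reg1.
have [_ _ _ _ [C2 [c2 [c20 H2']]]] := reg2.
have [bd1 va1] := decay_vanish c10 H1'; have [bd2 va2] := decay_vanish c20 H2'.
have [r10 r20] := S0.
pose M := Num.max C1 C2.
have bM x : r1 x <= M /\ r2 x <= M.
  rewrite !le_max (le_trans (ler_norm _) (bd1 x)) (le_trans (ler_norm _) (bd2 x)).
  by rewrite orbT.
have vanish (e : R) : 0 < e -> exists2 X : R, 0 <= X &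
    forall x, X <= `|x| -> r1 x <= e /\ r2 x <= e.
  move=> e0; have [X X0 HX] := va1 e e0; have [Y Y0 HY] := va2 e e0.
  exists (Num.max X Y); first by rewrite le_max X0.
  move=> x; rewrite ge_max => /andP[hx hy].
  by split; apply: (le_trans (ler_norm _)); [exact: HX|exact: HY].
have ndg (W1 W2 V1 V2 : R -> R) : has_deriv W1 V1 /\ has_deriv W2 V2 ->
  has_deriv V1 (fun x => 2 * W1 x - 2 * (nonlin_d1 p beta (r1 x) (r2 x) * W1 x +
                                        nonlin_d2 p beta (r1 x) (r2 x) * W2 x)) /\
  has_deriv V2 (fun x => 2 * W2 x - 2 * (nonlin_d1 p beta (r2 x) (r1 x) * W2 x +
                                        nonlin_d2 p beta (r2 x) (r1 x) * W1 x)) ->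
  (exists2 c : R, 0 <= c & forall x,
       [/\ `|W1 x| <= c * expR (- (2^-1 * `|x|)), `|W2 x| <= c * expR (- (2^-1 * `|x|)),
           `|V1 x| <= c * expR (- (2^-1 * `|x|)) & `|V2 x| <= c * expR (- (2^-1 * `|x|))]) ->
  exists theta : R, W1 = (fun x => theta * A1 x) /\ W2 = (fun x => theta * A2 x).
  move=> [dW1 dW2] [dV1 dV2] [c _ Hc].
  have cW1 := has_deriv_continuous dW1; have cW2 := has_deriv_continuous dW2.
  have cV1 := has_deriv_continuous dV1; have cV2 := has_deriv_continuous dV2.
  have cg1 := @continuous_linearization R p beta _ _ _ _ p1 r10 r20 cr1 cr2 cW1 cW2.
  have cg2 := @continuous_linearization R p beta _ _ _ _ p1 r20 r10 cr2 cr1 cW2 cW1.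
  have lin : linearized_solution p beta (r1, r2) (W1, W2).
    split=> /=.
    - by apply: (H1_decay dW1 cV1 (c := c)) => x; have [] := Hc x.
    - by apply: (H1_decay dW2 cV2 (c := c)) => x; have [] := Hc x.
    - exact: (classical_weak_eq dW1 dV1 cg1).
    (* The second linearized equation is the first with the components exchanged, up to the order of
       factors. *)
    - have := classical_weak_eq dW2 dV2 cg2; congr weak_eq; apply/funext => x.
      by rewrite /nonlin_d1 /nonlin_d2; ring.
  (* Nondegeneracy speaks of [wderiv] almost everywhere; since [A1] and [A2] are its continuous
     representatives, the identity holds at every point. *)
  have [theta th] := hnd _ lin; exists theta.
  have cA1 : continuous A1 by case: dA => /has_deriv_continuous.
  have cA2 : continuous A2 by case: dA => _ /has_deriv_continuous.
  have cZ (f : R -> R) : continuous f -> continuous (fun x => theta * f x).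
    by move=> cf x; apply: cvgM; [exact: cvg_cst|exact: cf].
  split.
    apply: continuous_ae_eq => //; first exact: cZ.
    by apply: ae_imp2 th b1 => x [/= -> _] ->.
  apply: continuous_ae_eq => //; first exact: cZ.
  by apply: ae_imp2 th b2 => x [_ /= ->] ->.
(* If [r'] vanished identically, [r] would be constant and, tending to zero at infinity, would be
   zero. *)
have [x0 Ax] : exists x0, A1 x0 != 0 \/ A2 x0 != 0.
  apply: contrapT => nA; apply: nz.
  have z1 x : A1 x = 0 by apply/eqP; apply: contrapT => /negP h; apply: nA; exists x; left.
  have z2 x : A2 x = 0 by apply/eqP; apply: contrapT => /negP h; apply: nA; exists x; right.
  have zero (f f' : R -> R) : has_deriv f f' -> (forall x, f' x = 0) ->
      (forall e : R, 0 < e -> exists2 X : R, 0 <= X & forall x, X <= `|x| -> `|f x| <= e) ->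
      forall x, f x = 0.
    move=> df f'0 va x; apply/eqP; rewrite -normr_eq0 eq_le normr_ge0 andbT.
    apply/ler_addgt0Pr => e e0; rewrite add0r.
    have [X X0 HX] := va e e0.
    have xy : x <= `|x| + X by apply: (le_trans (ler_norm x)); rewrite lerDl.
    have [c _] := has_deriv_mvt df xy; rewrite f'0 mul0r => /eqP; rewrite subr_eq0 => /eqP <-.
    by apply: HX; rewrite ger0_norm ?addr_ge0// lerDr.
  have [dr1 dr2] := dS.
  apply: aeW => x /=; split; first exact: (zero _ _ dr1 z1 va1).
  exact: (zero _ _ dr2 z2 va2).
have [e e0 He] := classical_isolated p1 sol bM vanish ndg Ax.
(* The factor [3] is that of [sobolev_sup], which turns H^1 closeness into uniform closeness. *)
exists (e / 3); first by rewrite divr_gt0.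
move=> [s1 s2] [es _ _] close.
have [T1 [T2 [B1 [B2 [T0 [ta1 ta2] dT dB _]]]]] := elliptic_classical p1 es.
have [[hr1 hr2] _ _ _] := er; have [[hs1 hs2] _ _ _] := es.
have e3 : 0 < e / 3 by rewrite divr_gt0.
have nrm : H1norm (subp (pairC (r1, r2)) (pairC (s1, s2))) ^+ 2 <= (e / 3) ^+ 2.
  by rewrite ler_pXn2r ?nnegrE ?(ltW close) ?(ltW e3)// sqrtr_ge0.
rewrite H1norm_real// addrACA in nrm.
have sup (u v U V : R -> R) : H1 u -> H1 v -> continuous U -> continuous V ->
    {ae lebesgue_measure, forall x, u x = U x} -> {ae lebesgue_measure, forall x, v x = V x} ->
    (\int[lebesgue_measure]_x (wderiv (fun y => u y - v y) x ^+ 2) + \int[lebesgue_measure]_x ((u x - v x) ^+ 2) <= (e / 3) ^+ 2)%R ->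
    forall x, `|V x - U x| <= e.
  move=> hu hv cU cV uU vV le_e x.
  have huv := H1B hu hv; have [i1 i2] := H1_sqr_integrable huv.
  have [D [cD dD HD]] := weak_deriv_primitive (H1_weak huv).
  have := sobolev_sup e3 (H1_weak huv) i1 i2 cD dD HD le_e x.
  (* [D] is the continuous representative of the difference, hence the difference of the continuous
     representatives. *)
  have -> : D = (fun x => U x - V x).
    apply: continuous_ae_eq => //; first by move=> y; apply: cvgB; [exact: cU|exact: cV].
    by apply: ae_imp2 dD (ae_imp2 (fun y h1 h2 => conj h1 h2) uU vV) => y <- [-> ->].
  by rewrite distrC mulrC divfK.
have pos (f : R -> R) : 0 <= (\int[lebesgue_measure]_x (f x ^+ 2))%R.
  by apply: Rintegral_ge0 => x _; exact: sqr_ge0.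
have cT1 : continuous T1 by case: dT => /has_deriv_continuous.
have cT2 : continuous T2 by case: dT => _ /has_deriv_continuous.
have p1' := pos (wderiv (fun y => r1 y - s1 y)); have p2' := pos (wderiv (fun y => r2 y - s2 y)).
have p3' := pos (fun y => r1 y - s1 y); have p4' := pos (fun y => r2 y - s2 y).
have cl x : `|T1 x - r1 x| <= e /\ `|T2 x - r2 x| <= e.
  split.
    apply: (sup r1 s1 r1 T1 hr1 hs1 cr1 cT1 _ ta1); first exact: aeW.
    by apply: le_trans nrm; rewrite lerDl addr_ge0.
  apply: (sup r2 s2 r2 T2 hr2 hs2 cr2 cT2 _ ta2); first exact: aeW.
  exact: (le_trans (ler_wpDl (addr_ge0 p1' p3') (lexx _)) nrm).
have [c Hc] := He T1 T2 B1 B2 (And3 T0 dT dB) cl.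
(* Both states are real with nonnegative components, and a translation alone relates them, so the
   phases are zero. *)
exists c, 0, 0.
have expi0 : expi (0 : R) = 1 by rewrite /expi cos0 sin0.
apply: ae_imp2 ta1 ta2 => x /= -> ->; rewrite /phase_translate/= expi0 !mul1r.
by have [-> ->] := Hc x.
Qed.
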